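(* Let $V=(V(t))_{t\ge 0}$ be a centered homogeneous random process with independent increments such that $V(0)=0$ and ${\bf E}(V(1))^2=\sigma^2<\infty$, $\sigma\ge 0$. For $t>0$ let $$ X_t(x)=\frac{1}{\sqrt{t}}V(tx). $$ Then $$ X_t\stackrel{d}{\to}\sigma W\qquad\text{as } t\to\infty $$ in $D[0,1]$ endowed with the topology of uniform convergence, where $W$ is the standard Wiener process.
   Context: ''Homogeneous'' means that the increments are stationary: the law of $V(t+h)-V(t)$ depends only on $h$. ''Centered'' means ${\bf E}V(t)=0$ for all $t\ge0$. Almost all sample paths of $V$ are right-continuous with left limits, so that almost all sample paths of $X_t$, restricted to $x\in[0,1]$, belong to $D[0,1]$, the space of real functions on $[0,1]$ that are right-continuous with left limits. Random processes are identified with the corresponding random elements of $D[0,1]$. $\stackrel{d}{\to}$ denotes convergence in distribution. Since $D[0,1]$ with the uniform metric is not separable, convergence in distribution for the uniform topology is understood in the usual sense (Pollard): $Z_t\stackrel{d}{\to}Z$ if ${\bf E}\,g(Z_t)\to{\bf E}\,g(Z)$ for every bounded $g:D[0,1]\to{\bf R}$ that is continuous for the uniform metric and measurable with respect to the $\sigma$-algebra generated by the coordinate projections. *)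

(* Defs.v *)
From HB Require Import structures.
From mathcomp Require Import all_boot all_order all_algebra.
From mathcomp Require Import all_classical all_reals all_analysis.
From mathcomp Require Import measurable_realfun.

Set Implicit Arguments.
Unset Strict Implicit.
Unset Printing Implicit Defensive.

Import Order.TTheory GRing.Theory Num.Theory.
Import numFieldNormedType.Exports.

Local Open Scope classical_set_scope.
Local Open Scope ring_scope.

(* At an endpoint of I one of the two filters below contains the empty set, so
   that the corresponding condition is void, as it should be. *)
Definition cadlag (R : realType) (I : set R) (f : R -> R) : Prop :=
  forall t, I t ->
    (f x @[x --> within I t^'+] --> f t) /\
    (exists l : R, f x @[x --> within I t^'-] --> l).

(* A function on [0, 1] is encoded by its extension by 0 to the real line: this
   makes D[0, 1] a type in which equality is equality on [0, 1]. *)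
Record D01 (R : realType) := MkD01 {
  D01_fun :> R -> R ;
  D01_cadlag : cadlag `[0, 1] D01_fun ;
  D01_out : forall x, ~ `[0, 1]%classic x -> D01_fun x = 0 }.

Section D01_structures.
Variable R : realType.
Implicit Types f g h : D01 R.

Lemma D01_ext f g : (forall x, `[0, 1]%classic x -> f x = g x) -> f = g.
Proof.
case: f g => [f cf f0] [g cg g0] /= fg.
have efg : f = g.
  apply/funext => x; have [/fg//|nx] := pselect (`[0, 1]%classic x).
  by rewrite f0// g0.
by subst g; congr MkD01; exact: Prop_irrelevance.
Qed.

Lemma cadlag0 (I : set R) : cadlag I (fun _ : R => 0).
Proof. by move=> t _; split; [|exists 0]; exact: cvg_cst. Qed.

Definition D01_zero : D01 R := MkD01 (@cadlag0 _) (fun _ _ => erefl).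

HB.instance Definition _ := gen_eqMixin (D01 R).
HB.instance Definition _ := gen_choiceMixin (D01 R).
HB.instance Definition _ := isPointed.Build (D01 R) D01_zero.

Definition unif_dist f g : R :=
  sup [set `|f x - g x| | x in `[0, 1]%classic].

Lemma cadlag_bounded (f : R -> R) : cadlag `[0, 1] f ->
  exists M, forall x, `[0, 1]%classic x -> `|f x| <= M.
Proof.
move=> cf.
have /compact_near_coveringP cov := @segment_compact R 0 1.
have := cov _ (pinfty_nbhs R) (fun M x => `[0, 1]%classic x -> `|f x| <= M) _.
case=> [t It|M [_ /(_ (M + 1))]]; last first.
  by rewrite ltrDl ltr01 => /(_ isT) H; exists (M + 1) => x Ix; exact: H.
have [rc [l lc]] := cf t It.
have b (F : set_system R) (a : R) : Filter F -> f x @[x --> F] --> a ->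
    F [set x | `|f x| <= `|a| + 1].
  move=> FF /cvgrPdist_le /(_ 1 ltr01); apply: filterS => x /= Hx.
  rewrite -[f x](subKr a) (le_trans (ler_normB _ _))// lerD2l.
  by rewrite Hx.
have hr : \forall x \near t, t < x -> `[0, 1]%classic x -> `|f x| <= `|f t| + 1.
  exact: b (within `[0, 1] t^'+) _ _ rc.
have hl : \forall x \near t, x < t -> `[0, 1]%classic x -> `|f x| <= `|l| + 1.
  exact: b (within `[0, 1] t^'-) _ _ lc.
have Hx : \forall x \near t, `[0, 1]%classic x ->
    `|f x| <= `|f t| + `|l| + 1.
  near=> x; move=> Ix.
  have [xt|tx|->] := ltgtP x t.
  - rewrite (@le_trans _ _ (`|l| + 1))//.
      by move: Ix; apply: (near hl x).
    by rewrite -addrA lerDr.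
  - rewrite (@le_trans _ _ (`|f t| + 1))//.
      by move: Ix; apply: (near hr x).
    by rewrite lerD2r lerDl.
  - by rewrite -addrA lerDl addr_ge0.
near=> x M => /= Ix.
apply: (@le_trans _ _ (`|f t| + `|l| + 1)).
  by move: Ix; apply: (near Hx x).
by near: M; exact: nbhs_pinfty_ge.
Unshelve. all: by end_near. Qed.

Lemma unif_dist_ub f g x : `[0, 1]%classic x -> `|f x - g x| <= unif_dist f g.
Proof.
move=> Ix; have [Mf bf] := cadlag_bounded (D01_cadlag f).
have [Mg bg] := cadlag_bounded (D01_cadlag g).
apply: ub_le_sup; last by exists x.
exists (Mf + Mg) => _ [y Iy <-].
by rewrite (le_trans (ler_normB _ _))// lerD ?bf ?bg.
Qed.

Lemma unif_dist_le f g M :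
  (forall x, `[0, 1]%classic x -> `|f x - g x| <= M) -> unif_dist f g <= M.
Proof.
move=> H; apply: ge_sup; last by move=> _ [x Ix <-]; exact: H.
by exists `|f 0 - g 0|; exists 0 => //=; rewrite in_itv/= lexx ler01.
Qed.

Let unif_distxx f : unif_dist f f = 0.
Proof.
apply/eqP; rewrite eq_le unif_dist_le/=; last first.
  by move=> x _; rewrite subrr normr0.
rewrite (le_trans _ (@unif_dist_ub f f 0 _))//=.
by rewrite in_itv/= lexx ler01.
Qed.

Let unif_dist_positivity f g : unif_dist f g = 0 -> f = g.
Proof.
move=> fg0; apply: D01_ext => x Ix; apply/eqP; rewrite -subr_eq0 -normr_le0.
by rewrite -fg0 unif_dist_ub.
Qed.

Let unif_dist_sym f g : unif_dist f g = unif_dist g f.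
Proof.
by rewrite /unif_dist; congr sup; apply: eq_imagel => x _; rewrite distrC.
Qed.

Let unif_dist_triangle g f h :
  unif_dist f h <= unif_dist f g + unif_dist g h.
Proof.
apply: unif_dist_le => x Ix.
by rewrite (le_trans (ler_distD (g x) _ _))// lerD// unif_dist_ub.
Qed.

HB.instance Definition _ := @isMetric.Build R (D01 R) unif_dist
  unif_distxx unif_dist_positivity unif_dist_sym unif_dist_triangle.

Definition D01_cylinders : set (set (D01 R)) :=
  [set A | exists x (B : set R), [/\ `[0, 1]%classic x, measurable B &
     A = [set f : D01 R | B (f x)]]].

HB.instance Definition _ :=
  Measurable.copy (D01 R) (g_sigma_algebraType D01_cylinders).

End D01_structures.

Section processes.
Context d (T : measurableType d) (R : realType) (P : probability T R).

Definition independent_RVs (n : nat) (X : 'I_n -> T -> R) : Prop :=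
  forall B : 'I_n -> set R, (forall i, measurable (B i)) ->
    P (\bigcap_i (X i @^-1` B i)) = (\prod_(i < n) P (X i @^-1` B i))%E.

Definition independent_increments (I : set R) (V : R -> T -> R) : Prop :=
  forall (n : nat) (t : nat -> R),
    (forall i, (i <= n)%N -> I (t i)) ->
    (forall i, (i < n)%N -> t i <= t i.+1) ->
    independent_RVs (fun (i : 'I_n) w => V (t i.+1) w - V (t i) w).

Definition homogeneous (V : R -> T -> R) : Prop :=
  forall s t h : R, 0 <= s -> 0 <= t -> 0 <= h ->
  forall B : set R, measurable B ->
    P [set w | B (V (s + h) w - V s w)] = P [set w | B (V (t + h) w - V t w)].

(* Integrability is stated explicitly because the integral of the library is
   total. *)
Definition centered (V : R -> T -> R) : Prop :=
  forall t : R, 0 <= t ->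
    P.-integrable setT (EFin \o V t) /\ ('E_P[V t] = 0)%E.

(* The parameters of normal_prob are the mean and the standard deviation. *)
Definition standard_Wiener (I : set R) (W : R -> T -> R) : Prop :=
  [/\ {ae P, forall w, W 0 w = 0},
      independent_increments I W,
      (forall s t : R, I s -> I t -> s < t ->
        forall B : set R, measurable B ->
        P [set w | B (W t w - W s w)] = normal_prob 0 (Num.sqrt (t - s)) B) &
      {ae P, forall w, {within I, continuous (W ^~ w)}}].

(* Z is the random element of D[0, 1] identified with the process Y. *)
Definition random_element_of (Y : R -> T -> R) (Z : {RV P >-> D01 R}) : Prop :=
  {ae P, forall w, forall x, `[0, 1]%classic x -> Z w x = Y x w}.

Lemma random_element_ex (Y : R -> {RV P >-> R}) :
  {ae P, forall w, cadlag `[0, 1] (Y ^~ w)} ->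
  exists Z : {RV P >-> D01 R}, random_element_of Y Z.
Proof.
move=> [N [mN N0 subN]].
have cY w : (~` N) w -> cadlag `[0, 1] (Y ^~ w).
  by move=> nN; apply: contrapT => nc; apply: nN; exact: subN.
have cadlag_restr (f : R -> R) : cadlag `[0, 1] f ->
    cadlag `[0, 1] (f \_ `[0, 1]).
  move=> cf t It; have [rc [l lc]] := cf t It.
  have eqf (F : set_system R) (a : R) : Filter F ->
      f x @[x --> within `[0, 1] F] --> a ->
      (f \_ `[0, 1]) x @[x --> within `[0, 1] F] --> a.
    move=> FF; apply: cvg_trans; apply: near_eq_cvg.
    rewrite near_withinE; apply: nearW => x Ix.
    by rewrite patchE mem_set.
  split; last by exists l; exact: eqf.
  by rewrite {2}/patch mem_set//; exact: eqf.
have out0 (f : R -> R) x : ~ `[0, 1]%classic x -> (f \_ `[0, 1]) x = 0.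
  by move=> nx; rewrite patchE memNset.
pose Z0 w : D01 R := match pselect ((~` N) w) with
  | left h => MkD01 (cadlag_restr _ (cY w h)) (@out0 (Y ^~ w))
  | right _ => D01_zero R end.
have Z0E w x : `[0, 1]%classic x -> Z0 w x = Y x w * \1_(~` N) w.
  move=> Ix; rewrite /Z0; case: pselect => [h|h] /=.
    by rewrite patchE mem_set// indicE mem_set// mulr1.
  by rewrite indicE memNset// mulr0.
have mZ0 : measurable_fun setT Z0.
  apply: (@measurability _ _ _ _ _ _ (@D01_cylinders R)) => //.
  move=> _ [_ [x [B [Ix mB ->]]] <-].
  have -> : Z0 @^-1` [set f : D01 R | B (f x)] =
      (fun w => Y x w * \1_(~` N) w) @^-1` B.
    by apply/funext => w /=; rewrite Z0E.
  have : measurable_fun setT (fun w => Y x w * \1_(~` N) w).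
    apply: measurable_funM => //.
    by apply: measurable_indic; exact: measurableC.
  by apply.
pose HZ := isMeasurableFun.Build _ _ _ _ Z0 mZ0.
pose Z : {mfun T >-> D01 R} := HB.pack Z0 HZ.
exists Z; exists N; split=> // w /= nw; apply: contrapT => nN; apply: nw => x Ix.
by rewrite Z0E// indicE mem_set// mulr1.
Qed.

End processes.

Definition cvg_in_distribution d (T : measurableType d) d' (T' : measurableType d')
    (R : realType) (P : probability T R) (P' : probability T' R)
    (Z : R -> {RV P >-> D01 R}) (Z' : {RV P' >-> D01 R}) : Prop :=
  forall g : D01 R -> R,
    (exists M, forall f, `|g f| <= M) -> continuous g ->
    measurable_fun [set: D01 R] g ->
    ('E_P[g \o Z t] @[t --> +oo%R] --> 'E_P'[g \o Z'])%E.

(* Main.v *)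
(* The bounded continuous test function g is first replaced by a bounded Lipschitz
   one. The limit Z is almost surely continuous, hence concentrated on the closure
   of the countable set of step functions with rational increments; a Lipschitz
   partition of unity subordinate to balls around these points approximates g
   outside an event which is negligible for Z and, the remainder of the partition
   being Lipschitz, for X t as well when t is large. For Lipschitz F, X t is
   replaced by its step discretization of mesh 1/m; the error is controlled,
   uniformly in large t, by Ottaviani's inequality on finite grids. The expectation
   of F at a step process is an iterated integral against the law of one increment,
   and replacing the increments of X t by those of sigma W one at a time leaves a
   one-dimensional central limit theorem, uniform over bounded Lipschitz functions
   with fixed constants, which is again proved by Lindeberg's replacement, with
   truncated second moments and a second-order Taylor expansion. *)

From HB Require Import structures.
Require Import Defs.
From mathcomp Require Import all_boot all_order all_algebra.
From mathcomp Require Import all_classical all_reals all_analysis.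
From mathcomp Require Import measurable_realfun lra ring.
Import Order.TTheory GRing.Theory Num.Theory.
Import numFieldNormedType.Exports.
Local Open Scope classical_set_scope.
Local Open Scope ring_scope.

Set Implicit Arguments.
Unset Strict Implicit.
Unset Printing Implicit Defensive.

(** * Iterated integrals and independence *)

(** For the uniform metric D[0, 1] is not separable and its Borel sets outnumber the cylinder sets,
    so a tightness argument on a Polish space is not at hand; a separable support is asked of the
    limit only. Hence the need for a central limit theorem uniform over such functions. Chebyshev's
    inequality alone would not control the discretization: there are [m] blocks, and it bounds the
    probability of a large oscillation in one block by O(1/m) only. The central limit theorem brings
    in the Gaussian tail, which is o(1/m). So [m] is fixed before [t], and the bound must be uniform
    in the number [K] of points sampled inside a block, since [K] tends to infinity while [t] is
    fixed. Only the second moment at time 1 is given. At other times it is controlled by additivity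
    in unit steps and monotonicity, at the price of rounding times to integers. *)

Section bounded_integrals.
Context d (T : measurableType d) (R : realType) (m : probability T R).
Implicit Types f g : T -> R.

Lemma bounded_integrable f (M : R) : measurable_fun setT f ->
  (forall x, `|f x| <= M) -> m.-integrable setT (EFin \o f).
Proof.
move=> mf fM; apply: (le_integrable measurableT (g := EFin \o cst M)).
- exact/measurable_EFinP.
- by move=> x _; rewrite /= lee_fin (le_trans (fM x)) ?ler_norm.
- exact: finite_measure_integrable_cst.
Qed.

Lemma Rintegral_cst1 (c : R) : \int[m]_x c = c.
Proof. by rewrite Rintegral_cst//= probability_setT mulr1. Qed.

Lemma Rintegral_bounded f (M : R) : measurable_fun setT f ->
  (forall x, `|f x| <= M) -> `|\int[m]_x f x| <= M.
Proof.
move=> mf fM; have If := bounded_integrable mf fM.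
rewrite (le_trans (le_normr_Rintegral _ If))//.
rewrite -[leRHS]Rintegral_cst1; apply: le_Rintegral => //.
  apply: (@bounded_integrable _ M); first exact: measurableT_comp.
  by move=> x; rewrite normr_id.
by apply: (@bounded_integrable _ `|M|) => // x.
Qed.

Lemma Rintegral_dist_le f g (M e : R) : measurable_fun setT f -> measurable_fun setT g ->
  (forall x, `|f x| <= M) -> (forall x, `|g x| <= M) ->
  (forall x, `|f x - g x| <= e) -> `|\int[m]_x f x - \int[m]_x g x| <= e.
Proof.
move=> mf mg fM gM fg; rewrite -RintegralB//; first last.
- exact: bounded_integrable mg gM.
- exact: bounded_integrable mf fM.
by apply: Rintegral_bounded => //; exact: measurable_funB.
Qed.

End bounded_integrals.

Section bounded_fubini.
Context d1 d2 (T1 : measurableType d1) (T2 : measurableType d2) (R : realType).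
Variables (f : T1 * T2 -> R) (M : R).
Hypotheses (mf : measurable_fun setT f) (fM : forall x, `|f x| <= M).

Lemma measurable_Rintegral_snd (m2 : probability T2 R) :
  measurable_fun setT (fun x => \int[m2]_y f (x, y)).
Proof.
(* Adding [M] makes the integrand nonnegative, so that Tonelli's measurability applies. *)
have -> : (fun x => \int[m2]_y f (x, y)) =
    (fun x => \int[m2]_y (f (x, y) + M) - M).
  apply/funext => x; rewrite RintegralD//.
  - by rewrite Rintegral_cst1 addrK.
  - by apply: (@bounded_integrable _ _ _ _ _ M) => //; exact: measurable_fun_pair2.
  - by apply: (@bounded_integrable _ _ _ _ _ `|M|).
apply: measurable_funB => //; rewrite /Rintegral.
apply: measurableT_comp => //.
apply: (@measurable_fun_fubini_tonelli_F _ _ _ _ _ m2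
  (fun z => (f z + M)%:E)) => [|z].
  by apply/measurable_EFinP; exact: measurable_funD.
have /ler_normlP[+ _] := fM z.
by rewrite lee_fin -[f z + M]opprK opprD oppr_ge0 subr_le0.
Qed.

Lemma Rintegral_swap (m1 : probability T1 R) (m2 : probability T2 R) :
  \int[m1]_x \int[m2]_y f (x, y) = \int[m2]_y \int[m1]_x f (x, y).
Proof.
have If : (m1 \x m2)%E.-integrable setT (EFin \o f).
  exact: bounded_integrable mf fM.
have fin1 x : (\int[m2]_y (f (x, y))%:E)%E \is a fin_num.
  apply: integrable_fin_num => //.
  by apply: (@bounded_integrable _ _ _ _ _ M) => //; exact: measurable_fun_pair2.
have fin2 y : (\int[m1]_x (f (x, y))%:E)%E \is a fin_num.
  apply: integrable_fin_num => //.
  by apply: (@bounded_integrable _ _ _ _ _ M) => //; exact: measurable_fun_pair1.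
rewrite /Rintegral; congr fine.
have := Fubini If; rewrite /fubini_F /fubini_G /= => FE.
under eq_integral do rewrite fineK//.
by rewrite FE; apply: eq_integral => y _; rewrite fineK.
Qed.

Lemma Rintegral_prod (m1 : probability T1 R) (m2 : probability T2 R) :
  \int[(m1 \x m2)%E]_z f z = \int[m1]_x \int[m2]_y f (x, y).
Proof.
have If : (m1 \x m2)%E.-integrable setT (EFin \o f).
  exact: bounded_integrable mf fM.
rewrite /Rintegral -(integral12_prod_meas1 If) /fubini_F /=; congr fine.
apply: eq_integral => x _; rewrite fineK//.
apply: integrable_fin_num => //.
by apply: (@bounded_integrable _ _ _ _ _ M) => //; exact: measurable_fun_pair2.
Qed.

End bounded_fubini.

(* The integral of a function of n variables against the n-fold product of mu,
   the variables being listed in a sequence. *)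
Fixpoint iter_int (R : realType) (mu : probability R R) (n : nat)
    (H : seq R -> R) : R :=
  if n is n'.+1 then \int[mu]_y iter_int mu n' (fun s => H (y :: s)) else H [::].

(* Since seq R carries no sigma-algebra, measurability in n variables (and a
   parameter in T0) is expressed by composition with measurable families. *)
Definition param_measurable d0 (T0 : measurableType d0) (R : realType) (n : nat)
    (G : T0 -> seq R -> R) : Prop :=
  forall d1 (T1 : measurableType d1) (p : T1 -> T0) (Y : nat -> T1 -> R),
    measurable_fun setT p -> (forall i, measurable_fun setT (Y i)) ->
    measurable_fun setT (fun w => G (p w) (mkseq (Y ^~ w) n)).

Definition seq_measurable (R : realType) (n : nat) (H : seq R -> R) : Prop :=
  param_measurable n (fun (_ : R) s => H s).

Lemma mkseq_cons T (f : nat -> T) n :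
  mkseq f n.+1 = f 0%N :: mkseq (fun i => f i.+1) n.
Proof. by rewrite /mkseq /= -[1%N]/(1 + 0)%N iotaDl -map_comp. Qed.

Section iterated_integrals.
Variable R : realType.
Implicit Types (mu nu : probability R R) (H : seq R -> R).

(** The head of the list becomes part of the parameter. Inductions on the number of variables
    therefore pass from the parameter space [T0] to [T0 * R]. *)
Lemma param_measurable_cons d0 (T0 : measurableType d0) n (G : T0 -> seq R -> R) :
  param_measurable n.+1 G ->
  param_measurable n (fun (z : T0 * R) s => G z.1 (z.2 :: s)).
Proof.
move=> mG d1 T1 p Y mp mY.
have := mG _ T1 (fst \o p) (fun i => if i is j.+1 then Y j else snd \o p).
have -> : (fun w => G ((fst \o p) w) (mkseq
   (fun i => (if i is j.+1 then Y j else snd \o p) w) n.+1)) =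
   (fun w => G (p w).1 ((p w).2 :: mkseq (Y ^~ w) n)).
  by apply/funext => w; rewrite mkseq_cons.
apply; first exact: measurableT_comp.
by case => //; exact: measurableT_comp.
Qed.

(** Both conclusions go through one induction: the outer integral is measurable because the inner
    one is measurable and bounded. *)
Lemma param_iter_int mu d0 (T0 : measurableType d0) n (M : R)
    (G : T0 -> seq R -> R) : param_measurable n G ->
  (forall x s, size s = n -> `|G x s| <= M) ->
  measurable_fun setT (fun x => iter_int mu n (G x)) /\
  (forall x, `|iter_int mu n (G x)| <= M).
Proof.
elim: n d0 T0 G => [|n IH] d0 T0 G mG GM /=.
  by split => [|x]; [exact: (mG _ T0 id (fun _ => cst 0))|exact: GM].
pose f (z : T0 * R) := iter_int mu n (fun s => G z.1 (z.2 :: s)).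
have [mf fM] : measurable_fun setT f /\ (forall z, `|f z| <= M).
  apply: IH; first exact: param_measurable_cons.
  by move=> x s sn; apply: GM; rewrite /= sn.
split; first exact: (measurable_Rintegral_snd mf fM mu).
move=> x; apply: (@Rintegral_bounded _ _ _ mu) => [|y]; last exact: (fM (x, y)).
exact: (measurable_fun_pair2 x mf).
Qed.

Lemma seq_measurable_cons n H : seq_measurable n.+1 H ->
  param_measurable n (fun (y : R) s => H (y :: s)).
Proof.
move=> mH d1 T1 p Y mp mY.
apply: (@param_measurable_cons _ _ _ _ mH d1 T1 (fun w => (0, p w)) Y) => //.
by apply: measurable_fun_pair => //.
Qed.

Lemma seq_measurable_behead n H y : seq_measurable n.+1 H ->
  seq_measurable n (fun s => H (y :: s)).
Proof.
move=> mH d1 T1 p Y mp mY.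
by have /(_ _ T1 (cst y)) := seq_measurable_cons mH; apply.
Qed.

Lemma param_measurable_pt d0 (T0 : measurableType d0) n (G : T0 -> seq R -> R) s :
  param_measurable n G -> size s = n -> measurable_fun setT (G ^~ s).
Proof.
move=> mG sn; have := mG _ T0 id (fun i => cst (nth 0 s i)).
have -> : (fun w : T0 => G (id w) (mkseq (fun i => cst (nth 0 s i) w) n)) = G ^~ s.
  by apply/funext => x; rewrite -sn mkseq_nth.
by apply.
Qed.

Lemma iter_int_bounded mu M n H : seq_measurable n H ->
  (forall s, size s = n -> `|H s| <= M) -> `|iter_int mu n H| <= M.
Proof. by move=> mH HM; have [_] := param_iter_int mu mH (fun _ => HM); apply. Qed.

Section one_law.
Variables (mu : probability R R) (M : R) (n : nat) (H : seq R -> R).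
Hypotheses (mH : seq_measurable n.+1 H) (HM : forall s, size s = n.+1 -> `|H s| <= M).

Lemma iter_int_cons :
  measurable_fun setT (fun y => iter_int mu n (fun s => H (y :: s))) /\
  (forall y, `|iter_int mu n (fun s => H (y :: s))| <= M).
Proof.
apply: param_iter_int; first exact: seq_measurable_cons.
by move=> x s sn; apply: HM; rewrite /= sn.
Qed.

Lemma integrable_iter_int_cons :
  mu.-integrable setT (EFin \o (fun y => iter_int mu n (fun s => H (y :: s)))).
Proof. by have [mf fM] := iter_int_cons; exact: (@bounded_integrable _ _ _ _ _ M). Qed.

End one_law.

Lemma le_iter_int mu n H1 H2 M : seq_measurable n H1 -> seq_measurable n H2 ->
  (forall s, size s = n -> `|H1 s| <= M) -> (forall s, size s = n -> `|H2 s| <= M) ->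
  (forall s, size s = n -> H1 s <= H2 s) -> iter_int mu n H1 <= iter_int mu n H2.
Proof.
elim: n H1 H2 => [|n IH] H1 H2 m1 m2 M1 M2 H12 /=; first exact: H12.
apply: le_Rintegral => //; [exact: (@integrable_iter_int_cons _ M)..|].
move=> y _; apply: IH; try exact: seq_measurable_behead.
- by move=> s sn; apply: M1; rewrite /= sn.
- by move=> s sn; apply: M2; rewrite /= sn.
- by move=> s sn; apply: H12; rewrite /= sn.
Qed.

Lemma eq_iter_int mu n H1 H2 : (forall s, size s = n -> H1 s = H2 s) ->
  iter_int mu n H1 = iter_int mu n H2.
Proof.
elim: n H1 H2 => [|n IH] H1 H2 H12 /=; first exact: H12.
by apply: eq_Rintegral => y _; apply: IH => s sn; apply: H12; rewrite /= sn.
Qed.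

Lemma iter_int_dist mu n H1 H2 M e : seq_measurable n H1 -> seq_measurable n H2 ->
  (forall s, size s = n -> `|H1 s| <= M) -> (forall s, size s = n -> `|H2 s| <= M) ->
  (forall s, size s = n -> `|H1 s - H2 s| <= e) ->
  `|iter_int mu n H1 - iter_int mu n H2| <= e.
Proof.
elim: n H1 H2 => [|n IH] H1 H2 m1 m2 M1 M2 H12 /=; first exact: H12.
have [mf1 fM1] := iter_int_cons mu m1 M1.
have [mf2 fM2] := iter_int_cons mu m2 M2.
apply: (@Rintegral_dist_le _ _ _ _ _ _ M) => // y.
apply: IH; try exact: seq_measurable_behead.
- by move=> s sn; apply: M1; rewrite /= sn.
- by move=> s sn; apply: M2; rewrite /= sn.
- by move=> s sn; apply: H12; rewrite /= sn.
Qed.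

Lemma iter_int_rcons mu n H :
  iter_int mu n.+1 H = iter_int mu n (fun s => \int[mu]_y H (rcons s y)).
Proof.
elim: n H => [|n IH] H //.
by apply: eq_Rintegral => y _; exact: (IH (fun s => H (y :: s))).
Qed.

Lemma seq_measurable_rcons n H : seq_measurable n.+1 H ->
  param_measurable n (fun (y : R) s => H (rcons s y)).
Proof.
move=> mH d1 T1 p Y mp mY.
have := mH _ _ p (fun i => if (i < n)%N then Y i else p) mp.
have -> : (fun w => H (mkseq (fun i => (if (i < n)%N then Y i else p) w) n.+1)) =
    (fun w => H (rcons (mkseq (Y ^~ w) n) (p w))).
  apply/funext => w; congr H; rewrite /mkseq -addn1 iotaD map_cat /= add0n ltnn cats1.
  congr rcons; apply/eq_in_map => i; rewrite mem_iota add0n => /andP[_ ->//].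
by apply => i; case: ifP.
Qed.

Lemma seq_measurable_Rintegral mu n M (K : R -> seq R -> R) :
  param_measurable n K -> (forall y s, size s = n -> `|K y s| <= M) ->
  seq_measurable n (fun s => \int[mu]_y K y s).
Proof.
move=> mK KM d1 T1 p Y mp mY.
pose f (z : T1 * R) := K z.2 (mkseq (Y ^~ z.1) n).
apply: (@measurable_Rintegral_snd _ _ _ _ _ f M _ _ mu).
  apply: (mK _ _ snd (fun i => Y i \o fst)) => // i.
  exact: measurableT_comp.
by move=> z; apply: KM; rewrite size_mkseq.
Qed.

Lemma iter_int_Rintegral mu nu n M (K : R -> seq R -> R) :
  param_measurable n K -> (forall y s, size s = n -> `|K y s| <= M) ->
  \int[mu]_y iter_int nu n (K y) = iter_int nu n (fun s => \int[mu]_y K y s).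
Proof.
elim: n K => [|n IH] K mK KM //=.
have KM' z s : size s = n -> `|K z.1 (z.2 :: s)| <= M.
  by move=> sn; apply: KM; rewrite /= sn.
have [mf fM] := param_iter_int nu (param_measurable_cons mK) KM'.
rewrite (Rintegral_swap mf fM); apply: eq_Rintegral => z _.
apply: (IH (fun y s => K y (z :: s))); last by move=> y s; exact: (KM' (y, z)).
move=> d1 T1 p Y mp mY.
apply: (param_measurable_cons mK (p := fun w => (p w, z))) => //.
exact: measurable_fun_pair.
Qed.

(* Lindeberg's method: the laws of the variables are replaced one at a time. *)
Lemma iter_int_swap mu nu n H M e : seq_measurable n H ->
  (forall s, size s = n -> `|H s| <= M) ->
  (forall p s, size (p ++ s) = n.-1 ->
    `|\int[mu]_y H (p ++ y :: s) - \int[nu]_y H (p ++ y :: s)| <= e) ->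
  `|iter_int mu n H - iter_int nu n H| <= n%:R * e.
Proof.
elim: n H => [|n IH] H mH HM He; first by rewrite /= subrr normr0 mul0r.
rewrite -natr1 mulrDl mul1r.
(* Intermediate term: the first variable has law [mu], all the others already have law [nu]. *)
pose J y := iter_int nu n (fun s => H (y :: s)).
have HM' y s : size s = n -> `|H (y :: s)| <= M.
  by move=> sn; apply: HM; rewrite /= sn.
have [mf1 fM1] := iter_int_cons mu mH HM.
have [mf2 fM2] := iter_int_cons nu mH HM.
rewrite -(subrKA (\int[mu]_y J y)) (le_trans (ler_normD _ _))// lerD//.
  apply: (@Rintegral_dist_le _ _ _ _ _ _ M) => // y.
  (* The case of an empty tail is separate: since [0.-1] is [0], the hypothesis on lists of size
     [n.-1] would not pass to the tail. *)
  case: n IH mH HM He @J HM' mf1 fM1 mf2 fM2 => [|n] IH mH HM He J HM' mf1 fM1 mf2 fM2.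
    by rewrite /= subrr normr0 mul0r.
  apply: IH; [exact: seq_measurable_behead|by move=> s; exact: HM'|].
  by move=> p s psn; apply: (He (y :: p)); rewrite /= psn.
have mK := seq_measurable_cons mH.
rewrite /J /= !(iter_int_Rintegral _ _ mK HM').
have mI la := seq_measurable_Rintegral la mK HM'.
apply: (@iter_int_dist _ _ _ _ M) => //; last by move=> s sn; exact: (He [::]).
- by move=> s sn; apply: Rintegral_bounded => [|y]; [exact: param_measurable_pt mK sn|exact: HM'].
- by move=> s sn; apply: Rintegral_bounded => [|y]; [exact: param_measurable_pt mK sn|exact: HM'].
Qed.

End iterated_integrals.

Section laws.
Context d (T : measurableType d) (R : realType) (P : probability T R).

Definition law dS (S : measurableType dS) (f : T -> S)
    (mf : measurable_fun setT f) : probability S R :=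
  distribution P (HB.pack f (isMeasurableFun.Build _ _ _ _ f mf) : {mfun T >-> S}).

Section law_theory.
Context dS (S : measurableType dS) (f : T -> S) (mf : measurable_fun setT f).

Lemma ge0_integral_law (g : S -> \bar R) : measurable_fun setT g ->
  (forall y, 0 <= g y)%E -> (\int[law mf]_y g y = \int[P]_w g (f w))%E.
Proof. by move=> mg g0; rewrite /law ge0_integral_distribution. Qed.

Lemma Rintegral_law (g : S -> R) M : measurable_fun setT g ->
  (forall y, `|g y| <= M) -> \int[law mf]_y g y = \int[P]_w g (f w).
Proof.
move=> mg gM; rewrite /Rintegral integral_distribution//; first exact/measurable_EFinP.
by apply: (@bounded_integrable _ _ _ _ _ M) => //; exact: measurableT_comp.
Qed.

End law_theory.

Section independent_pair.
Context dS (S : measurableType dS) (U : T -> S) (Y : T -> R) (mu : probability R R).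
Hypotheses (mU : measurable_fun setT U) (mY : measurable_fun setT Y).
Hypothesis UY : forall A B, measurable A -> measurable B ->
  P (U @^-1` A `&` Y @^-1` B) = (P (U @^-1` A) * mu B)%E.

Let mUY : measurable_fun setT (fun w => (U w, Y w)).
Proof. exact: measurable_fun_pair. Qed.

Let law_pair A : measurable A -> law mUY A = (law mU \x mu)%E A.
Proof.
by move=> mA; apply/esym/product_measure_unique => // A1 A2 mA1 mA2; exact: UY.
Qed.

Lemma ge0_integral_indep (h : S * R -> \bar R) : measurable_fun setT h ->
  (forall z, 0 <= h z)%E ->
  (\int[P]_w h (U w, Y w) = \int[P]_w \int[mu]_y h (U w, y))%E.
Proof.
move=> mh h0; rewrite -(ge0_integral_law mUY mh h0).
rewrite (eq_measure_integral (law mU \x mu)%E); last by move=> A mA _; exact: law_pair.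
rewrite (fubini_tonelli1 _ mh h0) /fubini_F ge0_integral_law//.
  exact: measurable_fun_fubini_tonelli_F.
by move=> y; apply: integral_ge0.
Qed.

Lemma Rintegral_indep (h : S * R -> R) (M : R) : measurable_fun setT h ->
  (forall z, `|h z| <= M) ->
  \int[P]_w h (U w, Y w) = \int[P]_w \int[mu]_y h (U w, y).
Proof.
move=> mh hM; rewrite -(Rintegral_law mUY mh hM).
transitivity (\int[(law mU \x mu)%E]_z h z).
  by rewrite /Rintegral; congr fine; apply: eq_measure_integral => A mA _; exact: law_pair.
rewrite (Rintegral_prod mh hM) (@Rintegral_law _ _ _ _ _ M)//.
  exact: measurable_Rintegral_snd mh hM mu.
move=> y; apply: Rintegral_bounded => [|z]; last exact: hM.
exact: measurable_fun_pair2.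
Qed.

End independent_pair.

(** Induction that splits off the last variable. Independence is given on boxes; a pi-system
    argument extends it to the sigma-algebra of the first [n] variables, and Fubini's theorem
    integrates the last one out. *)
Lemma independent_iter_int (Y : nat -> T -> R) n (mu : probability R R) H (M : R) :
  (forall i, measurable_fun setT (Y i)) ->
  independent_RVs P (fun i : 'I_n => Y i) ->
  (forall i B, (i < n)%N -> measurable B -> P (Y i @^-1` B) = mu B) ->
  seq_measurable n H -> (forall s, size s = n -> `|H s| <= M) ->
  \int[P]_w H (mkseq (Y ^~ w) n) = iter_int mu n H.
Proof.
move=> mY; elim: n H => [|n IH] H iY muY mH HM.
  by rewrite /mkseq /= Rintegral_cst1.
pose G : set (set T) := [set A | exists B : nat -> set R,
  (forall i, measurable (B i)) /\ A = \bigcap_(i < n) (Y i @^-1` B i)].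
have GT : G setT.
  exists (fun=> setT); split => //; apply/esym; rewrite -subTset => w _ i _ //.
have GI : setI_closed G.
  move=> _ _ [B [mB ->]] [C [mC ->]]; exists (fun i => B i `&` C i); split.
    by move=> i; exact: measurableI.
  by rewrite -bigcapI; apply: eq_bigcapr => i _; rewrite preimage_setI.
have Gm : G `<=` measurable.
  move=> _ [B [mB ->]]; apply: bigcap_measurableType => // i _.
  by rewrite -[X in measurable X]setTI; exact: mY.
have E (C : nat -> set R) (D : set R) : (forall i, measurable (C i)) -> measurable D ->
    P (\bigcap_(i < n) (Y i @^-1` C i) `&` Y n @^-1` D) =
    ((\prod_(i < n) P (Y i @^-1` C i)) * P (Y n @^-1` D))%E.
  move=> mC mD; have /= := iY (fun i => if (i < n)%N then C i else D).
  rewrite big_ord_recr /= ltnn => /(_ _)/esym.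
  under eq_bigr do rewrite ltn_ord.
  move=> ->; last by move=> i; case: ifP.
  congr (P _); apply/seteqP; split => [w [Cw Dw] i _ /=|w Cw /=].
    case: ltnP => [|ni]; first exact: Cw.
    suff -> : val i = n by [].
    by apply/eqP; rewrite eqn_leq ni andbT -ltnS ltn_ord.
  split => [i /= ni|].
    by have := Cw (Ordinal (ltnW ni : (i < n.+1)%N)) I; rewrite /= ni.
  by have := Cw ord_max I; rewrite /= ltnn.
have iYn A B : G A -> measurable B -> P (A `&` Y n @^-1` B) = (P A * mu B)%E.
  move=> [C [mC ->]] mB; rewrite E// muY//; congr (_ * _)%E.
  have := E C setT mC measurableT.
  by rewrite preimage_setT setIT probability_setT mule1 => <-.
(* For fixed [B], both sides are finite measures in [A] that agree on the pi-system [G]: the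
   restriction of [P] to the event on [Y n], and [P] scaled by [mu B]. *)
have sYn A B : <<s G >> A -> measurable B -> P (A `&` Y n @^-1` B) = (P A * mu B)%E.
  move=> sA mB.
  have mYB : measurable (Y n @^-1` B) by rewrite -[X in measurable X]setTI; exact: mY.
  have muB : mu B \is a fin_num by exact: fin_num_measure.
  have r0 : (0 <= fine (mu B))%R by rewrite fine_ge0.
  have msE X : mscale (NngNum r0) P X = (P X * mu B)%E.
    by rewrite /mscale /= fineK// muleC.
  rewrite -msE -/(mrestr P mYB A).
  apply: (@g_sigma_algebra_measure_unique _ _ _ G Gm (fun=> setT) (fun=> GT)) => //.
  - by rewrite -subTset => x _; exists 0%N.
  - by move=> A' GA'; exact: etrans (iYn _ _ GA' mB) (esym (msE A')).
  - by move=> _ /=; rewrite /mrestr setTI -ge0_fin_numE// fin_num_measure.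
(* [S] is [T] with the coarser sigma-algebra of the first [n] variables. The identity from [T] to
   [S] plays the part of the random element independent of [Y n], so no sigma-algebra on lists is
   called for. *)
pose S : measurableType _ := g_sigma_algebraType G.
have mU : measurable_fun setT (fun w : T => w : S).
  move=> _ A sA; rewrite setTI; apply: sA; split; last exact: Gm.
  exact: sigma_algebra_measurable.
have mYS i : (i < n)%N -> measurable_fun setT (Y i : S -> R).
  move=> ni _ B mB; rewrite setTI; apply: sub_sigma_algebra.
  exists (fun j => if j == i then B else setT); split.
    by move=> j; case: ifP.
  apply/seteqP; split => [w Bw j _ /=|w Bw].
    by case: eqP => // ->.
  by have := Bw i ni; rewrite /= eqxx.
pose h (z : S * R) := H (rcons (mkseq (Y ^~ z.1) n) z.2).
have mh : measurable_fun setT h.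
  have := @seq_measurable_rcons _ _ _ mH _ (S * R)%type snd
    (fun i z => if (i < n)%N then Y i z.1 else 0).
  have -> : (fun z : S * R => H (rcons (mkseq (fun i => if (i < n)%N then
       Y i z.1 else 0) n) z.2)) = h.
    apply/funext => z; congr H; congr rcons; apply/eq_in_map => i.
    by rewrite mem_iota add0n => /andP[_ ->].
  apply => // i; case ni : (i < n)%N => //.
  by apply: measurableT_comp; [exact: mYS|].
have hM z : `|h z| <= M by apply: HM; rewrite size_rcons size_mkseq.
rewrite iter_int_rcons -IH; last 4 first.
(* The first [n] variables are independent: [insub] fails at the last index, which then receives
   [setT]. *)
- move=> B mB; have := iY (fun i : 'I_n.+1 => oapp B setT (insub (i : nat))).
  rewrite big_ord_recr /= insubF ?ltnn//= preimage_setT probability_setT mule1.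
  under eq_bigr do rewrite valK /=.
  move=> /(_ _)/esym -> => [|i]; last by case: insub => //= ?.
  congr (P _); apply/seteqP; split => w Bw i _ /=; last first.
    by have := Bw (widen_ord (leqnSn n) i) I; rewrite /= valK.
  by case: insubP => //= j _ ji; have := Bw j I; rewrite /= ji.
- by move=> i B ni; apply: muY; exact: ltnW.
- apply: (seq_measurable_Rintegral _ (seq_measurable_rcons mH)) => y s sn.
  by apply: HM; rewrite size_rcons sn.
- move=> s sn; apply: Rintegral_bounded => [|y].
    exact: (param_measurable_pt (seq_measurable_rcons mH)).
  by apply: HM; rewrite size_rcons sn.
have <- := @Rintegral_indep _ S (fun w : T => w : S) (Y n) mu mU (mY n) sYn h M mh hM.
apply: eq_Rintegral => w _; congr H.
by rewrite /mkseq -addn1 iotaD map_cat /= add0n cats1.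
Qed.

Lemma increments_iter_int (I : set R) (V : R -> T -> R) (mu : probability R R)
    (c s h : R) n H (M : R) :
  (forall t, measurable_fun setT (V t)) -> independent_increments P I V -> 0 <= h ->
  (forall i, (i <= n)%N -> I (s + i%:R * h)) ->
  (forall i B, (i < n)%N -> measurable B ->
    P [set w | B (c * (V (s + i.+1%:R * h) w - V (s + i%:R * h) w))] = mu B) ->
  seq_measurable n H -> (forall u, size u = n -> `|H u| <= M) ->
  \int[P]_w H (mkseq (fun i => c * (V (s + i.+1%:R * h) w - V (s + i%:R * h) w)) n) =
  iter_int mu n H.
Proof.
move=> mV iV h0 tI muV mH HM.
pose Y i w := c * (V (s + i.+1%:R * h) w - V (s + i%:R * h) w).
have mc : measurable_fun setT ( *%R c : R -> R).
  by apply: continuous_measurable_fun; exact: mulrl_continuous.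
apply: (@independent_iter_int Y _ _ _ M) => //.
  by move=> i; apply: measurable_funM => //; exact: measurable_funB.
move=> B mB.
have := iV n (fun i => s + i%:R * h) tI _ (fun i => [set y | B i (c * y)]).
apply.
  by move=> i _; rewrite lerD2l ler_wpM2r// ler_nat.
by move=> i; rewrite -[X in measurable X]setTI; exact: mc.
Qed.

End laws.

(** * Smoothing and Gaussian laws *)

Section smoothing.
Variable R : realType.

(** The integral from a base point [a] is a primitive only to the right of [a]. The base point thus
    moves with [x], and subtracting the integral up to 0 makes the value independent of it. *)
Lemma antiderivative (f : R -> R) : continuous f ->
  exists F : R -> R, forall x : R, is_derive x 1 F (f x).
Proof.
move=> cf.
have If (a b : R) : (@lebesgue_measure R).-integrable `[a, b] (EFin \o f).
  apply: continuous_compact_integrable; first exact: segment_compact.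
  exact: continuous_subspaceT.
pose G (a x : R) := (\int[lebesgue_measure]_(t in `[a, x]) f t)%R.
have GB (a b x : R) : a <= b -> b <= x -> G a x - G a b = G b x.
  move=> ab bx; rewrite /G Rintegral_itvB ?bnd_simp// Rintegral_itv_obnd_cbnd//.
  by apply: integrableS (If b x) => //; exact: subset_itv_oc_cc.
have dG (a x : R) : a < x -> is_derive x 1 (G a) (f x).
  move=> ax; have [] := @continuous_FTC1_closed _ f a x (x + 1) _ (If _ _) ax (cf x).
    by rewrite ltrDl.
  by move=> dx fx; rewrite -fx derive1E; exact/derivableP.
pose b (x : R) := Num.min x 0 - 1.
pose F (x : R) : R := G (b x) x - G (b x) 0.
have FE (a x : R) : a <= b x -> F x = G a x - G a 0.
  move=> ax; have bx : b x <= x by rewrite /b; case: (leP x 0) => ?; lra.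
  have b0 : b x <= 0 by rewrite /b; case: (leP x 0) => ?; lra.
  by rewrite /F -(GB a _ x ax bx) -(GB a _ 0 ax b0) opprB addrA subrK.
exists F => x; pose a := Num.min x 0 - 2.
have dGa : is_derive x 1 (fun y => G a y - G a 0) (f x).
  have ax : a < x by rewrite /a; case: (leP x 0) => ?; lra.
  have := dG a x ax => dGx.
  by apply: is_derive_eq; rewrite subr0.
apply: near_eq_is_derive dGa; near=> y; apply/esym/FE.
(* The offsets 2 in [a] and 1 in [b] leave room for this: [a] stays below [b y] for every [y] within
   distance 1 of [x]. *)
have : `|x - y| < 1 by near: y; exact: nbhsx_ballx.
rewrite ltr_distlC /a /b => /andP[? ?].
by case: (leP x 0) => ?; case: (leP y 0) => ?; lra.
Unshelve. all: by end_near. Qed.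

Lemma mvt (g dg : R -> R) (x y : R) : (forall z : R, is_derive z 1 g (dg z)) ->
  exists2 c, `|c - x| <= `|y - x| & g y - g x = dg c * (y - x).
Proof.
move=> dgz.
have cg : continuous g.
  by move=> z; apply/differentiable_continuous/derivable1_diffP; have [] := dgz z.
have [xy|/ltW yx] := leP x y.
  have [|c] := @MVT_segment _ g dg _ _ xy (fun z _ => dgz z).
    exact: continuous_subspaceT.
  rewrite in_itv/= => /andP[xc cy] gE; exists c => //.
  by rewrite !ger0_norm ?subr_ge0// lerB.
have [|c] := @MVT_segment _ g dg _ _ yx (fun z _ => dgz z).
  exact: continuous_subspaceT.
rewrite in_itv/= => /andP[xc cy] gE; exists c.
  by rewrite !ler0_norm ?subr_le0// lerN2 lerB.
by rewrite -opprB gE -mulrN opprB.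
Qed.

Section taylor.
Variables (f F F1 : R -> R) (L M : R).
Hypotheses (fL : forall x y, `|f x - f y| <= L * `|x - y|)
  (fM : forall x, `|f x| <= M).
Hypotheses (dF1 : forall x : R, is_derive x 1 F1 (f x))
  (dF : forall x : R, is_derive x 1 F (F1 x)).

Let L0 : 0 <= L.
Proof. by have := fL 1 0; rewrite subr0 normr1 mulr1; apply: le_trans. Qed.

Lemma taylor1 x y :
  `|F1 y - F1 x - (y - x) * f x| <= Num.min (2 * M) (L * `|y - x|) * `|y - x|.
Proof.
have [c cx ->] := mvt x y dF1.
rewrite [_ * f x]mulrC -mulrBl normrM ler_wpM2r// le_min; apply/andP; split.
  by rewrite (le_trans (ler_normB _ _))// mulr2n mulrDl mul1r lerD.
by rewrite (le_trans (fL _ _))// ler_wpM2l.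
Qed.

(** As a function of its endpoint the remainder vanishes at [x], and its derivative is the remainder
    of [taylor1]; the mean value theorem then adds one factor [y - x]. *)
Lemma taylor2 x y :
  `|F y - F x - (y - x) * F1 x - (y - x) ^+ 2 / 2 * f x| <=
  Num.min (2 * M) (L * `|y - x|) * (y - x) ^+ 2.
Proof.
pose g u := F u - (u - x) * F1 x - (u - x) ^+ 2 / 2 * f x.
have dg (u : R) : is_derive u 1 g (F1 u - F1 x - (u - x) * f x).
  have := dF u => dFu; rewrite /g.
  apply: is_derive_eq; rewrite /GRing.scale /=; by field.
have [c cx] := mvt x y dg.
have -> : g x = F x by rewrite /g subrr !mul0r !subr0 expr0n /= mul0r mul0r subr0.
rewrite {1}/g => gE.
have -> : F y - F x - (y - x) * F1 x - (y - x) ^+ 2 / 2 * f x =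
  F y - (y - x) * F1 x - (y - x) ^+ 2 / 2 * f x - F x by ring.
rewrite gE normrM -[_ ^+ 2]real_normK ?num_real// expr2 mulrA ler_wpM2r//.
rewrite (le_trans (taylor1 _ _))// ler_pM//.
  by rewrite le_min !mulr_ge0// (le_trans _ (fM 0)).
rewrite le_min !ge_min lexx/=; apply/orP; right.
by rewrite ler_wpM2l.
Qed.

End taylor.

Lemma lipschitz_continuous (f : R -> R) (L : R) :
  (forall x y, `|f x - f y| <= L * `|x - y|) -> continuous f.
Proof.
move=> fL.
have L0 : 0 <= L by have := fL 1 0; rewrite subr0 normr1 mulr1; apply: le_trans.
move=> x; apply/cvgrPdist_le => eps eps0.
have L1 : 0 < L + 1 by rewrite ltr_wpDl.
have eL : 0 < (L + 1)^-1 * eps by rewrite mulr_gt0// invr_gt0.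
have /cvgrPdist_le/(_ _ eL) : z @[z --> x] --> x by exact: cvg_id.
apply: filterS => y xy; rewrite (@le_trans _ _ ((L + 1) * `|x - y|))//.
  by rewrite (le_trans (fL _ _))// ler_wpM2r// lerDl.
by rewrite -ler_pdivlMl.
Qed.

Lemma smooth_approximation (f : R -> R) (L M e : R) : 0 < e ->
  (forall x y, `|f x - f y| <= L * `|x - y|) -> (forall x, `|f x| <= M) ->
  exists g g1 g2 : R -> R, [/\ continuous g,
    forall x, `|g x - f x| <= 10 * L * e &
    forall x y, `|g (x + y) - g x - y * g1 x - y ^+ 2 / 2 * g2 x| <=
      4 * (2 * M + L) / e ^+ 2 * (y ^+ 2 * Num.min 1 `|y|)].
Proof.
move=> e0 fL fM.
have L0 : 0 <= L by have := fL 1 0; rewrite subr0 normr1 mulr1; apply: le_trans.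
have M0 : 0 <= M by rewrite (le_trans _ (fM 0)).
have lipc := lipschitz_continuous fL.
have [F1 dF1] := antiderivative lipc.
have cts (h dh : R -> R) : (forall z : R, is_derive z 1 h (dh z)) -> continuous h.
  by move=> dhz z; apply/differentiable_continuous/derivable1_diffP; have [] := dhz z.
have [F dF] := antiderivative (cts _ _ dF1).
have Fc := cts _ _ dF.
pose D (h : R -> R) x := (h (x + 2 * e) - 2 * h (x + e) + h x) / e ^+ 2.
have e2 : 0 < e ^+ 2 by rewrite exprn_gt0.
have ne := lt0r_neq0 e0.
have DE (a2 a1 a0 b2 b1 b0 : R) : `|a2| <= b2 -> `|a1| <= b1 -> `|a0| <= b0 ->
    `|(a2 - 2 * a1 + a0) / e ^+ 2| <= (b2 + 2 * b1 + b0) / e ^+ 2.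
  move=> ab2 ab1 ab0; rewrite normrM [`|_^-1|]ger0_norm ?invr_ge0 ?(ltW e2)//.
  rewrite ler_wpM2r ?invr_ge0 ?(ltW e2)// (le_trans (ler_normD _ _))// lerD//.
  by rewrite (le_trans (ler_normB _ _))// lerD// normrM ger0_norm// ler_wpM2l.
(* A second difference quotient of a second primitive of f: it has a bounded
   Lipschitz second derivative. *)
exists (D F), (D F1), (D f); split.
- move=> x; rewrite /D; apply: cvgM; last exact: cvg_cst.
  apply: cvgD; last exact: Fc.
  have sh (c : R) : F (z + c) @[z --> x] --> F (x + c).
    apply: (cvg_comp (fun z => z + c) F); last exact: Fc.
    by apply: cvgD; [exact: cvg_id|exact: cvg_cst].
  by apply: cvgB; [exact: sh|apply: cvgM; [exact: cvg_cst|exact: sh]].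
(* Taylor's formula at [x + 2 * e] and [x + e]: the remainders are at most 8 L e^3 and L e^3, and
   the second counts twice, which gives 10 L e^3 before the division by e^2. *)
- move=> x.
  have := taylor2 fL fM dF1 dF x (x + 2 * e).
  have := taylor2 fL fM dF1 dF x (x + e).
  rewrite ![x + _ - x]addrAC !subrr !add0r.
  set a1 := (X in `|X|); set b1 := (X in _ <= X) => ab1.
  set a2 := (X in `|X|); set b2 := (X in _ <= X) => ab2.
  have -> : D F x - f x = (a2 - 2 * a1 + 0) / e ^+ 2.
    by rewrite /D /a2 /a1; field.
  rewrite (le_trans (DE _ _ _ _ _ 0 ab2 ab1 _)) ?normr0//.
  rewrite ler_pdivrMr//.
  have b1le : b1 <= L * e * e ^+ 2.
    by rewrite ler_wpM2r ?(ltW e2)// ge_min gtr0_norm// lexx orbT.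
  have b2le : b2 <= L * (2 * e) * (2 * e) ^+ 2.
    by rewrite ler_wpM2r ?sqr_ge0// ge_min gtr0_norm ?mulr_gt0// lexx orbT.
  rewrite (le_trans (lerD (lerD b2le (ler_wpM2l _ b1le)) (lexx _)))//.
  by rewrite le_eqVlt; apply/orP; left; apply/eqP; ring.
(* The remainder is the second difference of three remainders of [F]. The weights 1, 2, 1 make the
   factor 4, and min(2M, L|y|) is at most (2M + L) min(1, |y|). *)
- move=> x y.
  have T z := taylor2 fL fM dF1 dF z (z + y).
  have T0 : Num.min (2 * M) (L * `|y|) * y ^+ 2 <= (2 * M + L) * (y ^+ 2 * Num.min 1 `|y|).
    rewrite [y ^+ 2 * _]mulrC [leRHS]mulrA ler_wpM2r ?sqr_ge0//.
    case: (leP 1 `|y|) => y1.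
      by rewrite mulr1 ge_min lerDl L0.
    by rewrite [leRHS]mulrDl ge_min; apply/orP; right; rewrite lerDr mulr_ge0// mulr_ge0.
  have := T x; have := T (x + e); have := T (x + 2 * e).
  rewrite ![_ + y - _]addrAC !subrr !add0r.
  set a2 := (X in `|X|) => ab2; set a1 := (X in `|X|) => ab1.
  set a0 := (X in `|X|) => ab0.
  rewrite [X in `|X|](_ : _ = (a2 - 2 * a1 + a0) / e ^+ 2); last first.
    rewrite /D /a2 /a1 /a0 [x + y + _]addrAC [x + y + e]addrAC; by field.
  rewrite (le_trans (DE _ _ _ _ _ _ ab2 ab1 ab0))//.
  rewrite mulrAC ler_wpM2r ?invr_ge0 ?(ltW e2)//.
  by rewrite -mulrA (le_trans _ (ler_wpM2l _ T0))//; lra.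
Unshelve. all: by end_near. Qed.

End smoothing.

(** * Density, scaling, symmetry and second moment of the normal law *)

Section gaussian.
Variable R : realType.
Local Notation mu := (@lebesgue_measure R).
Implicit Types s x : R.

Lemma ge0_integral_normal (m s : R) (G : R -> R) :
  (forall x, 0 <= G x) -> measurable_fun setT G ->
  (\int[normal_prob m s]_x (G x)%:E = \int[mu]_x (G x * normal_pdf m s x)%:E)%E.
Proof.
move=> G0 mG; under [RHS]eq_integral do rewrite EFinM.
have mf : measurable_fun setT (EFin \o G) by exact/measurable_EFinP.
have numu := normal_prob_dominates m s.
rewrite -(Radon_Nikodym_SigmaFinite.change_of_variables numu)//.
apply: ae_eq_integral => //.
- apply: emeasurable_funM => //; apply: (measurable_int mu).
  exact: (Radon_Nikodym_SigmaFinite.f_integrable numu).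
- apply: emeasurable_funM => //=; apply/measurable_EFinP.
  exact: measurable_normal_pdf.
- apply: ae_eqe_mul2l => /=.
  apply: integral_ae_eq => //=.
  + exact: (Radon_Nikodym_SigmaFinite.f_integrable numu).
  + by apply/measurable_EFinP; exact: measurable_normal_pdf.
  + move=> E _ mE; rewrite -(Radon_Nikodym_SigmaFinite.f_integral numu)//.
Qed.

Local Notation phi := (@normal_pdf R 0 1).

Lemma normal_pdf01E x : phi x = (Num.sqrt (pi *+ 2))^-1 * expR (- (x ^+ 2 / 2)).
Proof.
rewrite normal_pdfE ?oner_eq0//= /normal_peak /normal_fun expr1n mul1r subr0.
by rewrite mulNr.
Qed.

Lemma normal_pdf_scale s x : 0 < s -> normal_pdf 0 s (s * x) * s = phi x.
Proof.
move=> s0; have sn0 := lt0r_neq0 s0.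
rewrite normal_pdf01E normal_pdfE// /normal_peak /normal_fun subr0.
rewrite mulrAC; congr (_ * expR _).
  rewrite -mulrnAr sqrtrM ?sqr_ge0// sqrtr_sqr gtr0_norm// invfM mulrAC.
  by rewrite mulVf// mul1r.
by rewrite exprMn -mulr_natr; field.
Qed.

(** Change of variables in the density. Continuity and nonnegativity of [G] come from the
    substitution theorem; [scaled_law] keeps exactly this class of test functions. *)
Lemma ge0_integral_normal_scale s (G : R -> R) : 0 < s -> continuous G ->
  (forall x, 0 <= G x) ->
  (\int[normal_prob 0 s]_x (G x)%:E = \int[normal_prob 0 1]_x (G (s * x))%:E)%E.
Proof.
move=> s0 cG G0; have sn0 := lt0r_neq0 s0.
pose sc (x : R) : R := s * x.
have cs : continuous sc by exact: mulrl_continuous.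
have mG := continuous_measurable_fun cG.
have mGs : measurable_fun setT (fun x => G (s * x)).
  exact: (measurableT_comp mG (continuous_measurable_fun cs)).
rewrite (ge0_integral_normal _ _ G0 mG).
rewrite (ge0_integral_normal _ _ (fun x => G0 (s * x)) mGs).
have ds x : derivable sc x 1 by [].
have dsE : derive1 sc = cst s.
  apply/funext => x; rewrite derive1E.
  by rewrite /sc deriveM// derive_cst scaler0 addr0 derive_id /GRing.scale/= mulr1.
have sc_homo : {homo sc : x y / x < y} by move=> x y xy; rewrite /sc ltr_pM2l.
have csc' : continuous (derive1 sc) by rewrite dsE => x; exact: cvg_cst.
have cvNy : cvg (derive1 sc x @[x --> -oo]) by rewrite dsE; exact: is_cvg_cst.
have cvy : cvg (derive1 sc x @[x --> +oo]) by rewrite dsE; exact: is_cvg_cst.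
have scNy : sc x @[x --> -oo] --> -oo by apply/gt0_cvgMrNy => //; exact: cvg_id.
have scy : sc x @[x --> +oo] --> +oo by apply/gt0_cvgMry => //; exact: cvg_id.
have cH : continuous (fun x => G x * normal_pdf 0 s x).
  by move=> x; apply: cvgM; [exact: cG|exact: continuous_normal_pdf].
have H0 x : 0 <= G x * normal_pdf 0 s x by rewrite mulr_ge0// normal_pdf_ge0.
rewrite (increasing_ge0_integration_by_substitutionT sc_homo csc' cvNy cvy ds
  scNy scy cH H0).
apply: eq_integral => x _; rewrite dsE; congr EFin.
by rewrite fctE /= -mulrA normal_pdf_scale.
Qed.

Lemma ge0_integral_normal_sym (G : R -> R) : continuous G -> (forall x, 0 <= G x) ->
  (\int[normal_prob 0 1]_x (G (- x))%:E = \int[normal_prob 0 1]_x (G x)%:E)%E.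
Proof.
move=> cG G0.
have phiN x : phi (- x) = phi x by rewrite !normal_pdf01E sqrrN.
have cphi : continuous phi by apply: continuous_normal_pdf.
have split_int (H : R -> R) : continuous H -> (forall x, 0 <= H x) ->
  (\int[mu]_x (H x)%:E = \int[mu]_(x in `[0%R, +oo[) (H (- x))%:E
     + \int[mu]_(x in `[0%R, +oo[) (H x)%:E)%E.
  move=> cH H0.
  have mH D : measurable_fun D (EFin \o H).
    by apply/measurable_EFinP/measurable_funTS; exact: continuous_measurable_fun.
  rewrite -(setUv `]-oo, (0:R)]) setCitvl ge0_integral_setU//=; first last.
  - apply/disj_setPS => x [/=]; rewrite !in_itv/= andbT => ? ?; lra.
  - by move=> x _; rewrite lee_fin.
  - exact: mH.
  rewrite integral_itv_obnd_cbnd//; congr (_ + _)%E.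
  rewrite -{1}oppr0 ge0_integration_by_substitutionNy//.
  exact: continuous_subspaceT.
have cGN : continuous (G \o -%R).
  by move=> x; apply: continuous_comp; [exact: oppr_continuous|exact: cG].
rewrite (ge0_integral_normal _ _ G0 (continuous_measurable_fun cG)).
rewrite (ge0_integral_normal _ _ (fun x => G0 (- x)) (continuous_measurable_fun cGN)).
have c1 : continuous (fun x => G (- x) * phi x).
  by move=> x; apply: cvgM; [exact: cGN|exact: cphi].
have c2 : continuous (fun x => G x * phi x).
  by move=> x; apply: cvgM; [exact: cG|exact: cphi].
rewrite split_int//; last first.
  by move=> x; rewrite mulr_ge0// normal_pdf_ge0.
rewrite split_int//; last first.
  by move=> x; rewrite mulr_ge0// normal_pdf_ge0.
under eq_integral do rewrite opprK phiN.
under [X in (_ = X + _)%E]eq_integral do rewrite phiN.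
exact: addeC.
Qed.

(** Integration by parts with the primitive x phi(x) of phi(x)(1 - x^2), on the half-line by
    symmetry. The integrand changes sign at 1, so the fundamental theorem is applied on [0, 1] and
    on [1, +oo[ separately, to nonnegative integrands, and the boundary terms at 1 cancel. *)
Lemma normal_second_moment : (\int[normal_prob 0 (1 : R)]_x (x ^+ 2)%:E = 1)%E.
Proof.
have cphi : continuous phi by apply: continuous_normal_pdf.
have phi0 x : 0 <= phi x by rewrite normal_pdf_ge0.
have cX2 : continuous (fun x : R => x ^+ 2) by exact: exprn_continuous.
rewrite (ge0_integral_normal _ _ (fun x => sqr_ge0 x) (continuous_measurable_fun cX2)).
have cX2phi : continuous (fun x => x ^+ 2 * phi x).
  by move=> x; apply: cvgM; [exact: cX2|exact: cphi].
have phiN x : phi (- x) = phi x by rewrite !normal_pdf01E sqrrN.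
have := @integral_normal_pdf R 0 1.
rewrite (@ge0_symfun_integralT _ phi)//; last by move=> x /=; rewrite phiN.
rewrite (@ge0_symfun_integralT _ (fun x => x ^+ 2 * phi x))//; first last.
- by move=> x /=; rewrite phiN sqrrN.
- by move=> x; rewrite mulr_ge0// sqr_ge0.
move=> <-; congr (_ * _)%E.
pose F x : R := x * phi x.
pose c : R := (Num.sqrt (pi *+ 2))^-1.
have phiE : phi = fun x => c * expR (- (x ^+ 2 / 2)).
  by apply/funext => x; rewrite normal_pdf01E.
have dF x : is_derive x 1 F (phi x * (1 - x ^+ 2)).
  rewrite /F phiE; apply: is_derive_eq.
  by rewrite /GRing.scale/=; field.
have c0 : 0 <= c by rewrite invr_ge0 sqrtr_ge0.
(* Since exp(x^2/2) is at least x^2/2, the function is below 2c/x. *)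
have Fcvg : F x @[x --> +oo%R] --> (0 : R).
  rewrite -(mulr0 (c * 2)).
  have inv0 : x^-1 @[x --> +oo%R] --> (0 : R).
    by apply/gtr0_cvgV0; [exact: nbhs_pinfty_gt|exact: cvg_id].
  apply: (@squeeze_cvgr _ _ _ _ (fun=> 0) (fun x => c * 2 * x^-1)).
  - near=> x; have x0 : 0 < x by near: x; exact: nbhs_pinfty_gt.
    rewrite /F mulr_ge0 ?(ltW x0)//= phiE mulrCA -mulrA ler_wpM2l//.
    rewrite expRN ler_pdivrMr ?expR_gt0// (le_trans _ (ler_wpM2l _ (expR_ge1Dx _)))//.
      rewrite mulrDr mulr1 -[leLHS]add0r lerD ?divr_ge0//.
      by rewrite le_eqVlt; apply/orP; left; apply/eqP; field; rewrite lt0r_neq0.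
    by rewrite divr_ge0// ltW.
  - by rewrite mulr0; exact: cvg_cst.
  - by apply: cvgM => //; exact: cvg_cst.
have mphi D : measurable_fun D (EFin \o phi).
  by apply/measurable_EFinP/measurable_funTS; exact: continuous_measurable_fun.
have mX2 D : measurable_fun D (EFin \o (fun x => x ^+ 2 * phi x)).
  by apply/measurable_EFinP/measurable_funTS; exact: continuous_measurable_fun.
have split_int (H : R -> R) : measurable_fun setT (EFin \o H) -> (forall x, 0 <= H x) ->
  (\int[mu]_(x in [set x | (0 <= x)%R]) (H x)%:E = \int[mu]_(x in `[0%R, 1%R]) (H x)%:E
     + \int[mu]_(x in `[1%R, +oo[) (H x)%:E)%E.
  move=> mH H0.
  rewrite -set_itvcy (@itv_bndbnd_setU _ _ (BLeft 0) (BRight 1) +oo%O)//; last first.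
    by rewrite bnd_simp.
  rewrite ge0_integral_setU//=.
  - by rewrite integral_itv_obnd_cbnd//; exact: measurable_funTS.
  - exact: measurable_funTS.
  - by move=> x _; rewrite lee_fin.
  - by apply/disj_setPS => x [/=]; rewrite !in_itv/= andbT => /andP[_ x1]; rewrite ltNge x1.
rewrite !split_int//; last by move=> x; rewrite mulr_ge0// sqr_ge0.
have cF : continuous F.
  by move=> x; apply/differentiable_continuous/derivable1_diffP; have [] := dF x.
have derF x : derive1 F x = phi x * (1 - x ^+ 2).
  by rewrite derive1E; have [_ ->] := dF x.
have i01 : (\int[mu]_(x in `[0%R, 1%R]) (phi x)%:E = (F 1)%:E +
    \int[mu]_(x in `[0%R, 1%R]) (x ^+ 2 * phi x)%:E)%E.
  have cf : continuous (fun x => phi x * (1 - x ^+ 2)).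
    by move=> x; apply: cvgM; [exact: cphi|apply: cvgB; [exact: cvg_cst|exact: cX2]].
  have -> : (F 1)%:E = (\int[mu]_(x in `[0%R, 1%R]) (phi x * (1 - x ^+ 2))%:E)%E.
    rewrite (@continuous_FTC2 _ _ F)//.
    - by rewrite /F mul0r sube0.
    - exact: continuous_subspaceT.
    - split=> [x _||]; first by have [] := dF x.
        by apply: cvg_at_right_filter; exact: cF.
      by apply: cvg_at_left_filter; exact: cF.
  rewrite -ge0_integralD//=.
  - by apply: eq_integral => x _; rewrite -EFinD; congr EFin; ring.
  - move=> x; rewrite in_itv/= => /andP[x0 x1].
    by rewrite lee_fin mulr_ge0// subr_ge0 exprn_ile1.
  - by apply/measurable_EFinP/measurable_funTS; exact: continuous_measurable_fun.
  - by move=> x _; rewrite lee_fin mulr_ge0// sqr_ge0.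
  - exact: mX2.
have i1y : (\int[mu]_(x in `[1%R, +oo[) (x ^+ 2 * phi x)%:E = (F 1)%:E +
    \int[mu]_(x in `[1%R, +oo[) (phi x)%:E)%E.
  have cf : continuous (fun x => phi x * (x ^+ 2 - 1)).
    by move=> x; apply: cvgM; [exact: cphi|apply: cvgB; [exact: cX2|exact: cvg_cst]].
  have f0 x : 1 <= x -> 0 <= phi x * (x ^+ 2 - 1).
    by move=> x1; rewrite mulr_ge0// subr_ge0 exprn_ege1.
  have -> : (F 1)%:E = (\int[mu]_(x in `[1%R, +oo[) (phi x * (x ^+ 2 - 1))%:E)%E.
    rewrite (@ge0_continuous_FTC2y _ _ (fun x => - F x) _ 0)//.
    - by rewrite EFinN oppeK add0e.
    - exact: continuous_subspaceT.
    - by rewrite -oppr0; apply: cvgN.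
    - by apply: cvgN; apply: cvg_at_right_filter; exact: cF.
    - move=> x _; rewrite derive1N; last by have [] := dF x.
      by rewrite derF -mulrN opprB.
  rewrite -ge0_integralD//=.
  - by apply: eq_integral => x _; rewrite -EFinD; congr EFin; ring.
  - by move=> x; rewrite in_itv/= andbT => x1; rewrite lee_fin f0.
  - by apply/measurable_EFinP/measurable_funTS; exact: continuous_measurable_fun.
  - by move=> x _; rewrite lee_fin.
  - exact: mphi.
by rewrite i01 i1y addeCA addeA.
Unshelve. all: by end_near. Qed.

End gaussian.

(** * Laws with finite second moment and their truncated moments *)

Section moments.
Variable R : realType.
Implicit Types (mu nu : probability R R) (c v : R).

Definition sq_integrable mu : Prop := mu.-integrable setT (fun y => (y ^+ 2)%:E).

(** Lindeberg's quantity in a smooth form: the weight min(1, c|y|) is the one in the Taylor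
    remainder of a function with bounded Lipschitz second derivative. *)
Definition trunc_moment mu c : R := \int[mu]_y (y ^+ 2 * Num.min 1 (c * `|y|)).

Definition centered_law mu v : Prop :=
  [/\ sq_integrable mu, \int[mu]_y y = 0 & \int[mu]_y y ^+ 2 = v].

Lemma continuous_trunc c : continuous (fun y : R => y ^+ 2 * Num.min 1 (c * `|y|)).
Proof.
move=> y; apply: cvgM; first exact: exprn_continuous.
apply: (@continuous_min _ _ (fun=> 1) (fun z => c * `|z|)); first exact: cvg_cst.
by apply: cvgM; [exact: cvg_cst|exact: norm_continuous].
Qed.

Lemma integrable_le_sq mu (f : R -> R) a b : sq_integrable mu ->
  measurable_fun setT f -> (forall y, `|f y| <= a + b * y ^+ 2) ->
  mu.-integrable setT (EFin \o f).
Proof.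
move=> mu2 mf fab; apply: (@le_integrable _ _ _ mu _ measurableT _
  (fun y : R => ((EFin \o cst a) y + b%:E * (y ^+ 2)%R%:E)%E)).
- exact/measurable_EFinP.
- move=> y _; rewrite /= lee_fin (le_trans (fab y))//.
  by rewrite ler_norm.
- apply: integrableD => //; first exact: finite_measure_integrable_cst.
  exact: integrableZl.
Qed.

Lemma integrable_id mu : sq_integrable mu -> mu.-integrable setT (fun y => y%:E).
Proof.
move=> mu2; apply: (@integrable_le_sq _ (fun y => y) 1 1) => // y.
rewrite mul1r; case: (leP `|y| 1) => y1.
  by rewrite (le_trans y1)// lerDl sqr_ge0.
rewrite -[_ ^+ 2]real_normK ?num_real// (le_trans (ler_peMr _ (ltW y1)))//.
by rewrite -expr2 lerDr.
Qed.

Lemma trunc_ge0 c (y : R) : 0 <= c -> 0 <= y ^+ 2 * Num.min 1 (c * `|y|).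
Proof. by move=> c0; rewrite mulr_ge0 ?sqr_ge0// le_min ler01 mulr_ge0. Qed.

Lemma trunc_le c (y : R) : y ^+ 2 * Num.min 1 (c * `|y|) <= y ^+ 2.
Proof. by rewrite ler_piMr ?sqr_ge0// ge_min lexx. Qed.

Lemma integrable_trunc mu c : 0 <= c -> sq_integrable mu ->
  mu.-integrable setT (EFin \o (fun y => y ^+ 2 * Num.min 1 (c * `|y|))).
Proof.
move=> c0 mu2; apply: (@integrable_le_sq _ _ 0 1) => //.
  exact: (continuous_measurable_fun (@continuous_trunc c)).
by move=> y; rewrite ger0_norm ?trunc_ge0// add0r mul1r trunc_le.
Qed.

Lemma le_trunc_moment mu c1 c2 : sq_integrable mu -> 0 <= c1 -> c1 <= c2 ->
  trunc_moment mu c1 <= trunc_moment mu c2.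
Proof.
move=> mu2 c0 c12; apply: le_Rintegral => //.
- exact: integrable_trunc.
- by apply: integrable_trunc => //; exact: le_trans c12.
- move=> y _; rewrite ler_wpM2l ?sqr_ge0// le_min ge_min lexx/= ge_min.
  by rewrite ler_wpM2r ?orbT.
Qed.

(** Dominated convergence along c = 1/(n + 1), with y^2 as dominating function; monotonicity in [c]
    covers the other values. *)
Lemma trunc_moment_cvg0 mu e : sq_integrable mu -> 0 < e ->
  exists2 c0, 0 < c0 & forall c, 0 <= c -> c <= c0 -> trunc_moment mu c <= e.
Proof.
move=> mu2 e0.
pose f (n : nat) (y : R) : \bar R := (y ^+ 2 * Num.min 1 (n.+1%:R^-1 * `|y|))%:E.
have mf n : measurable_fun setT (f n).
  by apply/measurable_EFinP; exact: (continuous_measurable_fun (@continuous_trunc _)).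
have [||| |_ _ fcvg] := @dominated_convergence _ _ _ mu setT measurableT f (cst 0)%E
    (fun y => (y ^+ 2)%:E) mf.
- exact: measurable_cst.
- apply: aeW => y _; rewrite /f.
  rewrite [X in _ --> X](_ : _ = (y ^+ 2 * 0)%:E); last by rewrite mulr0.
  apply: cvg_EFin; first exact: nearW.
  apply: cvgM; first exact: cvg_cst.
  apply: (@squeeze_cvgr _ _ _ _ (fun=> 0) (fun n => n.+1%:R^-1 * `|y|)).
  - by apply: nearW => n; rewrite le_min ler01 mulr_ge0//= ge_min lexx orbT.
  - exact: cvg_cst.
  - rewrite -[X in _ --> X](mul0r `|y|); apply: cvgM; last exact: cvg_cst.
    exact: cvg_harmonic.
- exact: mu2.
- by apply: aeW => y n _; rewrite /f gee0_abs lee_fin ?trunc_le ?trunc_ge0.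
move: fcvg; rewrite integral0 => /fine_cvgP[_] /cvgrPdist_le/(_ _ e0)[N _ HN].
exists N.+1%:R^-1 => // c c0 cN; rewrite (le_trans (le_trunc_moment mu2 c0 cN))//.
have := HN N (leqnn N); rewrite /= sub0r normrN; apply: le_trans.
exact: ler_norm.
Qed.

(** The linear term integrates to 0 and the quadratic one to [v / 2 * g2 x], so the main term
    depends on the law only through its variance. This makes two such laws interchangeable. *)
Lemma taylor_expectation mu v (g g1 g2 : R -> R) (B C : R) x :
  centered_law mu v -> continuous g -> (forall x, `|g x| <= B) ->
  (forall x y, `|g (x + y) - g x - y * g1 x - y ^+ 2 / 2 * g2 x| <=
     C * (y ^+ 2 * Num.min 1 `|y|)) ->
  `|\int[mu]_y g (x + y) - (g x + v / 2 * g2 x)| <= C * trunc_moment mu 1.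
Proof.
move=> [mu2 mu0 muv] cg gB gC.
have cgx : continuous (fun y => g (x + y)).
  move=> y; apply: (cvg_comp (fun y => x + y) g); last exact: cg.
  by apply: cvgD; [exact: cvg_cst|exact: cvg_id].
have i1 : mu.-integrable setT (EFin \o (fun y => g (x + y))).
  apply: (@bounded_integrable _ _ _ _ _ B) => //.
  exact: (continuous_measurable_fun cgx).
have i2 : mu.-integrable setT (EFin \o (fun y => g x)).
  exact: finite_measure_integrable_cst.
have i3 : mu.-integrable setT (EFin \o (fun y => y * g1 x)).
  rewrite (_ : _ \o _ = (fun y => y%:E * (g1 x)%:E)%E)//.
  exact: (integrableZr _ _ (integrable_id mu2)).
have i4 : mu.-integrable setT (EFin \o (fun y => y ^+ 2 * (g2 x / 2))).
  rewrite (_ : _ \o _ = (fun y => (y ^+ 2)%:E * (g2 x / 2)%:E)%E)//.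
  exact: (integrableZr _ _ mu2).
have i12 : mu.-integrable setT (EFin \o (fun y => g (x + y) - g x)).
  exact: (integrableB measurableT i1 i2).
have i123 : mu.-integrable setT (EFin \o (fun y => g (x + y) - g x - y * g1 x)).
  exact: (integrableB measurableT i12 i3).
have i1234 : mu.-integrable setT
    (EFin \o (fun y => g (x + y) - g x - y * g1 x - y ^+ 2 * (g2 x / 2))).
  exact: (integrableB measurableT i123 i4).
have -> : \int[mu]_y g (x + y) - (g x + v / 2 * g2 x) =
    \int[mu]_y (g (x + y) - g x - y * g1 x - y ^+ 2 * (g2 x / 2)).
  rewrite (RintegralB measurableT i123 i4) (RintegralB measurableT i12 i3).
  rewrite (RintegralB measurableT i1 i2) Rintegral_cst1.
  rewrite (RintegralZr _ measurableT (integrable_id mu2)) (RintegralZr _ measurableT mu2).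
  by rewrite mu0 muv; field.
rewrite (le_trans (le_normr_Rintegral measurableT i1234))//.
rewrite -RintegralZl//; last exact: (integrable_trunc ler01).
apply: le_Rintegral => //.
- have := integrable_abse i1234; exact.
- have := integrable_trunc ler01 mu2 => it.
  exact: (integrableZl measurableT C it).
- move=> y _; rewrite mul1r (le_trans _ (gC x y))// le_eqVlt; apply/orP; left.
  by apply/eqP; congr `|_|; field.
Qed.

(* mu is the law of c X, where X has law nu. *)
Definition scaled_law mu nu c : Prop := forall G : R -> R, continuous G ->
  (forall x, 0 <= G x) -> (\int[mu]_x (G x)%:E = \int[nu]_x (G (c * x)%R)%:E)%E.

Lemma scaled_centered mu nu c v : 0 <= c -> scaled_law mu nu c -> centered_law nu v ->
  centered_law mu (c ^+ 2 * v) /\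
  (forall k, 0 <= k -> trunc_moment mu k = c ^+ 2 * trunc_moment nu (k * c)).
Proof.
move=> c0 mn [nu2 nu0 nuv].
have cX2 : continuous (fun y : R => y ^+ 2) by exact: exprn_continuous.
have E2 : (\int[mu]_y (y ^+ 2)%:E = (c ^+ 2)%:E * \int[nu]_y (y ^+ 2)%:E)%E.
  rewrite (mn (fun y => y ^+ 2))//; last by move=> y; exact: sqr_ge0.
  under eq_integral do rewrite exprMn EFinM.
  by rewrite integralZl.
have nufin := integrable_fin_num measurableT nu2.
have mu2 : sq_integrable mu.
  apply/integrableP; split; first by apply/measurable_EFinP; exact: continuous_measurable_fun.
  under eq_integral do rewrite gee0_abs ?lee_fin ?sqr_ge0//.
  by rewrite E2 -(fineK nufin) -EFinM ltry.
split; first split => //.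
- have cpos : continuous (fun y : R => Num.max y 0).
    by move=> y; apply: (@continuous_max _ _ (fun z => z) (fun=> 0)); [exact: cvg_id|exact: cvg_cst].
  have cneg : continuous (fun y : R => Num.max (- y) 0).
    by move=> y; apply: (@continuous_max _ _ (fun z => - z) (fun=> 0)); [exact: oppr_continuous|exact: cvg_cst].
  (* [scaled_law] speaks of nonnegative functions only, hence the detour through positive and
     negative parts. *)
  have -> : \int[mu]_y y = \int[nu]_y (c * y).
    rewrite /Rintegral integralE [in RHS]integralE; congr (fine (_ - _)).
      transitivity (\int[mu]_y (Num.max y 0)%:E)%E.
        by apply: eq_integral => y _; rewrite funeposE EFin_max.
      rewrite mn//; last by move=> y; rewrite le_max lexx orbT.
      by apply: eq_integral => y _; rewrite funeposE EFin_max.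
    transitivity (\int[mu]_y (Num.max (- y) 0)%:E)%E.
      by apply: eq_integral => y _; rewrite funenegE EFin_max EFinN.
    rewrite (mn (fun y => Num.max (- y) 0))//; last by move=> y; rewrite le_max lexx orbT.
    by apply: eq_integral => y _; rewrite funenegE EFin_max EFinN.
  by rewrite (RintegralZl _ measurableT (integrable_id nu2)) nu0 mulr0.
- by rewrite /Rintegral E2 fineM//= -nuv.
- move=> k k0; rewrite /trunc_moment -RintegralZl//; last first.
    by apply: integrable_trunc => //; exact: mulr_ge0.
  rewrite /Rintegral (mn _ (@continuous_trunc k)); last by move=> y; exact: trunc_ge0.
  congr fine; apply: eq_integral => y _; congr EFin.
  by rewrite exprMn normrM (ger0_norm c0) !mulrA.
Qed.

(** Both integrals are close to the same second-order expression. The factor [c ^+ 2] is essential: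
    about 1/c^2 such replacements will be made, and the total error is still a truncated moment at
    [c]. *)
Lemma taylor_swap (mu nu mu0 nu0 : probability R R) c v (g g1 g2 : R -> R) (B C : R) x :
  0 <= c -> scaled_law mu mu0 c -> scaled_law nu nu0 c ->
  centered_law mu0 v -> centered_law nu0 v ->
  continuous g -> (forall x, `|g x| <= B) ->
  (forall x y, `|g (x + y) - g x - y * g1 x - y ^+ 2 / 2 * g2 x| <=
     C * (y ^+ 2 * Num.min 1 `|y|)) ->
  `|\int[mu]_y g (x + y) - \int[nu]_y g (x + y)| <=
    C * c ^+ 2 * (trunc_moment mu0 c + trunc_moment nu0 c).
Proof.
move=> c0 sm sn cm cn cg gB gC.
have [cmu tmu] := scaled_centered c0 sm cm.
have [cnu tnu] := scaled_centered c0 sn cn.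
have := taylor_expectation x cmu cg gB gC.
have := taylor_expectation x cnu cg gB gC.
rewrite tmu// tnu// !mul1r.
set a := (g x + _) => h1 h2.
rewrite -(subrKA a) (le_trans (ler_normD _ _))//.
by rewrite -mulrA mulrDr mulrDr (distrC a) lerD.
Qed.

(* The library states normal_prob on another copy of the Borel structure of R. *)
Definition gauss (s : R) : probability R R :=
  law (normal_prob (0 : R) s) (@measurable_id _ R setT).

Lemma ge0_integral_gauss s (G : R -> R) : continuous G -> (forall x, 0 <= G x) ->
  (\int[gauss s]_x (G x)%:E = \int[normal_prob 0%R s]_x (G x)%:E)%E.
Proof.
move=> cG G0; rewrite /gauss ge0_integral_law//.
by apply/measurable_EFinP; exact: continuous_measurable_fun.
Qed.

Lemma gauss_scaled s : 0 < s -> scaled_law (gauss s) (gauss 1) s.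
Proof.
move=> s0 G cG G0; have cGs : continuous (fun x : R => G (s * x)).
  by move=> x; apply: (cvg_comp ( *%R s) G); [exact: mulrl_continuous|exact: cG].
rewrite (ge0_integral_gauss s cG G0).
rewrite (ge0_integral_gauss 1 cGs (fun x => G0 (s * x))).
exact: ge0_integral_normal_scale.
Qed.

Lemma gauss_sym (G : R -> R) : continuous G -> (forall x, 0 <= G x) ->
  (\int[gauss 1]_x (G (- x)%R)%:E = \int[gauss 1]_x (G x)%:E)%E.
Proof.
move=> cG G0; have cGN : continuous (fun x : R => G (- x)).
  by move=> x; apply: (cvg_comp -%R G); [exact: oppr_continuous|exact: cG].
rewrite (ge0_integral_gauss 1 cG G0) (ge0_integral_gauss 1 cGN (fun x => G0 (- x))).
exact: ge0_integral_normal_sym.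
Qed.

Lemma gauss_centered : centered_law (gauss 1) 1.
Proof.
have cX2 : continuous (fun y : R => y ^+ 2) by exact: exprn_continuous.
have mom2 : (\int[gauss 1]_y (y ^+ 2)%:E = 1)%E.
  rewrite (@ge0_integral_gauss _ (fun y => y ^+ 2))//; last by move=> y; exact: sqr_ge0.
  exact: normal_second_moment.
have mu2 : sq_integrable (gauss 1).
  apply/integrableP; split; first by apply/measurable_EFinP; exact: continuous_measurable_fun.
  under eq_integral do rewrite gee0_abs ?lee_fin ?sqr_ge0//.
  by rewrite mom2 ltry.
split => //; last by rewrite /Rintegral mom2.
have cpos : continuous (fun y : R => Num.max y 0).
  by move=> y; apply: (@continuous_max _ _ (fun z => z) (fun=> 0)); [exact: cvg_id|exact: cvg_cst].
have Ipos : (\int[gauss 1]_y (Num.max (- y) 0)%:E = \int[gauss 1]_y (Num.max y 0)%:E)%E.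
  by apply: (@gauss_sym (fun y => Num.max y 0)) => // y; rewrite le_max lexx orbT.
rewrite /Rintegral integralE.
have -> : (\int[gauss 1]_y (fun y : R => y%:E)^\+ y = \int[gauss 1]_y (Num.max y 0)%:E)%E.
  by apply: eq_integral => y _; rewrite funeposE EFin_max.
have -> : (\int[gauss 1]_y (fun y : R => y%:E)^\- y = \int[gauss 1]_y (Num.max y 0)%:E)%E.
  by rewrite -Ipos; apply: eq_integral => y _; rewrite funenegE EFin_max EFinN.
(* Both parts have the same integral; were it infinite, [fine] would return 0 as well. *)
case: (\int[_]_y _)%E => [r| |] //=; by rewrite subrr.
Qed.

End moments.

Lemma truncn_itv_nat (R : realType) (x : R) : 0 <= x ->
  (Num.truncn x)%:R <= x /\ x < (Num.truncn x).+1%:R.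
Proof. by move=> x0; have /andP[] := truncn_itv x0. Qed.

Lemma measurable_ind_gt d (T : measurableType d) (R : realType) (f : T -> R) (b : R) :
  measurable_fun setT f -> measurable_fun setT (fun w => (b < f w)%R%:R : R).
Proof.
move=> mf.
have -> : (fun w => (b < f w)%R%:R : R) = \1_(f @^-1` `]b, +oo[).
  apply/funext => w; rewrite indicE; congr ((nat_of_bool _)%:R).
  apply/idP/idP => [bf|]; first by rewrite inE /= in_itv/= bf.
  by rewrite inE/= in_itv/= andbT.
apply: measurable_indic; rewrite -[X in measurable X]setTI.
by apply: mf => //; exact: measurable_itv.
Qed.

Lemma ge0_integral_mulr d (T : measurableType d) (R : realType) (P : probability T R)
    (k : R) (f : T -> R) : measurable_fun setT f -> 0 <= k -> (forall w, 0 <= f w) ->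
  (\int[P]_w (k * f w)%:E = k%:E * \int[P]_w (f w)%:E)%E.
Proof.
move=> mf k0 f0; under eq_integral do rewrite EFinM.
by rewrite ge0_integralZl// => [|w _]; [exact/measurable_EFinP|rewrite lee_fin].
Qed.

(** * Increments and the central limit theorem *)

Section increments.
Context d (T : measurableType d) (R : realType) (P : probability T R).
Variables (V : R -> {RV P >-> R}) (sigma : R).
Hypotheses (V_indep : independent_increments P `[0, +oo[ V)
  (V_homog : homogeneous P V) (V_centered : centered P V)
  (V_0 : {ae P, forall w, V 0 w = 0})
  (V_var : ('E_P[(fun w => V 1 w ^+ 2)%R])%E = (sigma ^+ 2)%:E).

Lemma measurable_inc c s h : measurable_fun setT (fun w => c * (V (s + h) w - V s w)).
Proof. by apply: measurable_funM => //; exact: measurable_funB. Qed.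

(* The law of c (V(h) - V(0)), hence of c (V(s + h) - V(s)) for all s. *)
Definition inc_law c h : probability R R := law P (measurable_inc c 0 h).

Lemma inc_lawE c s h B : 0 <= s -> 0 <= h -> measurable B ->
  P [set w | B (c * (V (s + h) w - V s w))] = inc_law c h B.
Proof.
move=> s0 h0 mB; apply: (V_homog s0 (lexx 0) h0 (B := [set y | B (c * y)])).
rewrite -[X in measurable X]setTI.
by apply: (continuous_measurable_fun (f := *%R c)) => //; exact: mulrl_continuous.
Qed.

Lemma inc_law_setT c s h : 0 <= s -> 0 <= h ->
  forall A, measurable A -> law P (measurable_inc c s h) A = inc_law c h A.
Proof. by move=> s0 h0 A mA; exact: inc_lawE. Qed.

Lemma ge0_integral_inc c s h (f : R -> \bar R) : 0 <= s -> 0 <= h ->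
  measurable_fun setT f -> (forall y, 0 <= f y)%E ->
  (\int[P]_w f (c * (V (s + h) w - V s w))%R = \int[inc_law c h]_y f y)%E.
Proof.
move=> s0 h0 mf f0; rewrite -(ge0_integral_law _ (measurable_inc c s h) mf f0).
by apply: eq_measure_integral => A mA _; exact: inc_law_setT.
Qed.

Lemma Rintegral_inc c s h (f : R -> R) (M : R) : 0 <= s -> 0 <= h ->
  measurable_fun setT f -> (forall y, `|f y| <= M) ->
  \int[P]_w f (c * (V (s + h) w - V s w)) = \int[inc_law c h]_y f y.
Proof.
move=> s0 h0 mf fM; rewrite -(Rintegral_law _ (measurable_inc c s h) mf fM).
by rewrite /Rintegral; congr fine; apply: eq_measure_integral => A mA _; exact: inc_law_setT.
Qed.

Lemma inc_iter_int c s h n H (M : R) : 0 <= s -> 0 <= h -> seq_measurable n H ->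
  (forall u, size u = n -> `|H u| <= M) ->
  \int[P]_w H (mkseq (fun i => c * (V (s + i.+1%:R * h) w - V (s + i%:R * h) w)) n) =
  iter_int (inc_law c h) n H.
Proof.
move=> s0 h0 mH HM; apply: (increments_iter_int _ V_indep h0 _ _ mH HM) => //.
- by move=> i _; rewrite /= in_itv/= andbT addr_ge0// mulr_ge0.
- move=> i B _ mB; rewrite -(inc_lawE c (s := s + i%:R * h) _ h0 mB).
    by rewrite -addrA -natr1 mulrDl mul1r.
  by rewrite addr_ge0// mulr_ge0.
Qed.

Lemma two_increments s h (f : R * R -> \bar R) : 0 <= s -> 0 <= h ->
  measurable_fun setT f -> (forall z, 0 <= f z)%E ->
  (\int[P]_w f (V s w - V 0 w, V (s + h) w - V s w)%R =
   \int[P]_w \int[inc_law 1 h]_y f (V s w - V 0 w, y)%R)%E.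
Proof.
move=> s0 h0 mf f0.
have mU : measurable_fun setT (fun w => V s w - V 0 w) by exact: measurable_funB.
have mY : measurable_fun setT (fun w => V (s + h) w - V s w) by exact: measurable_funB.
apply: (ge0_integral_indep mU mY _ mf f0) => A B mA mB.
have := @V_indep 2%N (fun i => if i is j.+1 then if j is 0%N then s else s + h else 0) _ _
  (fun i => if (i : nat) is 0%N then A else B).
have -> : \bigcap_i ((fun (i : 'I_2) w =>
     V (if i.+1 is j.+1 then if j is 0%N then s else s + h else 0) w -
     V (if (i : nat) is j.+1 then if j is 0%N then s else s + h else 0) w) i @^-1`
     (if (i : nat) is 0%N then A else B)) =
     (fun w => V s w - V 0 w) @^-1` A `&` (fun w => V (s + h) w - V s w) @^-1` B.
  apply/seteqP; split => [w ABw|w [Aw Bw] [[|[|]]]//].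
  by split; [exact: (ABw ord0)|exact: (ABw ord_max)].
move=> ->.
- rewrite !big_ord_recl big_ord0 mule1 /=; congr (_ * _)%E.
  have := inc_lawE 1 s0 h0 mB => <-.
  by congr (P _); apply/seteqP; split => w /=; rewrite mul1r.
- by case=> [|[|i]] //= _; rewrite in_itv/= ?lexx ?s0 ?addr_ge0.
- by case=> [|[|i]] //= _; rewrite lerDl.
- by case=> -[|[|i]].
Qed.

(** Extended real: finiteness is assumed at time 1 only and has to be derived for other [h]. *)
Definition inc_moment h : \bar R := (\int[inc_law 1 h]_y (y ^+ 2)%:E)%E.

Let msq : measurable_fun setT (fun y : R => (y ^+ 2)%:E).
Proof. by apply/measurable_EFinP; exact: exprn_measurable. Qed.

Let sq0 (y : R) : (0 <= (y ^+ 2)%:E)%E.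
Proof. by rewrite lee_fin sqr_ge0. Qed.

Lemma inc_momentE s h : 0 <= s -> 0 <= h ->
  (\int[P]_w ((V (s + h) w - V s w) ^+ 2)%:E)%E = inc_moment h.
Proof.
move=> s0 h0; rewrite /inc_moment -(ge0_integral_inc 1 s0 h0 msq sq0).
by under [RHS]eq_integral do rewrite mul1r.
Qed.

Lemma inc_moment1 : inc_moment 1 = (sigma ^+ 2)%:E.
Proof.
rewrite -(inc_momentE (lexx 0) ler01) add0r -V_var unlock.
apply: ae_eq_integral => //.
- by apply/measurable_EFinP; apply: measurable_funX; exact: measurable_funB.
- by apply/measurable_EFinP; exact: measurable_funX.
- by case: V_0 => N [mN N0 sN]; exists N; split => // w /= nw; apply: sN => /= w0;
    apply: nw => _; rewrite w0 subr0.
Qed.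

Lemma inc_law_mean h : 0 <= h -> (inc_law 1 h).-integrable setT (fun y => y%:E) /\
  (\int[inc_law 1 h]_y y%:E = 0)%E.
Proof.
move=> h0.
have [i1 e1] := V_centered h0; have [i0 e0] := V_centered (lexx 0).
have iV : P.-integrable setT (EFin \o (fun w => 1 * (V (0 + h) w - V 0 w))).
  rewrite (_ : _ \o _ = (fun w => (EFin \o V h) w - (EFin \o V 0) w)%E); last first.
    by apply/funext => w; rewrite /= mul1r add0r.
  exact: integrableB.
split.
  apply/integrableP; split; first exact/measurable_EFinP.
  rewrite (ge0_integral_law _ (measurable_inc 1 0 h) (g := fun y : R => `|y%:E|%E))//.
    by have /integrableP[] := iV.
  by apply: measurableT_comp => //; exact/measurable_EFinP.
rewrite /inc_law /law integral_distribution//=.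
transitivity (\int[P]_w ((EFin \o V h) w - (EFin \o V 0) w))%E.
  by apply: eq_integral => w _; rewrite /= mul1r add0r.
by rewrite integralB//; move: e1 e0; rewrite unlock => -> ->; rewrite sube0.
Qed.

(** Given the first increment u, the second one y is independent and centered: (u + y)^2 is at least
    u^2 + 2uy, whose integral in y is u^2. If the inner integral is infinite the bound is trivial,
    so no second moment of y is presupposed. *)
Lemma inc_moment_mono s h : 0 <= s -> 0 <= h -> (inc_moment s <= inc_moment (s + h))%E.
Proof.
move=> s0 h0; rewrite -(inc_momentE (lexx 0) s0) -(inc_momentE (lexx 0) (addr_ge0 s0 h0)).
rewrite !add0r.
have mf : measurable_fun setT (fun z : R * R => ((z.1 + z.2) ^+ 2)%:E).
  by apply/measurable_EFinP; apply: measurable_funX; exact: measurable_funD.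
have := two_increments s0 h0 mf (fun z => sq0 _).
under eq_integral do rewrite /= addrC subrKA.
move=> ->; apply: ge0_le_integral => //.
- by apply/measurable_EFinP; apply: measurable_funX; exact: measurable_funB.
- have mU : measurable_fun setT (fun w => V s w - V 0 w) by exact: measurable_funB.
  exact: (measurableT_comp (measurable_fun_fubini_tonelli_F _ mf (fun z => sq0 _)) mU).
move=> w _; set u : R := V s w - V 0 w.
have [im me] := inc_law_mean h0.
have [foo|] := ltP (\int[inc_law 1 h]_y ((u + y) ^+ 2)%:E)%E +oo%E; last first.
  by rewrite leye_eq => /eqP ->; rewrite leey.
have i1 : (inc_law 1 h).-integrable setT (fun y => ((u + y) ^+ 2)%:E).
  apply/integrableP; split.
    by apply/measurable_EFinP; apply: measurable_funX; exact: measurable_funD.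
  by under eq_integral do rewrite gee0_abs ?sq0//.
have i2 : (inc_law 1 h).-integrable setT (fun y : R => (2 * u)%:E * y%:E)%E.
  exact: (integrableZl measurableT _ im).
have i3 : (inc_law 1 h).-integrable setT (fun y : R => (u ^+ 2)%:E).
  exact: finite_measure_integrable_cst.
have -> : ((u ^+ 2)%:E = \int[inc_law 1 h]_y ((u ^+ 2)%:E + (2 * u)%:E * y%:E))%E.
  rewrite (integralD measurableT i3 i2) (integralZl measurableT im) me mule0 adde0.
  by rewrite integral_cst//= probability_setT mule1.
apply: le_integral => //; first exact: integrableD.
move=> y _; rewrite /= -EFinM -EFinD lee_fin.
have -> : (u + y) ^+ 2 = u ^+ 2 + 2 * u * y + y ^+ 2 by ring.
by rewrite lerDl sqr_ge0.
Qed.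

Lemma inc_moment_add1 s : 0 <= s -> inc_moment (s + 1) = (inc_moment s + (sigma ^+ 2)%:E)%E.
Proof.
move=> s0; rewrite -(inc_momentE (lexx 0) s0) -(inc_momentE (lexx 0) (addr_ge0 s0 ler01)).
rewrite !add0r.
have mf : measurable_fun setT (fun z : R * R => ((z.1 + z.2) ^+ 2)%:E).
  by apply/measurable_EFinP; apply: measurable_funX; exact: measurable_funD.
have := two_increments s0 ler01 mf (fun z => sq0 _).
under eq_integral do rewrite /= addrC subrKA.
move=> ->.
have [im me] := inc_law_mean ler01.
have isq : (inc_law 1 1).-integrable setT (fun y : R => (y ^+ 2)%:E).
  apply/integrableP; split => //.
  under eq_integral do rewrite gee0_abs ?sq0//.
  by rewrite -/(inc_moment 1) inc_moment1 ltry.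
have E u : (\int[inc_law 1 1]_y ((u + y) ^+ 2)%:E = (u ^+ 2)%:E + (sigma ^+ 2)%:E)%E.
  have i2 : (inc_law 1 1).-integrable setT (fun y : R => (2 * u)%:E * y%:E)%E.
    exact: (integrableZl measurableT _ im).
  have i3 : (inc_law 1 1).-integrable setT (fun y : R => (u ^+ 2)%:E).
    exact: finite_measure_integrable_cst.
  transitivity (\int[inc_law 1 1]_y ((u ^+ 2)%:E + (2 * u)%:E * y%:E + (y ^+ 2)%:E))%E.
    apply: eq_integral => y _; rewrite -EFinM -!EFinD; congr EFin.
    by rewrite sqrrD -mulr_natl mulrA.
  rewrite (integralD measurableT (integrableD measurableT i3 i2) isq).
  rewrite (integralD measurableT i3 i2) (integralZl measurableT im) me mule0 adde0.
  by rewrite integral_cst//= probability_setT mule1 -/(inc_moment 1) inc_moment1.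
under eq_integral do rewrite E.
rewrite ge0_integralD//=.
- by rewrite integral_cst//= probability_setT mule1.
- by apply/measurable_EFinP; apply: measurable_funX; exact: measurable_funB.
Qed.

Lemma inc_moment_nat n : inc_moment n%:R = (n%:R * sigma ^+ 2)%:E.
Proof.
elim: n => [|n IH]; last first.
  by rewrite -natr1 inc_moment_add1// IH -EFinD mulrDl mul1r.
rewrite mul0r -(inc_momentE (lexx 0) (lexx 0)) addr0.
by under eq_integral do rewrite subrr expr0n/=; rewrite integral0.
Qed.

(** [h] is rounded up to the next integer, where the moment is known exactly. *)
Lemma inc_moment_le h : 0 <= h -> (inc_moment h <= ((h + 1) * sigma ^+ 2)%:E)%E.
Proof.
move=> h0; have [n1 n2] := truncn_itv_nat h0.
have d0 : 0 <= (Num.truncn h).+1%:R - h by rewrite subr_ge0 ltW.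
have := inc_moment_mono h0 d0; rewrite subrKC inc_moment_nat => /le_trans; apply.
by rewrite lee_fin ler_wpM2r ?sqr_ge0// -natr1 lerD2r.
Qed.

Lemma inc_moment_le1 h : 0 <= h -> h <= 1 -> (inc_moment h <= (sigma ^+ 2)%:E)%E.
Proof.
move=> h0 h1; have d0 : 0 <= 1 - h by rewrite subr_ge0.
by have := inc_moment_mono h0 d0; rewrite subrKC inc_moment1.
Qed.

Lemma inc_law_scaled c h : 0 <= c -> 0 <= h -> scaled_law (inc_law c h) (inc_law 1 h) c.
Proof.
move=> c0 h0 G cG G0.
have mG := continuous_measurable_fun cG.
have mGc : measurable_fun setT (fun x => G (c * x)).
  by apply: measurableT_comp => //; apply: continuous_measurable_fun; exact: mulrl_continuous.
rewrite -(ge0_integral_inc c (lexx 0) h0 (f := fun y => (G y)%:E)); last 2 first.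
- exact/measurable_EFinP.
- by move=> y; rewrite lee_fin.
rewrite -(ge0_integral_inc 1 (lexx 0) h0 (f := fun y => (G (c * y))%:E)); last 2 first.
- exact/measurable_EFinP.
- by move=> y; rewrite lee_fin.
by apply: eq_integral => w _; rewrite mul1r.
Qed.

Lemma inc_law_centered : centered_law (inc_law 1 1) (sigma ^+ 2).
Proof.
have [im me] := inc_law_mean ler01.
split.
- apply/integrableP; split => //.
  under eq_integral do rewrite gee0_abs ?sq0//.
  by rewrite -/(inc_moment 1) inc_moment1 ltry.
- by rewrite /Rintegral me.
- by rewrite /Rintegral -/(inc_moment 1) inc_moment1.
Qed.

Lemma inc_chebyshev c s h b : 0 <= s -> 0 <= h -> 0 < b ->
  \int[P]_w (b < `|c * (V (s + h) w - V s w)|)%R%:R <=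
  c ^+ 2 * (h + 1) * sigma ^+ 2 / b ^+ 2.
Proof.
move=> s0 h0 b0.
pose Y w := c * (V (s + h) w - V s w).
have mY : measurable_fun setT Y := measurable_inc c s h.
have mI : measurable_fun setT (fun w => (b < `|Y w|)%R%:R : R).
  by apply: measurable_ind_gt; exact: measurableT_comp.
have b2 : 0 < b ^+ 2 by rewrite exprn_gt0.
rewrite -lee_fin fineK; last first.
  apply: integrable_fin_num => //; apply: (@bounded_integrable _ _ _ _ _ 1) => // w.
  by case: (_ < _); rewrite ?normr1 ?normr0.
apply: (@le_trans _ _ (\int[P]_w ((b ^+ 2)^-1 * Y w ^+ 2)%:E)%E).
  apply: ge0_le_integral => //.
  - exact/measurable_EFinP.
  - by apply/measurable_EFinP; apply: measurable_funM => //; exact: measurable_funX.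
  - move=> w _; rewrite lee_fin; have [bY|_] := ltP b `|Y w|; last first.
      by rewrite mulr_ge0 ?sqr_ge0// invr_ge0 ltW.
    rewrite mulrC ler_pdivlMr// mul1r -[leRHS]real_normK ?num_real//.
    by rewrite !expr2; apply: ler_pM; exact: ltW.
have -> : c ^+ 2 * (h + 1) * sigma ^+ 2 / b ^+ 2 =
   (b ^+ 2)^-1 * (c ^+ 2 * ((h + 1) * sigma ^+ 2)) by rewrite mulrC !mulrA.
rewrite ge0_integral_mulr//; last 3 first.
- exact: measurable_funX.
- by rewrite invr_ge0 ltW.
- by move=> w; exact: sqr_ge0.
rewrite EFinM lee_pmul2l ?lte_fin ?invr_gt0//.
under eq_integral do rewrite exprMn.
rewrite ge0_integral_mulr//; last 3 first.
- by apply: measurable_funX; exact: measurable_funB.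
- exact: sqr_ge0.
- by move=> w; exact: sqr_ge0.
rewrite inc_momentE// [leRHS]EFinM lee_wpmul2l ?lee_fin ?sqr_ge0//.
exact: inc_moment_le.
Qed.

End increments.

(** Replaces Cauchy-Schwarz: |x| is at most c + x^2/c for every real x, and [c] is chosen as the
    order of magnitude of the L2 distance. *)
Lemma Rintegral_lipschitz d (T : measurableType d) (R : realType) (P : probability T R)
    (f g : T -> R) (phi : R -> R) (L M K c : R) :
  measurable_fun setT f -> measurable_fun setT g -> measurable_fun setT phi ->
  (forall x y, `|phi x - phi y| <= L * `|x - y|) -> (forall x, `|phi x| <= M) ->
  0 < c -> (\int[P]_w ((f w - g w) ^+ 2)%:E <= (c ^+ 2 * K)%:E)%E ->
  `|\int[P]_w phi (f w) - \int[P]_w phi (g w)| <= L * (c * (1 + K)).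
Proof.
move=> mf mg mphi phiL phiM c0 fgK.
have L0 : 0 <= L by have := phiL 1 0; rewrite subr0 normr1 mulr1; apply: le_trans.
have msq : measurable_fun setT (fun w => (f w - g w) ^+ 2).
  by apply: measurable_funX; exact: measurable_funB.
have isq : P.-integrable setT (EFin \o (fun w => (f w - g w) ^+ 2)).
  apply/integrableP; split; first exact/measurable_EFinP.
  under eq_integral do rewrite /= ger0_norm ?sqr_ge0//.
  by rewrite (le_lt_trans fgK)// ltry.
have i1 : P.-integrable setT (EFin \o (phi \o f)).
  by apply: (bounded_integrable _ (measurableT_comp mphi mf)) => w; exact: phiM.
have i2 : P.-integrable setT (EFin \o (phi \o g)).
  by apply: (bounded_integrable _ (measurableT_comp mphi mg)) => w; exact: phiM.
rewrite -(RintegralB measurableT i1 i2).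
have i12 : P.-integrable setT (EFin \o (fun w => phi (f w) - phi (g w))).
  exact: (integrableB measurableT i1 i2).
rewrite (le_trans (le_normr_Rintegral measurableT i12))//.
have ic : P.-integrable setT (EFin \o (fun _ : T => c)).
  exact: finite_measure_integrable_cst.
have isqc : P.-integrable setT (EFin \o (fun w => c^-1 * (f w - g w) ^+ 2)).
  exact: (integrableZl measurableT c^-1 isq).
have icsq : P.-integrable setT (EFin \o (fun w => c + c^-1 * (f w - g w) ^+ 2)).
  exact: (integrableD measurableT ic isqc).
apply: (@le_trans _ _ (\int[P]_w (L * (c + c^-1 * (f w - g w) ^+ 2)))).
  apply: le_Rintegral => //.
  - exact: (integrable_norm i12).
  - exact: (integrableZl measurableT L icsq).
  move=> w _; rewrite (le_trans (phiL _ _))// ler_wpM2l//.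
  rewrite -(ler_pM2l c0) mulrDr mulrA divff ?lt0r_neq0// mul1r -[_ ^+ 2]real_normK ?num_real//.
  set y := `|_|; have y0 : 0 <= y by exact: normr_ge0.
  have [yc|/ltW cy] := leP y c.
    by rewrite (le_trans (ler_wpM2l (ltW c0) yc))// lerDl sqr_ge0.
  by rewrite (le_trans (ler_wpM2r y0 cy))// expr2 lerDr mulr_ge0// ltW.
rewrite (RintegralZl _ measurableT icsq) ler_wpM2l//.
rewrite (RintegralD measurableT ic isqc) Rintegral_cst1 (RintegralZl _ measurableT isq).
rewrite mulrDr mulr1 lerD2l mulrC ler_pdivrMr//.
rewrite -lee_fin fineK; last exact: integrable_fin_num.
by rewrite (le_trans fgK)// lee_fin expr2 mulrAC.
Qed.

Lemma lipschitz_measurable (R : realType) (phi : R -> R) (L : R) :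
  (forall x y, `|phi x - phi y| <= L * `|x - y|) -> measurable_fun setT phi.
Proof. by move=> phiL; exact: (continuous_measurable_fun (lipschitz_continuous phiL)). Qed.

Lemma sum_mkseq_telescope (R : realType) (c : R) (f : nat -> R) n :
  \sum_(y <- mkseq (fun i => c * (f i.+1 - f i)) n) y = c * (f n - f 0%N).
Proof.
rewrite /mkseq big_map -[n in iota 0 n]subn0 -/(index_iota 0 n).
by rewrite -big_distrr /= telescope_sumr.
Qed.

Lemma seq_measurable_sum (R : realType) (phi : R -> R) n : measurable_fun setT phi ->
  seq_measurable n (fun s => phi (\sum_(y <- s) y)).
Proof.
move=> mphi d1 T1 p Y mp mY; apply: measurableT_comp => //.
under eq_fun do rewrite /mkseq big_map.
exact: measurable_sum.
Qed.

Section central_limit.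
Context d (T : measurableType d) (R : realType) (P : probability T R).
Variables (V : R -> {RV P >-> R}) (sigma : R).
Hypotheses (V_indep : independent_increments P `[0, +oo[ V)
  (V_homog : homogeneous P V) (V_centered : centered P V)
  (V_0 : {ae P, forall w, V 0 w = 0}) (sigma_ge0 : 0 <= sigma)
  (V_var : ('E_P[(fun w => V 1 w ^+ 2)%R])%E = (sigma ^+ 2)%:E).
Context d' (T' : measurableType d') (P' : probability T' R).
Variables (W : R -> {RV P' >-> R}) (W_Wiener : standard_Wiener P' `[0, 1] W).

Lemma measurable_mul (c : R) : measurable_fun setT ( *%R c : R -> R).
Proof. by apply: continuous_measurable_fun; exact: mulrl_continuous. Qed.

(** An image law, so that [sigma = 0] is covered too and yields the Dirac mass at 0; only [s] has to
    be positive for scaling. *)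
Definition limit_law s : probability R R := law (gauss s) (measurable_mul sigma).

Lemma ge0_integral_limit_law s (G : R -> R) : continuous G -> (forall x, 0 <= G x) ->
  (\int[limit_law s]_y (G y)%:E = \int[gauss s]_y (G (sigma * y))%:E)%E.
Proof.
move=> cG G0; rewrite ge0_integral_law//.
by apply/measurable_EFinP; exact: continuous_measurable_fun.
Qed.

Lemma limit_law_scaled s : 0 < s -> scaled_law (limit_law s) (limit_law 1) s.
Proof.
move=> s0 G cG G0.
have cGs (a : R) : continuous (fun y => G (a * y)).
  by move=> x; apply: (cvg_comp ( *%R a) G); [exact: mulrl_continuous|exact: cG].
rewrite (ge0_integral_limit_law s cG G0).
rewrite (ge0_integral_limit_law 1 (cGs s) (fun x => G0 _)).
rewrite (gauss_scaled s0 (cGs sigma) (fun x => G0 _)).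
by apply: eq_integral => y _; rewrite mulrCA.
Qed.

Lemma limit_law_centered : centered_law (limit_law 1) (sigma ^+ 2).
Proof.
have sc : scaled_law (limit_law 1) (gauss 1) sigma.
  by move=> G cG G0; exact: ge0_integral_limit_law.
have [] := scaled_centered sigma_ge0 sc (gauss_centered R).
by rewrite mulr1.
Qed.

Lemma Wiener_incE s t B : 0 <= s -> s < t -> t <= 1 -> measurable B ->
  P' [set w | B (sigma * (W t w - W s w))] = limit_law (Num.sqrt (t - s)) B.
Proof.
move=> s0 st t1 mB; have [_ _ WN _] := W_Wiener.
have := WN s t _ _ st [set y | B (sigma * y)].
rewrite /= !in_itv/= s0 t1 (le_trans s0 (ltW st)) (le_trans (ltW st) t1) => -> //.
rewrite -[X in measurable X]setTI; exact: measurable_mul.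
Qed.

Lemma measurable_Winc s t : measurable_fun setT (fun w => sigma * (W t w - W s w)).
Proof. by apply: measurable_funM => //; exact: measurable_funB. Qed.

Lemma Rintegral_Winc s t (f : R -> R) (M : R) : 0 <= s -> s < t -> t <= 1 ->
  measurable_fun setT f -> (forall y, `|f y| <= M) ->
  \int[P']_w f (sigma * (W t w - W s w)) = \int[limit_law (Num.sqrt (t - s))]_y f y.
Proof.
move=> s0 st t1 mf fM; rewrite -(Rintegral_law _ (measurable_Winc s t) mf fM).
by rewrite /Rintegral; congr fine; apply: eq_measure_integral => A mA _; exact: Wiener_incE.
Qed.

Lemma Wiener_inc_moment s t : 0 <= s -> s <= t -> t <= 1 ->
  (\int[P']_w ((sigma * (W t w - W s w)) ^+ 2)%:E = (sigma ^+ 2 * (t - s))%:E)%E.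
Proof.
move=> s0; rewrite le_eqVlt => /predU1P[<- _|st t1].
  rewrite subrr mulr0.
  by under eq_integral do rewrite subrr mulr0 expr0n/=; rewrite integral0.
have ts0 : 0 < Num.sqrt (t - s) by rewrite sqrtr_gt0 subr_gt0.
have [[isq _ mom] _] := scaled_centered (ltW ts0) (limit_law_scaled ts0) limit_law_centered.
transitivity (\int[limit_law (Num.sqrt (t - s))]_y (y ^+ 2)%:E)%E.
  have msq : measurable_fun setT (fun y : R => (y ^+ 2)%:E).
    by apply/measurable_EFinP; exact: exprn_measurable.
  have sq0 (y : R) : (0 <= (y ^+ 2)%:E)%E by rewrite lee_fin sqr_ge0.
  rewrite -(ge0_integral_law _ (measurable_Winc s t) msq sq0).
  by apply: eq_measure_integral => A mA _; exact: Wiener_incE.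
rewrite -[LHS]fineK; last exact: integrable_fin_num.
move: mom; rewrite /Rintegral => ->.
by rewrite sqr_sqrtr ?subr_ge0 1?ltW// mulrC.
Qed.

Lemma Winc_iter_int h n H (M : R) : 0 < h -> n%:R * h <= 1 -> seq_measurable n H ->
  (forall u, size u = n -> `|H u| <= M) ->
  \int[P']_w H (mkseq (fun i => sigma * (W (i.+1%:R * h) w - W (i%:R * h) w)) n) =
  iter_int (limit_law (Num.sqrt h)) n H.
Proof.
move=> h0 nh1 mH HM; have [_ W_indep _ _] := W_Wiener.
have ih i : (i <= n)%N -> 0 <= i%:R * h /\ i%:R * h <= 1.
  move=> iN; split; first by rewrite mulr_ge0// ltW.
  by rewrite (le_trans _ nh1)// ler_wpM2r ?(ltW h0)// ler_nat.
rewrite -(increments_iter_int (P := P') (I := `[0, 1]%classic) (V := W) (c := sigma) (s := 0) _ W_indep (ltW h0) _ _ mH HM)//.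
- by apply: eq_Rintegral => w _; congr H; apply: eq_mkseq => i; rewrite !add0r.
- by move=> i iN; rewrite /= in_itv/= add0r; apply/andP; exact: ih.
- move=> i B iN mB; have [i0 _] := ih _ (ltnW iN); have [_ i1] := ih _ iN.
  have st : i%:R * h < i.+1%:R * h by rewrite ltr_pM2r// ltr_nat.
  rewrite !add0r (Wiener_incE i0 st i1 mB).
  by rewrite -mulrBl -natr1 addrAC subrr add0r mul1r.
Qed.

(** The threshold [t0] precedes [phi]: later [phi] is a functional of a step path in which all the
    other increments are frozen at arbitrary values. *)
Lemma clt_bounded_lipschitz (m : nat) (M L e : R) : (0 < m)%N -> 0 < e ->
  exists2 t0 : R, 0 < t0 & forall t : R, t0 <= t -> forall phi : R -> R,
    (forall x y, `|phi x - phi y| <= L * `|x - y|) -> (forall x, `|phi x| <= M) ->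
    `|\int[inc_law V (Num.sqrt t)^-1 (t / m%:R)]_y phi y -
      \int[limit_law (Num.sqrt m%:R^-1)]_y phi y| <= e.
Proof.
move=> m0 e0.
have m0' : 0 < (m%:R : R) by rewrite ltr0n.
pose L' := `|L| + 1; have L'0 : 0 < L' by rewrite ltr_wpDl.
have LL' : L <= L' by rewrite (le_trans (ler_norm L))// lerDl.
(* Makes the smoothing error [10 * L' * eps] equal to [e / 8]. *)
pose eps := e / (80 * L').
have eps0 : 0 < eps by rewrite divr_gt0// mulr_gt0.
pose M' := `|M| + 10 * L' * eps.
pose C := 4 * (2 * `|M| + L') / eps ^+ 2.
have C0 : 0 <= C by rewrite divr_ge0 ?sqr_ge0// mulr_ge0// addr_ge0 ?mulr_ge0// ltW.
have cV := inc_law_centered V_homog V_centered V_0 V_var.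
have cW := limit_law_centered.
have e8 : 0 < e / (8 * (C + 1)) by rewrite divr_gt0// mulr_gt0// ltr_wpDl.
have [c1 c10 Hc1] := let: And3 i _ _ := cV in trunc_moment_cvg0 i e8.
have [c2 c20 Hc2] := let: And3 i _ _ := cW in trunc_moment_cvg0 i e8.
pose c3 := e / (8 * (L' * (1 + sigma ^+ 2))).
have s1 : 0 < 1 + sigma ^+ 2 by rewrite ltr_pwDl// sqr_ge0.
have c30 : 0 < c3 by rewrite divr_gt0// mulr_gt0// mulr_gt0.
(* The scale 1/sqrt t has to be below [c1] and [c2] for the truncated moments of the two laws, and
   below [c3] for the errors of rounding time. *)
pose c0 := Num.min c1 (Num.min c2 c3).
have c00 : 0 < c0 by rewrite !lt_min c10 c20.
exists (c0 ^- 2) => [|t tc phi phiL0 phiM0]; first by rewrite invr_gt0 exprn_gt0.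
have t0 : 0 < t by rewrite (lt_le_trans _ tc)// invr_gt0 exprn_gt0.
pose c := (Num.sqrt t)^-1.
have st0 : 0 < Num.sqrt t by rewrite sqrtr_gt0.
have cp : 0 < c by rewrite invr_gt0.
have c2E : c ^+ 2 = t^-1 by rewrite exprVn sqr_sqrtr// ltW.
have cc0 : c <= c0.
  by rewrite -ler_sqr ?nnegrE ?(ltW cp) ?(ltW c00)// c2E -[leRHS]invrK lef_pV2 ?posrE ?invr_gt0 ?exprn_gt0.
have phiL x y : `|phi x - phi y| <= L' * `|x - y|.
  by rewrite (le_trans (phiL0 x y))// ler_wpM2r.
have phiM x : `|phi x| <= `|M| by rewrite (le_trans (phiM0 x))// ler_norm.
have [psi [psi1 [psi2 [cpsi psiphi psiT]]]] := smooth_approximation eps0 phiL phiM.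
have psiM x : `|psi x| <= M'.
  by rewrite -[psi x](subrK (phi x)) (le_trans (ler_normD _ _))// addrC lerD.
have mphi := lipschitz_measurable phiL.
have mpsi := continuous_measurable_fun cpsi.
(* V(t / m) is compared with V(n), a sum of n i.i.d. increments, and W(1 / m)
   with W(n / t), so that both have n increments of the same variance. *)
pose n := Num.truncn (t / m%:R).
have tm0 : 0 <= t / m%:R by rewrite ltW// divr_gt0.
have [n1 n2] := truncn_itv_nat tm0; rewrite -/n in n1 n2.
have nt : n%:R <= t.
  by rewrite (le_trans n1)// ler_pdivrMr// ler_peMr ?(ltW t0)// ler1n.
pose X1 w := c * (V (t / m%:R) w - V 0 w).
pose X2 w := c * (V n%:R w - V 0 w).
pose Y1 w := sigma * (W m%:R^-1 w - W 0 w).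
pose Y2 w := sigma * (W (n%:R / t) w - W 0 w).
have mX1 : measurable_fun setT X1 by apply: measurable_funM => //; exact: measurable_funB.
have mX2 : measurable_fun setT X2 by apply: measurable_funM => //; exact: measurable_funB.
have mY1 : measurable_fun setT Y1 by exact: measurable_Winc.
have mY2 : measurable_fun setT Y2 by exact: measurable_Winc.
have E1 : \int[inc_law V c (t / m%:R)]_y phi y = \int[P]_w phi (X1 w).
  rewrite -(Rintegral_inc V_homog c (lexx 0) tm0 mphi phiM).
  by apply: eq_Rintegral => w _; rewrite add0r.
have E2 : \int[limit_law (Num.sqrt m%:R^-1)]_y phi y = \int[P']_w phi (Y1 w).
  rewrite (@Rintegral_Winc 0 m%:R^-1 phi `|M|) ?subr0 ?invr_gt0//.
  by rewrite invf_le1// ler1n.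
have small : L' * (c * (1 + sigma ^+ 2)) <= e / 8.
  have cc3 : c <= c3 by rewrite (le_trans cc0)// !ge_min lexx !orbT.
  rewrite mulrA mulrAC (le_trans (ler_wpM2l _ cc3))//; first by rewrite ltW// mulr_gt0.
  by rewrite /c3 le_eqVlt; apply/orP; left; apply/eqP; field; rewrite !lt0r_neq0.
have D1 : `|\int[P]_w phi (X1 w) - \int[P]_w phi (X2 w)| <= e / 8.
  apply: le_trans small; apply: (Rintegral_lipschitz mX1 mX2 mphi phiL phiM cp).
  have d0 : 0 <= t / m%:R - n%:R by rewrite subr_ge0.
  have d1 : t / m%:R - n%:R <= 1 by rewrite lerBlDl -natr1 in n2 *; exact: ltW.
  under eq_integral.
    move=> w _.
    have -> : (X1 w - X2 w) ^+ 2 = c ^+ 2 * (V (n%:R + (t / m%:R - n%:R)) w - V n%:R w) ^+ 2.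
      by rewrite subrKC /X1 /X2 -mulrBr opprB addrA subrK exprMn.
    over.
  rewrite ge0_integral_mulr//; last 3 first.
  - by apply: measurable_funX; exact: measurable_funB.
  - exact: sqr_ge0.
  - by move=> w; exact: sqr_ge0.
  rewrite (inc_momentE V_homog)// [leRHS]EFinM lee_wpmul2l ?lee_fin ?sqr_ge0//.
  exact: (inc_moment_le1 V_indep V_homog V_centered V_0 V_var).
have nt0 : 0 <= n%:R / t by rewrite divr_ge0// ltW.
have ntm : n%:R / t <= m%:R^-1 by rewrite ler_pdivrMr// mulrC.
have m1 : (m%:R^-1 : R) <= 1 by rewrite invf_le1// ler1n.
have D2 : `|\int[P']_w phi (Y1 w) - \int[P']_w phi (Y2 w)| <= e / 8.
  apply: le_trans small; apply: (Rintegral_lipschitz mY1 mY2 mphi phiL phiM cp).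
  have -> : (\int[P']_w ((Y1 w - Y2 w) ^+ 2)%:E)%E =
      (sigma ^+ 2 * (m%:R^-1 - n%:R / t))%:E.
    rewrite -Wiener_inc_moment//; apply: eq_integral => w _; congr (_ ^+ 2)%:E.
    by rewrite /Y1 /Y2 -mulrBr opprB addrA subrK.
  rewrite lee_fin mulrC ler_wpM2r ?sqr_ge0// c2E lerBlDr -[X in X + _]mul1r -mulrDl.
  by rewrite ler_pdivlMr// mulrC addrC natr1 ltW.
have D3 d0 (T0 : measurableType d0) (P0 : probability T0 R) (f : T0 -> R) :
    measurable_fun setT f ->
    `|\int[P0]_w phi (f w) - \int[P0]_w psi (f w)| <= e / 8.
  move=> mf; have -> : e / 8 = 10 * L' * eps by rewrite /eps; field; rewrite lt0r_neq0.
  apply: (@Rintegral_dist_le _ _ _ _ _ _ (`|M| + M')).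
  - exact: measurableT_comp.
  - exact: measurableT_comp.
  - move=> w; rewrite (le_trans (phiM _))// lerDl addr_ge0// mulr_ge0 ?(ltW eps0)//.
    by rewrite mulr_ge0 ?(ltW L'0).
  - by move=> w; rewrite (le_trans (psiM _))// lerDr.
  - by move=> w; rewrite distrC.
pose H s := psi (\sum_(y <- s) y).
have mH := seq_measurable_sum n mpsi; rewrite -/H in mH.
have HM s : size s = n -> `|H s| <= M' by move=> _; exact: psiM.
have E3 : \int[P]_w psi (X2 w) = iter_int (inc_law V c 1) n H.
  rewrite -(inc_iter_int V_indep V_homog c (lexx 0) ler01 mH HM).
  apply: eq_Rintegral => w _; rewrite /H (sum_mkseq_telescope c (fun i => V (0 + i%:R * 1) w)).
  by rewrite mul0r !add0r mulr1.
have E4 : \int[P']_w psi (Y2 w) = iter_int (limit_law c) n H.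
  have -> : c = Num.sqrt t^-1 by rewrite sqrtrV ?(ltW t0).
  rewrite -(Winc_iter_int (h := t^-1) _ _ mH HM) ?invr_gt0//.
    apply: eq_Rintegral => w _; rewrite /H (sum_mkseq_telescope sigma (fun i => W (i%:R / t) w)).
    by rewrite mul0r.
  exact: le_trans m1.
have D4 : `|\int[P]_w psi (X2 w) - \int[P']_w psi (Y2 w)| <= e / 4.
  rewrite E3 E4.
  have cc1 : c <= c1 by rewrite (le_trans cc0)// !ge_min lexx.
  have cc2 : c <= c2 by rewrite (le_trans cc0)// !ge_min lexx !orbT.
  (* There are [n] replacements, each costing [c ^+ 2] = 1/t times a small constant, and [n%:R / t]
     is at most 1. *)
  apply: (@le_trans _ _ (n%:R * (C * c ^+ 2 * (e / (8 * (C + 1)) + e / (8 * (C + 1)))))).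
    apply: (iter_int_swap mH HM) => p s _.
    have Hps y : H (p ++ y :: s) = psi (\sum_(z <- p ++ s) z + y).
      by rewrite /H !big_cat/= big_cons addrCA addrC.
    have Hint (la : probability R R) : \int[la]_y H (p ++ y :: s) =
        \int[la]_y psi (\sum_(z <- p ++ s) z + y).
      by apply: eq_Rintegral => y _; rewrite Hps.
    rewrite !Hint.
    have := taylor_swap (\sum_(z <- p ++ s) z) (ltW cp)
      (inc_law_scaled V_homog (ltW cp) ler01) (limit_law_scaled cp) cV cW cpsi psiM psiT.
    move=> /le_trans; apply; apply: ler_wpM2l; first exact: mulr_ge0 C0 (sqr_ge0 c).
    by apply: lerD; [apply: Hc1|apply: Hc2] => //; exact: ltW.
  have -> : n%:R * (C * c ^+ 2 * (e / (8 * (C + 1)) + e / (8 * (C + 1)))) =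
      (n%:R / t) * (C / (C + 1)) * (e / 4).
    by rewrite c2E; field; rewrite !lt0r_neq0// ltr_wpDl.
  apply: ler_piMl; first by rewrite divr_ge0// ltW.
  apply: mulr_ile1 => //; [by rewrite divr_ge0// addr_ge0|exact: le_trans m1|].
  by rewrite ler_pdivrMr ?mul1r ?lerDl// ltr_wpDl.
(* Two rounding errors and two smoothing errors of [e / 8], and [e / 4] for the replacement: less
   than [e] in all. *)
rewrite E1 E2.
have := D3 _ _ P X2 mX2; have := D3 _ _ P' Y2 mY2.
move: D1 D2 D4 => /ler_normlP[? ?] /ler_normlP[? ?] /ler_normlP[? ?].
move=> /ler_normlP[? ?] /ler_normlP[? ?].
apply/ler_normlP; split; lra.
Qed.

End central_limit.

Definition clip (R : realType) (x : R) : R := Num.min 1 (Num.max 0 x).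

Section clip.
Variable R : realType.
Implicit Types x y : R.

Lemma clip_ge0 x : 0 <= clip x.
Proof. by rewrite /clip le_min ler01 le_max lexx. Qed.

Lemma clip_le1 x : clip x <= 1.
Proof. by rewrite /clip ge_min lexx. Qed.

Lemma clip_eq1 x : 1 <= x -> clip x = 1.
Proof. by move=> x1; apply/eqP; rewrite eq_le clip_le1 /clip le_min lexx le_max x1 orbT. Qed.

Lemma clip_eq0 x : x <= 0 -> clip x = 0.
Proof. by move=> x0; apply/eqP; rewrite eq_le clip_ge0 andbT /clip ge_min ge_max lexx x0 orbT. Qed.

Lemma clip_lipschitz x y : `|clip x - clip y| <= `|x - y|.
Proof.
wlog xy : x y / x <= y => [wl|].
  by case: (leP x y) => [/wl//|/ltW/wl]; rewrite distrC (distrC y).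
have cxy : clip x <= clip y.
  by rewrite /clip le_min !ge_min lexx/= ge_max !le_max lexx xy !orbT.
rewrite distrC (distrC x) !ger0_norm ?subr_ge0//.
have max_xy : Num.max 0 x <= Num.max 0 y by rewrite ge_max !le_max lexx xy !orbT.
apply: (@le_trans _ _ (Num.max 0 y - Num.max 0 x)).
  by rewrite /clip; case: (leP 1 (Num.max 0 y)) => ?; case: (leP 1 (Num.max 0 x)) => ?; lra.
by case: (leP 0 x) => ?; case: (leP 0 y) => ?; lra.
Qed.

End clip.

(** * Maximal inequality *)

Section ottaviani.
Variable R : realType.
Implicit Types (c x a b p : R) (s : seq R) (mu : probability R R).

(** The starting point is an argument because the maximal inequality restarts the walk after its
    first step. *)
Fixpoint walk_exceeds c x s : bool :=
  if s is y :: s' then (c < `|x|) || walk_exceeds c (x + y) s' else c < `|x|.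

Lemma walk_exceeds_take c x s j : (j <= size s)%N ->
  c < `|x + \sum_(y <- take j s) y| -> walk_exceeds c x s.
Proof.
elim: s x j => [|y s IH] x [|j] //=; rewrite ?big_nil ?addr0 //; first by move=> _ ->.
by rewrite ltnS big_cons addrA => js /(IH _ _ js) ->; rewrite orbT.
Qed.

Lemma param_measurable_walk c n :
  param_measurable n (fun (x : R) s => (walk_exceeds c x s)%:R : R).
Proof.
elim: n => [|n IH] d1 T1 q Y mq mY.
  by apply: measurable_ind_gt; exact: measurableT_comp.
have -> : (fun w => (walk_exceeds c (q w) (mkseq (Y ^~ w) n.+1))%:R : R) =
  (fun w => 1 - (1 - (c < `|q w|)%R%:R) *
    (1 - (walk_exceeds c (q w + Y 0%N w) (mkseq (fun i => Y i.+1 w) n))%:R)).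
  apply/funext => w; rewrite mkseq_cons /=.
  case: (c < `|q w|); case: walk_exceeds => /=;
    by rewrite ?(subrr, subr0, mul0r, mul1r, mulr0, mulr1).
apply: measurable_funB => //; apply: measurable_funM; apply: measurable_funB => //.
  by apply: measurable_ind_gt; exact: measurableT_comp.
by apply: (IH _ _ (fun w => q w + Y 0%N w) (fun i => Y i.+1)) => //; exact: measurable_funD.
Qed.

Lemma seq_measurable_walk c x n : seq_measurable n (fun s => (walk_exceeds c x s)%:R : R).
Proof. by move=> d1 T1 q Y mq mY; exact: (@param_measurable_walk c n _ _ (cst x)). Qed.

Lemma seq_measurable_gt_sum a x n :
  seq_measurable n (fun s => (a < `|x + \sum_(y <- s) y|)%R%:R : R).
Proof.
apply: (@seq_measurable_sum _ (fun y => (a < `|x + y|)%R%:R)).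
by apply: measurable_ind_gt; apply: measurableT_comp => //; exact: measurable_funD.
Qed.

Lemma norm_bool_le1 (b : bool) : `|b%:R : R| <= 1.
Proof. by case: b; rewrite ?normr1 ?normr0. Qed.

Lemma iter_int_onem mu n H M : seq_measurable n H ->
  (forall s, size s = n -> `|H s| <= M) ->
  iter_int mu n (fun s => 1 - H s) = 1 - iter_int mu n H.
Proof.
elim: n H => [//|n IH] H mH HM /=.
have iH := integrable_iter_int_cons mu mH HM.
have i1 : mu.-integrable setT (EFin \o (fun=> 1)) by exact: finite_measure_integrable_cst.
rewrite -[in RHS](Rintegral_cst1 mu 1) -(RintegralB measurableT i1 iH).
apply: eq_Rintegral => y _; apply: IH; first exact: seq_measurable_behead.
by move=> s sn; apply: HM; rewrite /= sn.
Qed.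

(** From a position beyond [a + b], the remaining steps move the walk by at most [b] with
    probability at least [1 - p], so it ends beyond [a]; this is [small]. Induction on the first
    step stands in for the stopping time: either the start is already beyond [a + b], or the walk is
    restarted. The number of remaining steps is arbitrary, hence a hypothesis for every [j]. *)
Lemma ottaviani mu n a b p x : 0 <= b -> 0 <= p <= 1 ->
  (forall j, (j <= n)%N ->
    iter_int mu j (fun s => (b < `|0 + \sum_(y <- s) y|)%R%:R) <= p) ->
  (1 - p) * iter_int mu n (fun s => (walk_exceeds (a + b) x s)%:R) <=
  iter_int mu n (fun s => (a < `|x + \sum_(y <- s) y|)%R%:R).
Proof.
move=> b0 /andP[p0 p1]; have q0 : 0 <= 1 - p by rewrite subr_ge0.
have small m y : iter_int mu m (fun s => (b < `|0 + \sum_(z <- s) z|)%R%:R) <= p ->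
    a + b < `|y| ->
    (1 - p) * 1 <= iter_int mu m (fun s => (a < `|y + \sum_(z <- s) z|)%R%:R).
  move=> Hp aby; rewrite mulr1.
  apply: (@le_trans _ _ (iter_int mu m
      (fun s => 1 - (b < `|0 + \sum_(z <- s) z|)%R%:R))).
    rewrite (@iter_int_onem _ _ _ 1); [by rewrite lerB|exact: seq_measurable_gt_sum|].
    by move=> s _; exact: norm_bool_le1.
  apply: (@le_iter_int _ _ _ _ _ 1).
  - move=> d1 T1 q Y mq mY; apply: measurable_funB => //.
    exact: (@seq_measurable_gt_sum b 0 m _ _ q Y).
  - exact: seq_measurable_gt_sum.
  - by move=> s _; case: (_ < _); rewrite ?subrr ?subr0 ?normr0 ?normr1.
  - by move=> s _; exact: norm_bool_le1.
  - move=> s _; rewrite add0r; case: (ltP b) => [_|bs]; first by rewrite subrr ler0n.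
    rewrite subr0; case: (ltP a) => // ay; move: aby; rewrite ltNge => /negP[].
    rewrite -[y](addrK (\sum_(z <- s) z)) (le_trans (ler_normB _ _))//.
    by rewrite lerD.
elim: n x => [|n IH] x Hp.
  have [abx|abx] := ltP (a + b) `|x|.
    have := small 0%N x (Hp 0%N (leqnn _)) abx.
    by rewrite /= abx.
  by rewrite /= ltNge abx /= mulr0 ler0n.
have [abx|xab] := ltP (a + b) `|x|.
  rewrite (le_trans _ (small _ _ (Hp _ (leqnn _)) abx))// ler_wpM2l//.
  rewrite (le_trans (ler_norm _))// iter_int_bounded//; first exact: seq_measurable_walk.
  by move=> s _; exact: norm_bool_le1.
have pw : param_measurable n (fun (y : R) s => (walk_exceeds (a + b) (x + y) s)%:R : R).
  move=> d1 T1 q Y mq mY; apply: (@param_measurable_walk _ n _ _ (fun w => x + q w)) => //.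
  exact: measurable_funD.
have [mw bw] := param_iter_int mu pw (fun y s _ => norm_bool_le1 _).
have iw := bounded_integrable mu mw bw.
have mH := @seq_measurable_gt_sum a x n.+1.
have iS := integrable_iter_int_cons mu mH (fun s _ => norm_bool_le1 _).
have -> : iter_int mu n.+1 (fun s => (walk_exceeds (a + b) x s)%:R) =
    \int[mu]_y iter_int mu n (fun s => (walk_exceeds (a + b) (x + y) s)%:R).
  by apply: eq_Rintegral => y _; apply: eq_iter_int => s _; rewrite /= ltNge xab.
rewrite -(RintegralZl _ measurableT iw) /=.
apply: le_Rintegral => //; first exact: (integrableZl measurableT _ iw).
move=> y _; rewrite (le_trans (IH _ _))//; first by move=> j jn; exact: Hp (leqW jn).
by rewrite le_eqVlt; apply/orP; left; apply/eqP; apply: eq_iter_int => s _; rewrite big_cons addrA.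
Qed.

End ottaviani.

Section tail_bound.
Context d (T : measurableType d) (R : realType) (P : probability T R).
Variables (V : R -> {RV P >-> R}) (sigma : R).
Hypotheses (V_indep : independent_increments P `[0, +oo[ V)
  (V_homog : homogeneous P V) (V_centered : centered P V)
  (V_0 : {ae P, forall w, V 0 w = 0}) (sigma_ge0 : 0 <= sigma)
  (V_var : ('E_P[(fun w => V 1 w ^+ 2)%R])%E = (sigma ^+ 2)%:E).

Definition block c s h (K : nat) w : seq R :=
  mkseq (fun i => c * (V (s + i.+1%:R * h) w - V (s + i%:R * h) w)) K.

Lemma block_exceeds a c s h K j w : (j <= K)%N ->
  a < `|c * (V (s + j%:R * h) w - V s w)| -> walk_exceeds a 0 (block c s h K w).
Proof.
move=> jK; have -> : c * (V (s + j%:R * h) w - V s w) =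
    0 + \sum_(y <- take j (block c s h K w)) y.
  rewrite add0r /block /mkseq -map_take take_iota (minn_idPl jK).
  by rewrite (sum_mkseq_telescope c (fun i => V (s + i%:R * h) w)) mul0r addr0.
by apply: walk_exceeds_take; rewrite size_mkseq.
Qed.

(** Ottaviani's inequality with equal thresholds and p = 1/2, whence the factor 2. Chebyshev's bound
    for the whole block, assumed at most 1/2, dominates those for its initial segments. *)
Lemma block_tail a c s h K : 0 < a -> 0 <= s -> 0 <= h ->
  c ^+ 2 * (K%:R * h + 1) * sigma ^+ 2 / a ^+ 2 <= 2^-1 ->
  \int[P]_w (walk_exceeds (a + a) 0 (block c s h K w))%:R <=
  2 * \int[P]_w (a < `|c * (V (0 + K%:R * h) w - V 0 w)|)%R%:R.
Proof.
move=> a0 s0 h0 small.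
have bd H : forall u : seq R, size u = K -> `|(H u : bool)%:R : R| <= 1.
  by move=> u _; exact: norm_bool_le1.
rewrite (inc_iter_int V_indep V_homog c s0 h0 (seq_measurable_walk _ _ K)
  (bd (fun u => walk_exceeds (a + a) 0 u))).
have iE j : iter_int (inc_law V c h) j (fun s => (a < `|0 + \sum_(y <- s) y|)%R%:R) =
    \int[P]_w (a < `|c * (V (0 + j%:R * h) w - V 0 w)|)%R%:R.
  rewrite -(inc_iter_int V_indep V_homog c (lexx 0) h0 (seq_measurable_gt_sum a 0 j)
     (fun s _ => norm_bool_le1 R _)).
  apply: eq_Rintegral => w _.
  by rewrite (sum_mkseq_telescope c (fun i => V (0 + i%:R * h) w)) mul0r !addr0 !add0r.
rewrite -iE; have h2 : 0 <= (2^-1 : R) <= 1 by rewrite invr_ge0 ler0n invf_le1 ?ler1n.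
have := @ottaviani _ (inc_law V c h) K a a 2^-1 0 (ltW a0) h2.
have -> : 1 - 2^-1 = 2^-1 :> R by field.
rewrite ler_pdivrMl//; apply => j jK.
have jh : 0 <= j%:R * h by rewrite mulr_ge0.
rewrite iE (le_trans (inc_chebyshev V_indep V_homog V_centered V_0 V_var c (lexx 0) jh a0))//.
rewrite (le_trans _ small)// ler_wpM2r ?invr_ge0 ?sqr_ge0// ler_wpM2r ?sqr_ge0//.
by rewrite ler_wpM2l ?sqr_ge0// lerD2r ler_wpM2r// ler_nat.
Qed.

Context d' (T' : measurableType d') (P' : probability T' R).
Variables (W : R -> {RV P' >-> R}) (W_Wiener : standard_Wiener P' `[0, 1] W).

(** The clipped function is a Lipschitz majorant of the indicator of |y| > a that vanishes for |y|
    <= a/2; elsewhere it is at most 1, hence at most (2|y|/a)^2, and there the truncation weight is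
    1. Scaling by 1/sqrt m produces the factor 1/m that cancels [m]. *)
Lemma limit_law_tail a (m : nat) : 0 < a -> (0 < m)%N ->
  m%:R * \int[limit_law sigma (Num.sqrt m%:R^-1)]_y clip (2 / a * `|y| - 1) <=
  4 / a ^+ 2 * trunc_moment (limit_law sigma 1) (2 / a * Num.sqrt m%:R^-1).
Proof.
move=> a0 m0; have m0' : 0 < (m%:R : R) by rewrite ltr0n.
have s0 : 0 < Num.sqrt (m%:R^-1 : R) by rewrite sqrtr_gt0 invr_gt0.
have k0 : 0 <= 2 / a by rewrite divr_ge0// ltW.
have a2 : 0 <= 4 / a ^+ 2 by rewrite divr_ge0// sqr_ge0.
have [[isq _ _] tE] := scaled_centered (ltW s0) (limit_law_scaled sigma s0)
  (limit_law_centered sigma_ge0).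
have -> : 4 / a ^+ 2 * trunc_moment (limit_law sigma 1) (2 / a * Num.sqrt m%:R^-1) =
   m%:R * (4 / a ^+ 2 * trunc_moment (limit_law sigma (Num.sqrt m%:R^-1)) (2 / a)).
  rewrite tE// sqr_sqrtr ?invr_ge0 ?ler0n// mulrCA; congr (_ * _).
  by rewrite mulVKf// lt0r_neq0.
rewrite ler_pM2l//.
have it := integrable_trunc k0 isq.
rewrite -(RintegralZl _ measurableT it); apply: le_Rintegral => //.
- apply: (@bounded_integrable _ _ _ _ _ 1).
    have cl : forall x y : R, `|clip x - clip y| <= 1 * `|x - y|.
      by move=> x y; rewrite mul1r clip_lipschitz.
    apply: (measurableT_comp (lipschitz_measurable cl)).
    by apply: measurable_funB => //; apply: measurable_funM => //; exact: measurableT_comp.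
  by move=> y; rewrite ger0_norm ?clip_ge0 ?clip_le1.
- exact: (integrableZl measurableT _ it).
move=> y _; have [ya|ya] := leP `|y| (a / 2).
  rewrite clip_eq0; first exact: mulr_ge0 a2 (trunc_ge0 _ k0).
  by rewrite subr_le0 -ler_pdivlMl ?divr_gt0// invf_div mulr1.
have y1 : 1 <= 2 / a * `|y|.
  by rewrite -ler_pdivrMl ?divr_gt0// invf_div mulr1 ltW.
rewrite (min_idPl y1) mulr1 (le_trans (clip_le1 _))//.
have -> : 4 / a ^+ 2 * y ^+ 2 = (2 / a * `|y|) ^+ 2.
  by rewrite exprMn real_normK ?num_real// expr_div_n; congr (_ / _ * _); ring.
exact: exprn_ege1.
Qed.

(** A sum over [m] blocks of the same length can be afforded: the probability for one block is
    passed to the Gaussian law by the central limit theorem, where it is o(1/m). The threshold on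
    [t] depends on [m], but neither on the grid size [K] nor on the position [s] of the block. *)
Lemma grid_tail delta eta : 0 < delta -> 0 < eta ->
  exists m0 : nat, forall m : nat, (m0 < m)%N ->
  exists2 t0 : R, 0 < t0 & forall t : R, t0 <= t -> forall (K : nat) (s : R),
    (0 < K)%N -> 0 <= s ->
    m%:R * \int[P]_w (walk_exceeds delta 0
      (block (Num.sqrt t)^-1 s (t / m%:R / K%:R) K w))%:R <= eta.
Proof.
move=> delta0 eta0; pose a := delta / 2; have a0 : 0 < a by rewrite divr_gt0.
have aa : a + a = delta by rewrite /a -splitr.
have ea : 0 < eta * a ^+ 2 / 16 by rewrite divr_gt0// mulr_gt0// exprn_gt0.
have cW := limit_law_centered sigma_ge0.
have [c0 c00 Hc0] := let: And3 i _ _ := cW in trunc_moment_cvg0 i ea.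
have k0 : 0 <= 2 / a by rewrite divr_ge0// ltW.
(* [B] is chosen so that Chebyshev's bound is (B/m + B/t)/4, at most 1/2 once [m] and [t] exceed
   [B]; [D] below so that (2/a)/sqrt m is at most [c0] once [m] exceeds [D]. *)
pose B := 4 * sigma ^+ 2 / a ^+ 2.
have B0 : 0 <= B by rewrite divr_ge0 ?sqr_ge0// mulr_ge0// sqr_ge0.
pose D := (2 / a / c0) ^+ 2.
have D0 : 0 < D by rewrite exprn_gt0// divr_gt0// divr_gt0.
exists (Num.truncn (Num.max B D)) => m m0m.
have BDm : Num.max B D <= m%:R.
  have mx0 : 0 <= Num.max B D by rewrite le_max B0.
  have [_ /ltW lt2] := truncn_itv_nat mx0.
  by rewrite (le_trans lt2)// ler_nat.
have m0 : (0 < m)%N by exact: leq_ltn_trans m0m.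
have m0' : 0 < (m%:R : R) by rewrite ltr0n.
have em : 0 < eta / (4 * m%:R) by rewrite divr_gt0// mulr_gt0.
have [t1 t10 Ht1] := clt_bounded_lipschitz V_indep V_homog V_centered V_0 sigma_ge0
  V_var W_Wiener 1 (2 / a) m0 em.
exists (Num.max t1 (B + 1)) => [|t]; first by rewrite lt_max t10.
rewrite ge_max => /andP[t1t Bt] K s K0 s0.
have t0 : 0 < t by rewrite (lt_le_trans t10).
have K0' : 0 < (K%:R : R) by rewrite ltr0n.
pose c := (Num.sqrt t)^-1.
have c2E : c ^+ 2 = t^-1 by rewrite exprVn sqr_sqrtr// ltW.
pose h := t / m%:R / K%:R.
have h0 : 0 <= h by rewrite divr_ge0// divr_ge0// ltW.
have Kh : K%:R * h = t / m%:R by rewrite /h mulrCA divff ?lt0r_neq0// mulr1.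
have small : c ^+ 2 * (K%:R * h + 1) * sigma ^+ 2 / a ^+ 2 <= 2^-1.
  have -> : c ^+ 2 * (K%:R * h + 1) * sigma ^+ 2 / a ^+ 2 = B / 4 * (m%:R^-1 + t^-1).
    by rewrite Kh c2E /B; field; rewrite !lt0r_neq0.
  have B1 : B / m%:R <= 1.
    by rewrite ler_pdivrMr// mul1r (le_trans _ BDm)// le_max lexx.
  have B2 : B / t <= 1.
    by rewrite ler_pdivrMr// mul1r (le_trans _ Bt)// lerDl.
  have -> : B / 4 * (m%:R^-1 + t^-1) = (B / m%:R + B / t) / 4 by ring.
  by lra.
rewrite -aa; have := block_tail a0 s0 h0 small; rewrite -/c -/h => tailb.
(* Multiplied by 2m, the error of the central limit theorem is [eta / 2]; the Gaussian term
   contributes the other half. *)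
apply: (@le_trans _ _ (m%:R * (2 * (\int[limit_law sigma (Num.sqrt m%:R^-1)]_y clip (2 / a * `|y| - 1) + eta / (4 * m%:R))))).
  rewrite ler_pM2l// (le_trans tailb)// ler_pM2l//.
  pose phi (y : R) := clip (2 / a * `|y| - 1).
  have phiL x y : `|phi x - phi y| <= 2 / a * `|x - y|.
    rewrite (le_trans (clip_lipschitz _ _))// opprB addrA subrK -mulrBr normrM.
    by rewrite (ger0_norm k0) ler_wpM2l// ler_dist_dist.
  have phi1 y : `|phi y| <= 1 by rewrite ger0_norm ?clip_ge0 ?clip_le1.
  have := Ht1 t t1t phi phiL phi1 => /ler_normlP[_].
  rewrite lerBlDl => le1.
  have mphi := lipschitz_measurable phiL.
  apply: le_trans le1.
  have tm0 : 0 <= t / m%:R by rewrite -Kh mulr_ge0.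
  rewrite -(Rintegral_inc V_homog _ (lexx 0) tm0 mphi phi1) Kh -/c.
  have mY := measurable_inc V c 0 (t / m%:R).
  apply: le_Rintegral => //.
  - apply: (@bounded_integrable _ _ _ _ _ 1); last by move=> w; exact: norm_bool_le1.
    by apply: measurable_ind_gt; exact: measurableT_comp.
  - by apply: (bounded_integrable _ (measurableT_comp mphi mY)) => w; exact: phi1.
  - move=> w _; case: ltP => [aY|_]; last exact: clip_ge0.
    rewrite /phi clip_eq1// lerBrDr -[1 + 1]/(2%:R) -ler_pdivrMl ?divr_gt0//.
    by rewrite invf_div mulfVK// ltW.
have := limit_law_tail a0 m0; set I := \int[_]_y _ => tl.
have -> : m%:R * (2 * (I + eta / (4 * m%:R))) = 2 * (m%:R * I) + eta / 2.
  by field; rewrite lt0r_neq0.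
have tr : trunc_moment (limit_law sigma 1) (2 / a * Num.sqrt m%:R^-1) <= eta * a ^+ 2 / 16.
  apply: Hc0; first exact: mulr_ge0 k0 (sqrtr_ge0 _).
  have kc : 0 <= 2 / a / c0 by rewrite divr_ge0// ltW.
  have km : 2 / a / c0 <= Num.sqrt m%:R.
    rewrite -ler_sqr ?nnegrE ?sqrtr_ge0// sqr_sqrtr ?ler0n// (le_trans _ BDm)//.
    by rewrite le_max lexx orbT.
  rewrite sqrtrV ?ler0n// ler_pdivrMr ?sqrtr_gt0//.
  by rewrite -ler_pdivrMl// mulrC.
have a4 : 0 <= 4 / a ^+ 2 by rewrite divr_ge0// sqr_ge0.
have : m%:R * I <= eta / 4.
  rewrite (le_trans tl)// (le_trans (ler_wpM2l a4 tr))// le_eqVlt.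
  by apply/orP; left; apply/eqP; field; rewrite lt0r_neq0.
by lra.
Qed.

End tail_bound.

(** * The space D[0, 1] *)

Section step_functions.
Variable R : realType.
Implicit Types (f g h : D01 R) (s : seq R) (x : R).

Definition step_val (m : nat) s x : R :=
  \sum_(y <- take (Num.truncn (m%:R * x)) s) y.

Lemma truncn_eqP (n : nat) x : n%:R <= x -> x < n.+1%:R -> Num.truncn x = n.
Proof. by move=> nx xn; apply: truncn_def; rewrite nx xn. Qed.

Lemma cadlag_step m s : (0 < m)%N -> cadlag `[0, 1] (step_val m s \_ `[0, 1]).
Proof.
move=> m0 t; rewrite /= in_itv/= => /andP[t0 t1].
have m0' : 0 < (m%:R : R) by rewrite ltr0n.
pose k := Num.truncn (m%:R * t).
have mt0 : 0 <= m%:R * t by rewrite mulr_ge0.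
have [k1 k2] := truncn_itv_nat mt0; rewrite -/k in k1 k2.
have constE (F : set_system R) (FF : Filter F) n :
    (\forall x \near F, `[0, 1]%classic x -> Num.truncn (m%:R * x) = n) ->
    (step_val m s \_ `[0, 1]) x @[x --> within `[0, 1] F] -->
      \sum_(y <- take n s) y.
  move=> Fn; apply: cvg_near_cst; rewrite near_withinE; apply: filterS Fn => x xn Ix.
  by rewrite patchE mem_set// /step_val xn.
split.
  rewrite {2}/patch mem_set; last by rewrite /= in_itv/= t0.
  apply: constE; near=> x => Ix; apply: truncn_eqP.
    by rewrite (le_trans k1)// ler_pM2l// ltW//; near: x; exact: nbhs_right_gt.
  rewrite mulrC -ltr_pdivlMr//; near: x; apply: nbhs_right_lt.
  by rewrite ltr_pdivlMr// mulrC.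
have [km|km] := ltP (k%:R : R) (m%:R * t).
  exists (\sum_(y <- take k s) y); apply: constE; near=> x => Ix; apply: truncn_eqP.
    rewrite mulrC -ler_pdivrMr// ltW//; near: x; apply: nbhs_left_gt.
    by rewrite ltr_pdivrMr// mulrC.
  by rewrite (lt_trans _ k2)// ltr_pM2l//; near: x; exact: nbhs_left_lt.
(* Here [m%:R * t] is the integer [k] and the path may jump at [t], so the left limit uses [k.-1]
   entries. For [k = 0] the point is 0, which has no left neighbour in the interval. *)
have [k0|k0] := posnP k.
  have t_le0 : t <= 0 by rewrite -(ler_pM2l m0') mulr0 (le_trans km)// k0.
  exists (\sum_(y <- take 0 s) y); apply: constE; near=> x => Ix.
  have xt : x < t by near: x; exact: nbhs_left_lt.
  move: Ix; rewrite /= in_itv/= => /andP[x0 _].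
  by have := lt_le_trans (le_lt_trans x0 xt) t_le0; rewrite ltxx.
exists (\sum_(y <- take k.-1 s) y); apply: constE; near=> x => Ix.
apply: truncn_eqP.
  rewrite mulrC -ler_pdivrMr// ltW//; near: x; apply: nbhs_left_gt.
  by rewrite ltr_pdivrMr// mulrC (lt_le_trans _ k1)// ltr_nat prednK.
rewrite prednK// (lt_le_trans _ km)// ltr_pM2l//; near: x; exact: nbhs_left_lt.
Unshelve. all: by end_near. Qed.

Lemma step_out m s x : ~ `[0, 1]%classic x -> (step_val m s \_ `[0, 1]) x = 0.
Proof. by move=> nx; rewrite patchE memNset. Qed.

Definition stepD m s : D01 R := if pselect (0 < m)%N is left m0
  then MkD01 (cadlag_step s m0) (@step_out m s) else D01_zero R.

Lemma stepDE m s x : (0 < m)%N -> `[0, 1]%classic x -> stepD m s x = step_val m s x.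
Proof. by move=> m0 Ix; rewrite /stepD; case: pselect => //= _; rewrite patchE mem_set. Qed.

Lemma truncn_le_mesh (m : nat) x : `[0, 1]%classic x ->
  [/\ (Num.truncn (m%:R * x) <= m)%N, (Num.truncn (m%:R * x))%:R <= m%:R * x &
     m%:R * x < (Num.truncn (m%:R * x)).+1%:R].
Proof.
rewrite /= in_itv/= => /andP[x0 x1].
have mx0 : 0 <= m%:R * x by rewrite mulr_ge0.
have [k1 k2] := truncn_itv_nat mx0; split => //.
by rewrite -(ler_nat R) (le_trans k1)// ler_piMr.
Qed.

Lemma step_val_mkseq m (a : nat -> R) x : `[0, 1]%classic x ->
  step_val m (mkseq a m) x = \sum_(0 <= i < Num.truncn (m%:R * x)) a i.
Proof.
move=> Ix; have [km _ _] := truncn_le_mesh m Ix.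
by rewrite /step_val /mkseq -map_take take_iota (minn_idPl km) big_map -/(index_iota 0 _) /index_iota subn0.
Qed.

(** Changing one increment shifts all later values by the same amount. A Lipschitz functional thus
    becomes a Lipschitz function of each increment with the same constant, as the uniform central
    limit theorem requires. *)
Lemma stepD_dist_coord m p s (y z : R) :
  unif_dist (stepD m (p ++ y :: s)) (stepD m (p ++ z :: s)) <= `|y - z|.
Proof.
apply: unif_dist_le => x Ix.
have [m0|m0] := boolP (0 < m)%N; last first.
  by rewrite /stepD; case: pselect => [m1|//]; [rewrite m1 in m0|rewrite subrr normr0].
rewrite !stepDE// /step_val !take_cat; case: ltnP => [_|_]; first by rewrite subrr normr0.
case: (_ - _)%N => [|j] /=; first by rewrite subrr normr0.
rewrite !big_cat /= !big_cons; set A := \sum_(_ <- p) _; set B := \sum_(_ <- _) _.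
by rewrite opprD addrACA subrr add0r opprD addrACA subrr addr0.
Qed.

Lemma D01_measurable_fun d (T : measurableType d) (f : T -> D01 R) :
  (forall x, `[0, 1]%classic x -> measurable_fun setT (fun w => f w x)) ->
  measurable_fun setT f.
Proof.
move=> mf; apply: (@measurability _ _ _ _ _ _ (@D01_cylinders R)) => //.
move=> _ [_ [x [B [Ix mB ->]]] <-].
exact: (mf x Ix).
Qed.

Lemma measurable_eval x : `[0, 1]%classic x -> measurable_fun setT (fun f : D01 R => f x).
Proof.
move=> Ix _ B mB; rewrite setTI; apply: sub_sigma_algebra.
by exists x, B.
Qed.

Lemma measurable_stepD d (T : measurableType d) (Y : nat -> T -> R) m n :
  (forall i, measurable_fun setT (Y i)) ->
  measurable_fun setT (fun w => stepD m (mkseq (Y ^~ w) n)).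
Proof.
move=> mY; apply: D01_measurable_fun => x Ix.
have [m0|m0] := boolP (0 < m)%N; last first.
  rewrite /stepD; case: pselect => [m1|//]; by rewrite m1 in m0.
under eq_fun do rewrite stepDE// /step_val /mkseq -map_take big_map.
exact: measurable_sum.
Qed.

Lemma unif_dist_exists_gt f g a : a < unif_dist f g ->
  exists2 x, `[0, 1]%classic x & a < `|f x - g x|.
Proof.
move=> ad; apply: contrapT => nx; move: ad; rewrite ltNge => /negP; apply.
apply: unif_dist_le => x Ix; rewrite leNgt; apply/negP => ax; apply: nx.
by exists x.
Qed.

Lemma right_near_gt f g x a : `[0, 1]%classic x -> x < 1 -> a < `|f x - g x| ->
  exists2 z, x < z & forall y, x < y -> y < z -> y <= 1 -> a < `|f y - g y|.
Proof.
move=> Ix x1 afg.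
have [cf _] := D01_cadlag f Ix; have [cg _] := D01_cadlag g Ix.
have /cvgr_norm_gt/(_ _ afg) : f y - g y @[y --> within `[0, 1] x^'+] --> f x - g x.
  exact: cvgB.
rewrite near_withinE => -[e /= e0 He]; exists (x + e); first by rewrite ltrDl.
move=> y xy yz y1; apply: He => //=.
  by rewrite ltr0_norm ?subr_lt0// opprB ltrBlDl.
by move: Ix; rewrite /= in_itv/= => /andP[x0 _]; rewrite in_itv/= y1 andbT (le_trans x0)// ltW.
Qed.

(** Right continuity reduces the supremum to rational points, hence to countably many coordinates;
    the endpoint 1 has no right neighbour but is itself rational. *)
Lemma measurable_unif_dist d (T : measurableType d) (F G : T -> D01 R) :
  measurable_fun setT F -> measurable_fun setT G ->
  measurable_fun setT (fun w => unif_dist (F w) (G w)).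
Proof.
move=> mF mG; apply: (measurability _ (RGenOInfty.measurableE R)) => // _ [_ [a ->] <-].
rewrite setTI; pose A (q : rat) : set T := if (ratr q : R) \in `[0, 1]%R then
  [set w | a < `|F w (ratr q) - G w (ratr q)|] else set0.
have -> : (fun w => unif_dist (F w) (G w)) @^-1` `]a, +oo[%classic = \bigcup_q A q.
  apply/seteqP; split => w /=; rewrite in_itv/= andbT; last first.
    move=> [q _]; rewrite /A; case: ifPn => // Iq /lt_le_trans; apply.
    exact: unif_dist_ub.
  move=> /unif_dist_exists_gt[x Ix ax].
  have := Ix; rewrite /= in_itv/= => /andP[x0]; rewrite le_eqVlt => /predU1P[x1|x1].
    by exists 1 => //; rewrite /A rmorph1 in_itv/= ler01 lexx/= -x1.
  have [z xz Hz] := right_near_gt Ix x1 ax.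
  have xz1 : x < Num.min z 1 by rewrite lt_min xz x1.
  have [q] := rat_in_itvoo xz1.
  rewrite in_itv/= lt_min => /andP[xq /andP[qz q1]].
  exists q => //; rewrite /A in_itv/= (le_trans x0 (ltW xq)) (ltW q1)/=.
  by apply: Hz => //; exact: ltW.
apply: bigcupT_measurable_rat => q; rewrite /A; case: ifPn => // Iq.
have mq : measurable_fun setT (fun w => `|F w (ratr q) - G w (ratr q)|).
  apply: measurableT_comp => //; apply: measurable_funB.
    exact: (measurableT_comp (measurable_eval Iq) mF).
  exact: (measurableT_comp (measurable_eval Iq) mG).
have := mq measurableT _ (measurable_itv `]a, +oo[); rewrite setTI.
by congr measurable; apply/seteqP; split => w /=; rewrite in_itv/= andbT.
Qed.

Lemma segment_uniform_continuity (a : R -> R) e : {within `[0, 1], continuous a} -> 0 < e ->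
  \forall m \near \oo, forall x y, `[0, 1]%classic x -> `[0, 1]%classic y ->
    `|x - y| <= m.+1%:R^-1 -> `|a x - a y| <= e.
Proof.
move=> /subspace_continuousP ca e0; have e20 : 0 < e / 2 by rewrite divr_gt0.
have /compact_near_coveringP cov := @segment_compact R 0 1.
have := cov nat \oo (fun m x => `[0, 1]%classic x -> forall y, `[0, 1]%classic y ->
    `|x - y| <= m.+1%:R^-1 -> `|a x - a y| <= e) _.
case=> [t It|M MI HM]; last first.
  by exists M => // m Mm x y Ix; apply: HM.
have /cvgrPdist_lt/(_ _ e20) := ca t It; rewrite near_withinE => /nbhs_ballP[r /= r0 Hr].
have r20 : 0 < r / 2 by rewrite divr_gt0.
have Ht : \forall x \near t, `|t - x| < r / 2 by apply/nbhs_ballP; exists (r / 2).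
near=> x m; move=> /= Ix y Iy xy.
have xt : `|t - x| < r / 2 by near: x; exact: Ht.
have mr : m.+1%:R^-1 < r / 2 by near: m; exact: (near_infty_natSinv_lt (PosNum r20)).
have ht : `|t - y| < r.
  rewrite (splitr r) (le_lt_trans (ler_distD x _ _))// ltrD//; exact: le_lt_trans mr.
have h1 := Hr x _ Ix; have h2 := Hr y ht Iy.
rewrite (splitr e) (le_trans (ler_distD (a t) _ _))// lerD// ltW//.
rewrite distrC; apply: h1; apply: lt_trans xt _.
by rewrite ltr_pdivrMr// ltr_pMr// ltr1n.
Unshelve. all: by end_near. Qed.

Lemma stepD_increments (a : R -> R) f e m : (0 < m)%N -> a 0 = 0 ->
  (forall x, `[0, 1]%classic x -> f x = a x) ->
  (forall x y, `[0, 1]%classic x -> `[0, 1]%classic y ->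
     `|x - y| <= m%:R^-1 -> `|a x - a y| <= e) ->
  unif_dist f (stepD m (mkseq (fun i => a (i.+1%:R * m%:R^-1) - a (i%:R * m%:R^-1)) m)) <= e.
Proof.
move=> m0 a0 fa Hm; have m0' : 0 < (m%:R : R) by rewrite ltr0n.
apply: unif_dist_le => x Ix; rewrite stepDE// step_val_mkseq// fa//.
rewrite (@telescope_sumr _ _ _ (fun i => a (i%:R * m%:R^-1)))// mul0r a0 subr0.
have [km k1 k2] := truncn_le_mesh m Ix; set k := Num.truncn _ in km k1 k2 *.
apply: Hm => //.
  by rewrite /= in_itv/= divr_ge0//= ler_pdivrMr// mul1r ler_nat.
rewrite -[x in x - _](mulfK (lt0r_neq0 m0')) -mulrBl normrM [`|m%:R^-1|]ger0_norm ?invr_ge0//.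
rewrite ler_piMl ?invr_ge0// mulrC ger0_norm ?subr_ge0//.
by rewrite lerBlDl natr1 ltW.
Qed.

(** Half of [e] pays for the discretization; the other half is shared among the [m.+1] increments,
    whose rounding errors add up along the path. *)
Lemma stepD_rat_dense (a : R -> R) f e : {within `[0, 1], continuous a} -> a 0 = 0 ->
  (forall x, `[0, 1]%classic x -> f x = a x) -> 0 < e ->
  exists m (s : seq rat), unif_dist f (stepD m (map ratr s)) <= e.
Proof.
move=> ca a0 fa e0; have e20 : 0 < e / 2 by rewrite divr_gt0.
have [m _ /(_ m (leqnn m)) /= Hm] := segment_uniform_continuity ca e20.
pose b i := a (i.+1%:R * m.+1%:R^-1) - a (i%:R * m.+1%:R^-1).
have em : 0 < e / 2 / m.+1%:R by rewrite divr_gt0.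
have [q Hq] : {q : nat -> rat & forall i, `|b i - ratr (q i)| <= e / 2 / m.+1%:R}.
  apply: (@choice _ _ (fun i q => `|b i - ratr q| <= e / 2 / m.+1%:R)) => i.
  have bi : b i < b i + e / 2 / m.+1%:R by rewrite ltrDl.
  have [q] := rat_in_itvoo bi.
  rewrite in_itv/= => /andP[q1 q2]; exists q.
  by rewrite distrC ger0_norm ?subr_ge0 ?(ltW q1)// lerBlDl ltW.
exists m.+1, (mkseq q m.+1); apply: unif_dist_le => x Ix.
have := @stepD_increments a f (e / 2) m.+1 isT a0 fa Hm.
move=> /(le_trans (unif_dist_ub _ _ Ix)); rewrite -/b !stepDE// => h1.
rewrite (splitr e) (le_trans (ler_distD _ _ _) (lerD h1 _))//.
rewrite /mkseq -map_comp -/(mkseq _ _) -/(mkseq _ _) !step_val_mkseq//= -sumrB.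
rewrite (le_trans (ler_norm_sum _ _ _))// (le_trans (ler_sum _ (fun i _ => Hq i)))//.
have [km _ _] := truncn_le_mesh m.+1 Ix.
rewrite sumr_const_nat subn0 -[leLHS]mulr_natr mulrAC ler_pdivrMr//.
by rewrite ler_wpM2l ?(ltW e20)// ler_nat.
Qed.

Lemma unif_dist_sym f g : unif_dist f g = unif_dist g f.
Proof. exact: (metric_sym f g). Qed.

Lemma unif_dist_triangle g f h : unif_dist f h <= unif_dist f g + unif_dist g h.
Proof. exact: (metric_triangle f g h). Qed.

Lemma ball_unif_dist f r g : ball f r g = (unif_dist f g < r).
Proof. by rewrite ballEmdist. Qed.

End step_functions.

Lemma bounded_cvg_Rintegral d (T : measurableType d) (R : realType) (P : probability T R)
    (F : nat -> T -> R) (G : T -> R) (M : R) :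
  (forall n, measurable_fun setT (F n)) -> measurable_fun setT G ->
  (forall n w, `|F n w| <= M) -> {ae P, forall w, F n w @[n --> \oo] --> G w} ->
  \int[P]_w F n w @[n --> \oo] --> \int[P]_w G w.
Proof.
move=> mF mG FM FG.
have [|||||IG _] := @dominated_convergence _ _ _ P setT measurableT
    (fun n w => (F n w)%:E) (fun w => (G w)%:E) (fun=> M%:E).
- by move=> n; apply/measurable_EFinP.
- exact/measurable_EFinP.
- by apply: filterS FG => w Fw _; apply: cvg_EFin => //; exact: nearW.
- exact: finite_measure_integrable_cst.
- by apply: aeW => w n _; rewrite lee_fin.
move=> IF; rewrite /Rintegral; apply: fine_cvg.
by rewrite fineK//; exact: integrable_fin_num.
Qed.

Lemma measurable_clip (R : realType) : measurable_fun setT (@clip R).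
Proof.
apply: continuous_measurable_fun; apply: (@lipschitz_continuous _ _ 1) => x y.
by rewrite mul1r clip_lipschitz.
Qed.

(** * Bounded Lipschitz test functions and the reduction to them *)

Section bounded_lipschitz.
Variable R : realType.
Implicit Types (f h : D01 R) (F G : D01 R -> R).

(** Measurability is a separate clause: continuity for the uniform metric does not imply it for the
    cylinder sigma-algebra. *)
Definition bounded_lipschitz F : Prop :=
  [/\ measurable_fun setT F, exists M, forall f, `|F f| <= M &
      exists L, forall f h, `|F f - F h| <= L * unif_dist f h].

Lemma unif_dist_ge0 f h : 0 <= unif_dist f h.
Proof. exact: (@mdist_ge0 _ _ f h). Qed.

Lemma bounded_lipschitz_cst c : bounded_lipschitz (fun=> c).
Proof.
split; [exact: measurable_cst|by exists (`|c|)|exists 0 => f h].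
by rewrite subrr normr0 mul0r.
Qed.

Lemma bounded_lipschitzD F G : bounded_lipschitz F -> bounded_lipschitz G ->
  bounded_lipschitz (fun f => F f + G f).
Proof.
move=> [mF [M FM] [L FL]] [mG [M' GM] [L' GL]]; split.
- exact: measurable_funD.
- by exists (M + M') => f; rewrite (le_trans (ler_normD _ _))// lerD.
- exists (L + L') => f h; rewrite opprD addrACA (le_trans (ler_normD _ _))//.
  by rewrite mulrDl lerD.
Qed.

Lemma bounded_lipschitzM F G : bounded_lipschitz F -> bounded_lipschitz G ->
  bounded_lipschitz (fun f => F f * G f).
Proof.
move=> [mF [M FM] [L FL]] [mG [M' GM] [L' GL]]; split.
- exact: measurable_funM.
- by exists (M * M') => f; rewrite normrM ler_pM.
- exists (M' * L + M * L') => f h.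
  rewrite (_ : _ - _ = G f * (F f - F h) + F h * (G f - G h)); last by ring.
  rewrite (le_trans (ler_normD _ _))// !normrM mulrDl lerD// -mulrA.
    by rewrite ler_pM.
  by rewrite ler_pM.
Qed.

(** A Lipschitz cutoff, equal to 1 within distance [r] of [h] and to 0 beyond [2 * r]. *)
Definition bump h r f : R := clip (2 - unif_dist f h / r).

Lemma bounded_lipschitz_bump h r : 0 < r -> bounded_lipschitz (bump h r).
Proof.
move=> r0; have bumpL f f' : `|bump h r f - bump h r f'| <= r^-1 * unif_dist f f'.
  rewrite (le_trans (clip_lipschitz _ _))// opprB addrC addrA subrK -mulrBl normrM mulrC.
  rewrite [`|r^-1|]gtr0_norm ?invr_gt0// ler_wpM2l ?invr_ge0 ?(ltW r0)//.
  have := unif_dist_triangle f' f h; have := unif_dist_triangle f f' h.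
  by rewrite (unif_dist_sym f' f) ler_norml => h1 h2; apply/andP; split; lra.
split; [|exists 1 => f|by exists r^-1].
  apply: (measurableT_comp (@measurable_clip R)).
  apply: measurable_funB => //; apply: measurable_funM => //.
  by apply: (measurable_unif_dist (F := id)) => //; exact: measurable_cst.
by rewrite ger0_norm ?clip_ge0 ?clip_le1.
Qed.

End bounded_lipschitz.

Section reduction.
Context (R : realType) (g : D01 R -> R) (M eta : R).
Hypotheses (cg : continuous g) (mg : measurable_fun setT g) (gM : forall f, `|g f| <= M).
Hypothesis eta0 : 0 < eta.

(** The index codes a triple: a mesh, a list of rational increments, and [k] for the radius 1/(k +
    1). Every center thus occurs with arbitrarily small radii. *)
Let center (j : nat) : D01 R :=
  if (unpickle j : option (nat * seq rat * nat)) is Some (m, s, _) then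
    stepD m (map ratr s) else D01_zero R.

Let radius (j : nat) : R :=
  if (unpickle j : option (nat * seq rat * nat)) is Some (_, _, k) then k.+1%:R^-1 else 1.

Let radius_gt0 j : 0 < radius j.
Proof. by rewrite /radius; case: unpickle => [[[m s] k]|//]; rewrite invr_gt0. Qed.

(* A bump around the j-th point of a countable dense set, discarded when g varies
   by more than eta on its support. *)
Definition cell (j : nat) (f : D01 R) : R :=
  if `[< forall f', unif_dist f' (center j) < 2 * radius j -> `|g f' - g (center j)| <= eta >]
  then bump (center j) (radius j) f else 0.

Fixpoint uncovered (n : nat) (f : D01 R) : R :=
  if n is n'.+1 then uncovered n' f * (1 - cell n' f) else 1.

(** The weights [cell n f * uncovered n f] are nonnegative and telescope to [1 - uncovered n f]: a
    partition of unity up to the uncovered mass, obtained without any division. *)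
Fixpoint cell_sum (n : nat) (f : D01 R) : R :=
  if n is n'.+1 then cell_sum n' f + g (center n') * (cell n' f * uncovered n' f) else 0.

Lemma cell_bl j : bounded_lipschitz (cell j).
Proof.
rewrite /cell; case: asbool; last exact: bounded_lipschitz_cst.
exact: bounded_lipschitz_bump.
Qed.

Lemma uncovered_bl n : bounded_lipschitz (uncovered n).
Proof.
elim: n => [|n IHn]; first exact: bounded_lipschitz_cst.
apply: bounded_lipschitzM => //.
rewrite (_ : (fun f => _) = fun f => 1 + (-1) * cell n f); last first.
  by apply/funext => f; rewrite mulN1r.
apply: bounded_lipschitzD; first exact: bounded_lipschitz_cst.
by apply: bounded_lipschitzM; [exact: bounded_lipschitz_cst|exact: cell_bl].
Qed.

Lemma cell_sum_bl n : bounded_lipschitz (cell_sum n).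
Proof.
elim: n => [|n IHn]; first exact: bounded_lipschitz_cst.
apply: bounded_lipschitzD => //; apply: bounded_lipschitzM.
  exact: bounded_lipschitz_cst.
by apply: bounded_lipschitzM; [exact: cell_bl|exact: uncovered_bl].
Qed.

Lemma cell_itv j f : 0 <= cell j f <= 1.
Proof. by rewrite /cell; case: ifP => _; rewrite ?lexx ?ler01// clip_ge0 clip_le1. Qed.

Lemma uncovered_itv n f : 0 <= uncovered n f <= 1.
Proof.
elim: n => [|n /andP[r0 r1]] /=; first by rewrite ler01 lexx.
have /andP[c0 c1] := cell_itv n f.
by rewrite mulr_ge0 ?subr_ge0//= mulr_ile1 ?subr_ge0// gerBl.
Qed.

Lemma cell_dist j f : cell j f * `|g f - g (center j)| <= eta * cell j f.
Proof.
rewrite /cell; case: asboolP => [H|_]; last by rewrite mul0r mulr0.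
have [d2|d2] := ltP (unif_dist f (center j)) (2 * radius j).
  by rewrite mulrC ler_wpM2r ?clip_ge0// H.
by rewrite /bump clip_eq0 ?mul0r ?mulr0// subr_le0 ler_pdivlMr.
Qed.

Lemma cell_sum_dist n f : `|g f - cell_sum n f| <= eta + M * uncovered n f.
Proof.
have H : `|g f * (1 - uncovered n f) - cell_sum n f| <= eta * (1 - uncovered n f).
  elim: n => [|n IHn] /=; first by rewrite subrr !mulr0 subr0 normr0.
  have /andP[r0 r1] := uncovered_itv n f; have /andP[c0 _] := cell_itv n f.
  rewrite (_ : _ - _ = (g f * (1 - uncovered n f) - cell_sum n f) +
     uncovered n f * (cell n f * (g f - g (center n)))); last by ring.
  rewrite (_ : eta * _ = eta * (1 - uncovered n f) + uncovered n f * (eta * cell n f)); last by ring.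
  rewrite (le_trans (ler_normD _ _))// lerD// normrM ger0_norm// ler_wpM2l//.
  by rewrite normrM ger0_norm// cell_dist.
have /andP[r0 r1] := uncovered_itv n f.
rewrite (_ : g f - _ = (g f * (1 - uncovered n f) - cell_sum n f) + g f * uncovered n f); last by ring.
rewrite (le_trans (ler_normD _ _))// lerD// ?normrM ?(ger0_norm r0) ?ler_wpM2r//.
by rewrite (le_trans H)// ler_piMr ?(ltW eta0)// gerBl.
Qed.

Lemma uncovered_cvg0 f : (forall e, 0 < e -> exists m s, unif_dist f (stepD m (map ratr s)) <= e) ->
  uncovered n f @[n --> \oo] --> (0 : R).
Proof.
move=> Hf; have eta2 : 0 < eta / 2 by rewrite divr_gt0.
have gf : g f' @[f' --> f] --> g f by exact: cg.
have /cvgrPdist_le/(_ _ eta2)/nbhs_ballP[e /= e0 He] := gf.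
(* With radius r < e/3 and a center within r of [f], the ball of radius 2r about the center lies
   within e of [f], where [g] varies little. The cell is therefore kept and equals 1 at [f], so one
   factor of [uncovered] vanishes from then on. *)
have e3 : 0 < e / 3 by rewrite divr_gt0.
have [k _ /(_ k (leqnn k)) /= ke] := near_infty_natSinv_lt (PosNum e3).
have [m [s ms]] := Hf k.+1%:R^-1 ltac:(by rewrite invr_gt0).
pose j := pickle (m, s, k).
have cj : center j = stepD m (map ratr s) by rewrite /center pickleK.
have rj : radius j = k.+1%:R^-1 by rewrite /radius pickleK.
have cell1 : cell j f = 1.
  rewrite /cell asboolT; last first.
    move=> f' f'j.
    have h1 f'' : unif_dist f'' (center j) < 2 * radius j -> `|g f - g f''| <= eta / 2.
      move=> f''j; apply: He; rewrite /= ball_unif_dist.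
      rewrite (le_lt_trans (unif_dist_triangle (center j) _ _))//.
      rewrite (unif_dist_sym (center j)); rewrite cj rj in f''j *.
      by move: f''j ms ke; set x := k.+1%:R^-1; lra.
    rewrite (splitr eta) (le_trans (ler_distD (g f) _ _))// lerD//; first by rewrite distrC h1.
    apply: h1; rewrite (le_lt_trans (unif_dist_le (M := 0) _))//; first by move=> x _; rewrite subrr normr0.
    by rewrite mulr_gt0.
  rewrite /bump clip_eq1// cj rj lerBrDl -lerBrDr.
  by rewrite ler_pdivrMr ?invr_gt0// (le_trans ms)// ler_peMl ?invr_ge0//; lra.
have uncovered0 i : uncovered (j.+1 + i) f = 0.
  elim: i => [|i IH]; first by rewrite addn0 /= cell1 subrr mulr0.
  by rewrite addnS -[LHS]/(uncovered (j.+1 + i) f * _) IH mul0r.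
apply: cvg_near_cst; exists j.+1 => // n /= jn.
by rewrite -(subnKC jn) uncovered0.
Qed.

End reduction.

Lemma bounded_lipschitz_cvg (R : realType) d (T : measurableType d) (P : probability T R)
    d' (T' : measurableType d') (P' : probability T' R)
    (X : R -> {RV P >-> D01 R}) (Z : {RV P' >-> D01 R}) :
  {ae P', forall w, forall e, 0 < e ->
     exists m s, unif_dist (Z w) (stepD m (map ratr s)) <= e} ->
  (forall F, bounded_lipschitz F -> forall e, 0 < e -> exists2 t0, 0 < t0 &
     forall t, t0 <= t -> `|\int[P]_w F (X t w) - \int[P']_w F (Z w)| <= e) ->
  cvg_in_distribution X Z.
Proof.
move=> Zsep cvgF g [M gM] cg mg.
have M0 : 0 <= M by apply: le_trans (gM (D01_zero R)).
have mD d0 (S : measurableType d0) (Q : probability S R) (Y : {RV Q >-> D01 R}) F :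
    measurable_fun setT F -> measurable_fun setT (fun w => F (Y w) : R).
  by move=> mF; exact: (measurableT_comp mF).
have EE d0 (S : measurableType d0) (Q : probability S R) (Y : {RV Q >-> D01 R}) :
    'E_Q[g \o Y]%E = (\int[Q]_w g (Y w))%:E.
  rewrite unlock /Rintegral fineK//; apply: integrable_fin_num => //.
  by apply: (@bounded_integrable _ _ _ _ _ M) => //; exact: mD.
rewrite EE; under eq_fun do rewrite EE.
apply: cvg_EFin; first exact: nearW.
apply/cvgrPdist_le => e e0.
have eta0 : 0 < e / 8 by rewrite divr_gt0.
have gap d0 (S : measurableType d0) (Q : probability S R) (Y : {RV Q >-> D01 R}) n :
    `|\int[Q]_w g (Y w) - \int[Q]_w cell_sum g (e / 8) n (Y w)| <=
      e / 8 + M * \int[Q]_w uncovered g (e / 8) n (Y w).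
  have [mp [Mp pM] _] := cell_sum_bl g (e / 8) n.
  have [mr [Mr rM] _] := uncovered_bl g (e / 8) n.
  have ig : Q.-integrable setT (EFin \o (fun w => g (Y w))).
    by apply: (@bounded_integrable _ _ _ _ _ M) => //; exact: mD.
  have ip : Q.-integrable setT (EFin \o (fun w => cell_sum g (e / 8) n (Y w))).
    by apply: (@bounded_integrable _ _ _ _ _ Mp) => //; exact: mD.
  have ir : Q.-integrable setT (EFin \o (fun w => uncovered g (e / 8) n (Y w))).
    by apply: (@bounded_integrable _ _ _ _ _ Mr) => //; exact: mD.
  have iMr : Q.-integrable setT (EFin \o (fun w => M * uncovered g (e / 8) n (Y w))).
    apply: (@bounded_integrable _ _ _ _ _ (M * Mr)).
      by apply: measurable_funM => //; exact: mD.
    by move=> w; rewrite normrM ger0_norm// ler_wpM2l.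
  have ic : Q.-integrable setT (EFin \o (fun=> e / 8)).
    exact: finite_measure_integrable_cst.
  have igp : Q.-integrable setT (EFin \o (fun w => g (Y w) - cell_sum g (e / 8) n (Y w))).
    exact: (integrableB _ ig ip).
  rewrite -RintegralB// (le_trans (le_normr_Rintegral _ igp))//.
  rewrite -RintegralZl// -[X in X + _](Rintegral_cst1 Q) -RintegralD//.
  apply: le_Rintegral => //.
  - exact: (integrable_abse igp).
  - exact: (integrableD _ ic iMr).
  - by move=> w _; exact: cell_sum_dist.
have uncovered_cvg : \int[P']_w uncovered g (e / 8) n (Z w) @[n --> \oo] --> \int[P']_w (0 : R).
  apply: (@bounded_cvg_Rintegral _ _ _ _ _ _ 1) => //.
  - by move=> n; have [mr _ _] := uncovered_bl g (e / 8) n; exact: mD.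
  - move=> n w; have /andP[r0 r1] := uncovered_itv g (e / 8) n (Z w).
    by rewrite ger0_norm.
  - by apply: filterS Zsep => w; exact: uncovered_cvg0.
have e' : 0 < e / 8 / (M + 1) by rewrite divr_gt0// ltr_wpDl.
move: uncovered_cvg; rewrite Rintegral_cst1 => /cvgrPdist_le/(_ _ e')[n _ /(_ n (leqnn n))] /=.
rewrite sub0r normrN => /(le_trans (ler_norm _)) rn.
have [t1 t10 H1] := cvgF _ (cell_sum_bl g (e / 8) n) _ eta0.
have [t2 t20 H2] := cvgF _ (uncovered_bl g (e / 8) n) _ e'.
exists (Num.max t1 t2); split; first exact: num_real.
move=> t; rewrite /= gt_max => /andP[/ltW t1t /ltW t2t].
have h1 := H1 t t1t; have := H2 t t2t.
rewrite ler_distl => /andP[_ h2].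
have gX := gap _ _ _ (X t) n; have gZ := gap _ _ _ Z n.
move: h1 h2 rn gX gZ.
set a := \int[P]_w g _; set b := \int[P']_w g _; set pX := \int[P]_w cell_sum _ _ _ _.
set pZ := \int[P']_w cell_sum _ _ _ _; set rX := \int[P]_w uncovered _ _ _ _.
set rZ := \int[P']_w uncovered _ _ _ _ => h1 h2 rn gX gZ.
have MrZ : M * rZ <= e / 8.
  rewrite (le_trans (ler_wpM2l M0 rn))// mulrCA ler_piMr ?(ltW eta0)//.
  by rewrite ler_pdivrMr ?ltr_wpDl// mul1r lerDl.
have MrX : M * rX <= e / 8 + e / 8.
  rewrite (le_trans (ler_wpM2l M0 h2))// mulrDr lerD//.
  rewrite mulrCA ler_piMr ?(ltW eta0)//.
  by rewrite ler_pdivrMr ?ltr_wpDl// mul1r lerDl.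
(* The three terms are at most [e / 4], [e / 8] and [3 * e / 8]. *)
rewrite (_ : b - a = (b - pZ) - (pX - pZ) - (a - pX)); last by ring.
rewrite (le_trans (ler_normB _ _))// (le_trans (lerD (ler_normB _ _) (lexx _)))//.
lra.
Qed.

(** A deviation at some point of the interval persists just to its right, by right continuity of [f]
    and of the step path; every fine enough grid has a point there, in the same cell. An uncountable
    supremum is thus detected by finitely many increments. *)
Lemma step_path_dist (R : realType) (f : D01 R) (v : R -> R) (c t delta : R) (m : nat) :
  (0 < m)%N -> 0 < t -> 0 <= delta -> v 0 = 0 ->
  (forall x, `[0, 1]%classic x -> f x = c * v (t * x)) ->
  delta < unif_dist f (stepD m (mkseq (fun i => c * (v (0 + i.+1%:R * (t / m%:R))
    - v (0 + i%:R * (t / m%:R)))) m)) ->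
  exists2 i : nat, (i < m)%N & \forall K \near \oo, exists2 j : nat, (j <= K.+1)%N &
    delta < `|c * (v (i%:R * (t / m%:R) + j%:R * (t / m%:R / K.+1%:R))
      - v (i%:R * (t / m%:R)))|.
Proof.
move=> m0 t0 delta0 v0 fv; have m0' : 0 < (m%:R : R) by rewrite ltr0n.
set S := stepD _ _ => dS.
have SE x : `[0, 1]%classic x -> S x = c * v ((Num.truncn (m%:R * x))%:R * (t / m%:R)).
  move=> Ix; rewrite /S stepDE// step_val_mkseq// -mulr_sumr.
  rewrite (telescope_sumr (fun i => v (0 + i%:R * (t / m%:R))))//.
  by rewrite mul0r !add0r v0 subr0.
have [x Ix dx] := unif_dist_exists_gt dS.
have := Ix; rewrite /= in_itv/= => /andP[x0]; rewrite le_eqVlt => /predU1P[x1|x1].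
  (* At the endpoint 1 the step path agrees with [f], so no deviation can occur there. *)
  move: dx; rewrite fv// SE// x1 !mulr1 (@truncn_eqP _ m) ?ltr_nat//.
  by rewrite [m%:R * _]mulrCA divff ?lt0r_neq0// mulr1 subrr normr0 ltNge delta0.
have [z xz Hz] := right_near_gt Ix x1 dx.
have [km k1 k2] := truncn_le_mesh m Ix; set k := Num.truncn _ in km k1 k2.
have {}km : (k < m)%N.
  by rewrite -(ltr_nat R) (le_lt_trans k1)// -[ltRHS]mulr1 ltr_pM2l.
exists k => //.
have xk : x < k.+1%:R / m%:R by rewrite ltr_pdivlMr// mulrC.
(* Below [z] the deviation persists; below the end of the cell the step path keeps its value. *)
pose z' := Num.min z (k.+1%:R / m%:R).
have xz' : 0 < z' - x by rewrite subr_gt0 lt_min xz.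
near=> K.
have K0 : 0 < (K.+1%:R : R) by [].
have mK : (K.+1%:R : R)^-1 < z' - x by near: K; exact: (near_infty_natSinv_lt (PosNum xz')).
(* The position of [x] in its cell, in units of the fine grid. Taking [j.+1] rather than [j] puts
   the grid point [y] strictly to the right of [x], by at most one fine step. *)
pose u : R := (m%:R * x - k%:R) * K.+1%:R.
have u0 : 0 <= u by rewrite mulr_ge0// subr_ge0.
have [j1 j2] := truncn_itv_nat u0; set j := Num.truncn u in j1 j2.
pose y : R := (k%:R + j.+1%:R / K.+1%:R) / m%:R.
have xy : x < y.
  rewrite /y ltr_pdivlMr// mulrC -ltrBlDl ltr_pdivlMr//.
have yz : y < z'.
  rewrite -(ltrD2r (- x)); apply: le_lt_trans mK; rewrite lerBlDr /y ler_pdivrMr//.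
  rewrite -natr1 mulrDl mul1r addrA mulrDl addrC lerD//.
    by rewrite ler_peMr ?invr_ge0// ler1n.
  by rewrite -lerBrDl ler_pdivrMr// mulrC [x * _]mulrC mulrC.
have [yz1 yk] : y < z /\ y < k.+1%:R / m%:R by move: yz; rewrite /z' lt_min => /andP[].
have ky : m%:R * y = k%:R + j.+1%:R / K.+1%:R.
  by rewrite /y mulrC mulfVK// lt0r_neq0.
have y1 : y <= 1 by rewrite (le_trans (ltW yk))// ler_pdivrMr// mul1r ler_nat.
have Iy : `[0, 1]%classic y by rewrite /= in_itv/= y1 (le_trans x0 (ltW xy)).
exists j.+1.
  move: yk; rewrite /y ltr_pM2r ?invr_gt0// -[k.+1%:R]natr1 ltrD2l ltr_pdivrMr// mul1r ltr_nat.
  exact: ltnW.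
have := Hz y xy yz1 y1; rewrite fv// SE// ky (@truncn_eqP _ k); first last.
- by rewrite -ky mulrC -ltr_pdivlMr.
- by rewrite lerDl.
rewrite -mulrBr; congr (_ < `|_ * (v _ - _)|).
by rewrite /y; field; rewrite !lt0r_neq0.
Unshelve. all: by end_near. Qed.

Lemma Rintegral_sum d (T : measurableType d) (R : realType)
    (mu : {measure set T -> \bar R}) (I : Type) (s : seq I) (f : I -> T -> R) :
  (forall i, mu.-integrable setT (EFin \o f i)) ->
  \int[mu]_x (\sum_(i <- s) f i x) = \sum_(i <- s) \int[mu]_x f i x.
Proof.
move=> intf; rewrite /Rintegral; under eq_integral do rewrite -sumEFin.
have fin i : (\int[mu]_x (f i x)%:E)%E \is a fin_num
  by exact: (integrable_fin_num measurableT (intf i)).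
rewrite (integral_sum measurableT intf) (eq_bigr (fun i => (fine (\int[mu]_x (f i x)%:E)%E)%:E)).
  by rewrite sumEFin.
by move=> i _; rewrite fineK.
Qed.

(** * Convergence of the processes *)

Section donsker.
Context d (T : measurableType d) (R : realType) (P : probability T R).
Variables (V : R -> {RV P >-> R}) (sigma : R).
Hypotheses (V_indep : independent_increments P `[0, +oo[ V)
  (V_homog : homogeneous P V) (V_centered : centered P V)
  (V_0 : {ae P, forall w, V 0 w = 0}) (sigma_ge0 : 0 <= sigma)
  (V_var : ('E_P[(fun w => V 1 w ^+ 2)%R])%E = (sigma ^+ 2)%:E).
Variable X : R -> {RV P >-> D01 R}.
Hypothesis X_def : forall t, 0 < t ->
    random_element_of (fun x w => (Num.sqrt t)^-1 * V (t * x) w) (X t).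
Context d' (T' : measurableType d') (P' : probability T' R).
Variables (W : R -> {RV P' >-> R}) (W_Wiener : standard_Wiener P' `[0, 1] W).
Variable Z : {RV P' >-> D01 R}.
Hypothesis Z_def : random_element_of (fun x w => sigma * W x w) Z.

Lemma limit_path : {ae P', forall w, [/\ {within `[0, 1], continuous (fun x => sigma * W x w)},
  sigma * W 0 w = 0 & forall x, `[0, 1]%classic x -> Z w x = sigma * W x w]}.
Proof.
have [W0 _ _ cW] := W_Wiener; near=> w; split.
- have : {within `[0, 1], continuous (W ^~ w)} by near: w; exact: cW.
  move=> /subspace_continuousP cw; apply/subspace_continuousP => x Ix.
  by apply: cvgM; [exact: cvg_cst|exact: cw].
- have -> : W 0 w = 0 by near: w; exact: W0.
  by rewrite mulr0.
- by near: w; exact: Z_def.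
Unshelve. all: by end_near. Qed.

Lemma limit_separable : {ae P', forall w, forall e, 0 < e ->
  exists m s, unif_dist (Z w) (stepD m (map ratr s)) <= e}.
Proof.
by apply: filterS limit_path => w [cw w0 Zw] e e0; exact: stepD_rat_dense cw w0 Zw e0.
Qed.

Let Wstep m w := mkseq (fun i =>
  sigma * (W (i.+1%:R * m%:R^-1) w - W (i%:R * m%:R^-1) w)) m.

Lemma limit_step F : bounded_lipschitz F ->
  \int[P']_w F (stepD m.+1 (Wstep m.+1 w)) @[m --> \oo] --> \int[P']_w F (Z w).
Proof.
move=> [mF [M FM] [L FL]]; apply: (@bounded_cvg_Rintegral _ _ _ _ _ _ M) => //.
- move=> m; apply: (measurableT_comp mF); apply: measurable_stepD => i.
  exact: measurable_Winc.
- exact: (measurableT_comp mF).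
apply: filterS limit_path => w [cw w0 Zw]; apply/cvgrPdist_le => e e0.
have L0 : 0 < `|L| + 1 by rewrite ltr_wpDl.
have eL : 0 < e / (`|L| + 1) by rewrite divr_gt0.
apply: filterS (segment_uniform_continuity cw eL) => m Hm.
have := @stepD_increments _ (fun x => sigma * W x w) (Z w) _ m.+1 isT w0 Zw Hm.
rewrite (_ : mkseq _ _ = Wstep m.+1 w); last first.
  by apply: eq_mkseq => i; rewrite mulrBr.
move=> H; rewrite (le_trans (FL _ _))// (le_trans (ler_wpM2r (unif_dist_ge0 _ _) (ler_norm L)))//.
rewrite (le_trans (ler_wpM2l _ H))// mulrCA ler_piMr ?(ltW e0)//.
by rewrite ler_pdivrMr// mul1r lerDl.
Qed.

(** Where the paths are within [delta] the Lipschitz bound applies; on the exceptional event [D] the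
    difference is at most [2 * M]. A union bound over [m] blocks, each of probability at most
    [eta / m%:R], bounds the probability of [D]. *)
Lemma process_step (F : D01 R -> R) (M L delta eta t : R) (m : nat) :
  (0 < m)%N -> 0 < t -> 0 <= delta -> 0 <= eta -> measurable_fun setT F -> (forall f, `|F f| <= M) ->
  (forall f h, `|F f - F h| <= L * unif_dist f h) -> 0 <= L ->
  (forall (K : nat) (s : R), (0 < K)%N -> 0 <= s ->
    m%:R * \int[P]_w (walk_exceeds delta 0
      (block V (Num.sqrt t)^-1 s (t / m%:R / K%:R) K w))%:R <= eta) ->
  `|\int[P]_w F (X t w) - \int[P]_w F (stepD m (block V (Num.sqrt t)^-1 0 (t / m%:R) m w))|
    <= L * delta + 2 * M * eta.
Proof.
move=> m0 t0 delta0 eta0 mF FM FL L0 tail; set c := (Num.sqrt t)^-1 in tail *.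
have M0 : 0 <= M by apply: le_trans (FM (D01_zero R)).
pose S w := stepD m (block V c 0 (t / m%:R) m w).
have mS : measurable_fun setT S.
  by apply: measurable_stepD => i; apply: measurable_funM => //; exact: measurable_funB.
pose D w := delta < unif_dist (X t w) (S w).
have mdist_XS : measurable_fun setT (fun w => unif_dist (X t w) (S w)).
  exact: measurable_unif_dist.
have mD : measurable_fun setT (fun w => (D w)%:R : R).
  exact: measurable_ind_gt.
pose a i K w := walk_exceeds delta 0 (block V c (i%:R * (t / m%:R)) (t / m%:R / K.+1%:R) K.+1 w).
have ma i K : measurable_fun setT (fun w => (a i K w)%:R : R).
  apply: (seq_measurable_walk delta 0 K.+1 (p := fun=> 0)) => // j.
  by apply: measurable_funM => //; exact: measurable_funB.
have ia i K : P.-integrable setT (EFin \o (fun w => (a i K w)%:R : R)).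
  by apply: (@bounded_integrable _ _ _ _ _ 1) => // w; exact: norm_bool_le1.
have tm0 : 0 <= t / m%:R by rewrite divr_ge0// ltW.
pose A K w : R := \sum_(i < m) (a i K w)%:R.
have A0 K w : 0 <= A K w by apply: sumr_ge0.
have mA K : measurable_fun setT (A K) by apply: measurable_sum.
have iA K : \int[P]_w A K w <= eta.
  have -> : \int[P]_w A K w = \sum_(i < m) \int[P]_w (a i K w)%:R.
    by apply: Rintegral_sum => i.
  have m0' : 0 < (m%:R : R) by rewrite ltr0n.
  have Hi (i : 'I_m) : \int[P]_w (a i K w)%:R <= eta / m%:R.
    by rewrite ler_pdivlMr// mulrC; apply: tail => //; exact: mulr_ge0.
  rewrite (le_trans (ler_sum _ (fun i _ => Hi i)))// sumr_const card_ord.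
  by rewrite -[leLHS]mulr_natr mulfVK// lt0r_neq0.
(* By right continuity, on the event D the K-th grid detects an increment larger
   than delta as soon as K is large; the threshold depends on w. *)
have iD : \int[P]_w (D w)%:R <= eta.
  have cvgD : \int[P]_w ((D w)%:R * clip (A K w)) @[K --> \oo] --> \int[P]_w ((D w)%:R : R).
    apply: (@bounded_cvg_Rintegral _ _ _ _ _ _ 1) => //.
    - move=> K; apply: measurable_funM => //.
      exact: (measurableT_comp (@measurable_clip R)).
    - move=> K w; rewrite normrM mulr_ile1 ?norm_bool_le1//.
      by rewrite ger0_norm ?clip_ge0 ?clip_le1.
    apply: filterS2 V_0 (X_def t0) => w V0w Xw.
    rewrite /D; case: ltP => [Dw|_]; last first.
      by apply: cvg_near_cst; apply: nearW => K; rewrite mul0r.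
    apply: cvg_near_cst.
    have [i im] := @step_path_dist _ (X t w) (V ^~ w) c t delta m m0 t0 delta0 V0w Xw Dw.
    apply: filterS => K [j jK dj]; rewrite mul1r clip_eq1//.
    rewrite /A (bigD1 (Ordinal im))//= /a (block_exceeds jK dj) lerDl.
    exact: sumr_ge0.
  apply: (@cvgr_to_le _ _ _ _ _ _ _ cvgD); apply: nearW => K.
  apply: le_trans (iA K); apply: le_Rintegral => //.
  - apply: (@bounded_integrable _ _ _ _ _ 1).
      apply: measurable_funM => //; exact: (measurableT_comp (@measurable_clip R)).
    move=> w; rewrite normrM mulr_ile1 ?norm_bool_le1//.
    by rewrite ger0_norm ?clip_ge0 ?clip_le1.
  - apply: (@bounded_integrable _ _ _ _ _ m%:R) => // w; rewrite ger0_norm//.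
    have -> : m%:R = \sum_(i < m) 1 :> R by rewrite sumr_const card_ord.
    by apply: ler_sum => i _; rewrite lern1 leq_b1.
  - move=> w _; apply: (@le_trans _ _ (clip (A K w))).
      by rewrite ler_piMl ?clip_ge0// lern1 leq_b1.
    by rewrite /clip ge_min ge_max lexx A0 orbT.
have mFX : measurable_fun setT (fun w => F (X t w)) by exact: (measurableT_comp mF).
have mFS : measurable_fun setT (fun w => F (S w)) by exact: (measurableT_comp mF).
have iFX : P.-integrable setT (EFin \o (fun w => F (X t w))) by exact: bounded_integrable mFX _.
have iFS : P.-integrable setT (EFin \o (fun w => F (S w))) by exact: bounded_integrable mFS _.
have iFXS : P.-integrable setT (EFin \o (fun w => F (X t w) - F (S w))).
  exact: (integrableB _ iFX iFS).
have iDD : P.-integrable setT (EFin \o (fun w => (D w)%:R : R)).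
  by apply: (@bounded_integrable _ _ _ _ _ 1) => // w; exact: norm_bool_le1.
have iMD : P.-integrable setT (EFin \o (fun w => 2 * M * (D w)%:R : R)).
  apply: (@bounded_integrable _ _ _ _ _ (2 * M)).
    exact: measurable_funM.
  move=> w; rewrite normrM ger0_norm ?mulr_ge0// ler_piMr ?mulr_ge0//.
  exact: norm_bool_le1.
have iLd : P.-integrable setT (EFin \o (fun=> L * delta)).
  exact: finite_measure_integrable_cst.
rewrite -[X in _ - X]/(\int[P]_w F (S w)) -RintegralB// (le_trans (le_normr_Rintegral _ iFXS))//.
apply: (@le_trans _ _ (L * delta + 2 * M * \int[P]_w (D w)%:R)); last first.
  by rewrite lerD2l ler_wpM2l// mulr_ge0.
rewrite -[in X in _ <= X + _](Rintegral_cst1 P (L * delta)) -RintegralZl// -RintegralD//.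
apply: le_Rintegral => //.
- exact: (integrable_abse iFXS).
- exact: (integrableD _ iLd iMD).
move=> w _; rewrite /D; case: ltP => Dw.
  rewrite mulr1 (le_trans (ler_normB _ _))// mulrDl mul1r.
  by rewrite (le_trans (lerD (FM _) (FM _)))// lerDr mulr_ge0.
by rewrite mulr0 addr0 (le_trans (FL _ _))// ler_wpM2l.
Qed.

Lemma bounded_lipschitz_donsker F e : bounded_lipschitz F -> 0 < e ->
  exists2 t0, 0 < t0 & forall t, t0 <= t ->
    `|\int[P]_w F (X t w) - \int[P']_w F (Z w)| <= e.
Proof.
move=> blF e0; have [mF [M FM] [L0 FL0]] := blF.
pose L := `|L0|; have FL f h : `|F f - F h| <= L * unif_dist f h.
  rewrite (le_trans (FL0 _ _))// ler_wpM2r ?unif_dist_ge0//; exact: ler_norm.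
have L_ge0 : 0 <= L by exact: normr_ge0.
have M_ge0 : 0 <= M by apply: le_trans (FM (D01_zero R)).
have L1 : 0 < L + 1 by rewrite ltr_wpDl.
have M1 : 0 < M + 1 by rewrite ltr_wpDl.
have e8 : 0 < e / 8 by rewrite divr_gt0.
have delta0 : 0 < e / 8 / (L + 1) by rewrite divr_gt0.
have eta0 : 0 < e / 8 / (M + 1) by rewrite divr_gt0.
have [m0 Hm0] := grid_tail V_indep V_homog V_centered V_0 sigma_ge0 V_var W_Wiener delta0 eta0.
have /cvgrPdist_le/(_ _ e8)[m1 _ Hm1] := limit_step blF.
(* One mesh serves both purposes: it exceeds [m0], and its predecessor is at least [m1], the limit
   for [Z] being indexed by the predecessor. *)
pose m := (m0 + m1).+1.
have m_gt0 : (0 < m)%N by [].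
have m_gt0' : 0 < (m%:R : R) by rewrite ltr0n.
have [t1 t10 Ht1] := Hm0 m (leq_addr _ _ : (m0 < m)%N).
have hZ := Hm1 (m0 + m1)%N (leq_addl _ _).
have mH : seq_measurable m (fun s => F (stepD m s)).
  move=> d1 T1 p Y mp mY; apply: (measurableT_comp mF); exact: measurable_stepD.
have HM s : size s = m -> `|F (stepD m s)| <= M by [].
(* The precision is divided by [m] because all [m] increments will be replaced in turn. *)
have em : 0 < e / 8 / m%:R by rewrite divr_gt0.
have [t2 t20 Ht2] := clt_bounded_lipschitz V_indep V_homog V_centered V_0 sigma_ge0
  V_var W_Wiener M L m_gt0 em.
exists (Num.max t1 t2) => [|t]; first by rewrite lt_max t10.
rewrite ge_max => /andP[t1t t2t].
have t0 : 0 < t by rewrite (lt_le_trans t10).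
have hX := process_step m_gt0 t0 (ltW delta0) (ltW eta0) mF FM FL L_ge0 (Ht1 t t1t).
have tm0 : 0 <= t / m%:R by rewrite divr_ge0// ltW.
rewrite (inc_iter_int V_indep V_homog (Num.sqrt t)^-1 (lexx 0) tm0 mH HM) in hX.
have im0 : 0 < (m%:R : R)^-1 by rewrite invr_gt0.
have mim : m%:R * m%:R^-1 <= 1 :> R by rewrite divff// lt0r_neq0.
rewrite -/m /Wstep (Winc_iter_int sigma W_Wiener im0 mim mH HM) in hZ.
have hS := iter_int_swap mH HM (e := e / 8 / m%:R) (mu := inc_law V (Num.sqrt t)^-1 (t / m%:R))
  (nu := limit_law sigma (Num.sqrt m%:R^-1)).
have {}hS : `|iter_int (inc_law V (Num.sqrt t)^-1 (t / m%:R)) m (fun s => F (stepD m s)) -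
    iter_int (limit_law sigma (Num.sqrt m%:R^-1)) m (fun s => F (stepD m s))| <= e / 8.
  rewrite (_ : e / 8 = m%:R * (e / 8 / m%:R)); last by rewrite [RHS]mulrC mulfVK// lt0r_neq0.
  apply: hS => p s _; apply: (Ht2 t t2t (fun y => F (stepD m (p ++ y :: s)))) => [y z|y].
    by rewrite (le_trans (FL _ _))// ler_wpM2l// stepD_dist_coord.
  exact: FM.
have hLd : L * (e / 8 / (L + 1)) <= e / 8.
  by rewrite mulrCA ler_piMr ?(ltW e8)// ler_pdivrMr// mul1r lerDl.
have hMd : M * (e / 8 / (M + 1)) <= e / 8.
  by rewrite mulrCA ler_piMr ?(ltW e8)// ler_pdivrMr// mul1r lerDl.
move: hX hS hZ.
set a1 := \int[P]_w _; set b1 := iter_int _ _ _; set c1 := iter_int _ _ _.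
set z1 := \int[P']_w _ => hX hS hZ.
rewrite (_ : a1 - z1 = (a1 - b1) + (b1 - c1) - (z1 - c1)); last by ring.
rewrite (le_trans (ler_normB _ _))// (le_trans (lerD (ler_normD _ _) (lexx _)))//.
have : 2 * M * (e / 8 / (M + 1)) <= e / 4.
  by rewrite -mulrA (le_trans (ler_wpM2l _ hMd))//; lra.
by lra.
Qed.

End donsker.

Theorem theorem2 (R : realType)
  (d : measure_display) (T : measurableType d) (P : probability T R)
  (V : R -> {RV P >-> R}) (sigma : R)
  (V_indep : independent_increments P `[0, +oo[ V)
  (V_homog : homogeneous P V)
  (V_centered : centered P V)
  (V_cadlag : {ae P, forall w, cadlag `[0, +oo[ (V ^~ w)})
  (V_0 : {ae P, forall w, V 0 w = 0})
  (sigma_ge0 : 0 <= sigma)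
  (V_var : ('E_P[(fun w => V 1 w ^+ 2)%R])%E = (sigma ^+ 2)%:E)
  (X : R -> {RV P >-> D01 R})
  (X_def : forall t, 0 < t ->
    random_element_of (fun x w => (Num.sqrt t)^-1 * V (t * x) w) (X t))
  (d' : measure_display) (T' : measurableType d') (P' : probability T' R)
  (W : R -> {RV P' >-> R}) (W_Wiener : standard_Wiener P' `[0, 1] W)
  (Z : {RV P' >-> D01 R})
  (Z_def : random_element_of (fun x w => sigma * W x w) Z) :
  cvg_in_distribution X Z.
Proof.
apply: bounded_lipschitz_cvg (limit_separable W_Wiener Z_def) _ => F blF e e0.
exact: (bounded_lipschitz_donsker V_indep V_homog V_centered V_0 sigma_ge0 V_var
  X_def W_Wiener Z_def blF e0).
Qed.
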